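(* Let $\mathcal{G}=[\mathcal{G}_1\rightrightarrows M]$ be a topological groupoid whose source map $s\colon\mathcal{G}_1\to M$ is locally a Hurewicz fibration (respectively, locally a Serre fibration), and let $(F,1_M)\colon[\mathcal{G}_1\rightrightarrows M]\to[\mathcal{H}_1\rightrightarrows M]$ be a topological groupoid extension, with $\mathcal{H}=[\mathcal{H}_1\rightrightarrows M]$. Then the morphism of stacks $F\colon B\mathcal{G}\to B\mathcal{H}$ associated to this extension, which is a gerbe over $B\mathcal{H}$, is a Hurewicz gerbe (respectively, a Serre gerbe).
   Context: Throughout, spaces are objects of the category $\mathrm{CGTop}$ of compactly generated Hausdorff spaces, with the open-cover Grothendieck topology. A stack is a category fibered in groupoids over this site satisfying descent for open covers; morphisms of stacks are morphisms of fibered categories, and ''isomorphic'' stacks means equivalent as fibered categories. For a space $U$, $\underline{U}$ (also written $U$) denotes the stack represented by $U$. A continuous map $f\colon X\to Y$ admits local sections (is a map of local sections) if there is an open cover $\{U_\alpha\}$ of $Y$ and a continuous section $U_\alpha\to X$ of $f$ for each $\alpha$. A continuous map $f\colon X\to Y$ is locally a Hurewicz (respectively Serre) fibration if for every $x\in X$ there are open neighbourhoods $U$ of $x$ and $V$ of $f(x)$ such that $f$ restricts to a Hurewicz (respectively Serre) fibration $U\to V$. A topological groupoid $\mathcal{G}=[\mathcal{G}_1\rightrightarrows\mathcal{G}_0]$ is a groupoid internal to spaces, with source $s$ and target $t$; $\gamma\circ\gamma'$ is defined when $s(\gamma)=t(\gamma')$. A morphism of topological groupoids is a continuous functor. A topological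 groupoid extension of $[\mathcal{H}_1\rightrightarrows M]$ is a morphism of topological groupoids $(F,1_M)\colon[\mathcal{G}_1\rightrightarrows M]\to[\mathcal{H}_1\rightrightarrows M]$, the identity on objects, such that $F\colon\mathcal{G}_1\to\mathcal{H}_1$ admits local sections. A right action of $\mathcal{G}$ on a space $P$ consists of continuous maps $a\colon P\to\mathcal{G}_0$ and $P\times_{a,\mathcal{G}_0,t}\mathcal{G}_1\to P$, $(p,\gamma)\mapsto p\cdot\gamma$, with $a(p\cdot\gamma)=s(\gamma)$, $p\cdot 1_{a(p)}=p$, $(p\cdot\gamma)\cdot\gamma'=p\cdot(\gamma\circ\gamma')$. A principal $\mathcal{G}$-bundle over a space $N$ is a space $P$ with a right $\mathcal{G}$-action and a continuous map $\pi\colon P\to N$ admitting local sections, such that $\pi(p\cdot\gamma)=\pi(p)$ and $P\times_{\mathcal{G}_0}\mathcal{G}_1\to P\times_N P$, $(p,\gamma)\mapsto(p,p\cdot\gamma)$, is a homeomorphism. Morphisms of principal bundles are pairs of continuous maps (on total and base spaces) commuting with projections, the maps $a$, and the actions. $B\mathcal{G}$ is the stack of principal $\mathcal{G}$-bundles (with $(P,\pi,N)\mapsto N$). A topological stack is a stack isomorphic to $B\mathcal{G}$ for some topological groupoid $\mathcal{G}$ (a presentation of the stack). The morphism of stacks $B\mathcal{G}\to B\mathcal{H}$ associated to a morphism of topological groupoids $(\phi_1,\phi_0)\colon\mathcal{G}\to\mathcal{H}$ is defined as follows. Let $Q=\mathcal{G}_0\times_{\phi_0,\mathcal{H}_0,t}\mathcal{H}_1$,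 with left $\mathcal{G}$-action $\gamma\cdot(a,\delta)=(t(\gamma),\phi_1(\gamma)\circ\delta)$ along $\mathrm{pr}_1\colon Q\to\mathcal{G}_0$ and right $\mathcal{H}$-action $(a,\delta)\cdot\delta'=(a,\delta\circ\delta')$ along $s\circ\mathrm{pr}_2\colon Q\to\mathcal{H}_0$. A principal $\mathcal{G}$-bundle $P\to N$ is sent to the principal $\mathcal{H}$-bundle $(P\times_{\mathcal{G}_0}Q)/\mathcal{G}_1\to N$, the quotient by the action $\gamma\cdot(p,q)=(p\cdot\gamma,\gamma^{-1}\cdot q)$, with the induced right $\mathcal{H}$-action; similarly on morphisms. The $2$-fiber product $\mathcal{Y}\times_{\mathcal{X}}\mathcal{Z}$ of morphisms $f\colon\mathcal{Y}\to\mathcal{X}$, $g\colon\mathcal{Z}\to\mathcal{X}$ has objects triples $(y,z,\alpha)$ with $y,z$ over the same space and $\alpha\colon f(y)\to g(z)$ an arrow of $\mathcal{X}$ (over the identity), and morphisms the pairs $(u,v)$ over the same base map with $\alpha'\circ f(u)=g(v)\circ\alpha$. A morphism of stacks $F\colon\mathcal{D}\to\mathcal{C}$ is an epimorphism if for every space $U$ and every morphism $q\colon\underline{U}\to\mathcal{C}$ there are an open cover $\{\sigma_\alpha\colon U_\alpha\to U\}$ and morphisms $q_\alpha\colon\underline{U_\alpha}\to\mathcal{D}$ with $2$-isomorphisms $F\circ q_\alpha\Rightarrow q\circ\sigma_\alpha$ for each $\alpha$. A morphism of topological stacks $F\colon\mathcal{D}\to\mathcal{C}$ is a gerbe over $\mathcal{C}$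 if both $F$ and the diagonal morphism $\Delta_F\colon\mathcal{D}\to\mathcal{D}\times_{\mathcal{C}}\mathcal{D}$, $d\mapsto(d,d,1_{F(d)})$, are epimorphisms of stacks. A topological stack $\mathcal{D}$ is a Hurewicz (respectively Serre) stack if it admits a presentation by a topological groupoid $[R\rightrightarrows X]$ whose source map $s\colon R\to X$ (hence also its target map) is locally a Hurewicz (respectively Serre) fibration. A morphism of topological stacks $F\colon\mathcal{D}\to\mathcal{C}$ is a Hurewicz (respectively Serre) morphism if for every space $U$ and every morphism $U\to\mathcal{C}$ the $2$-fiber product $\mathcal{D}\times_{\mathcal{C}}U$ is a Hurewicz (respectively Serre) stack. A gerbe $F\colon\mathcal{D}\to\mathcal{C}$ is a Hurewicz (respectively Serre) gerbe if $F$ is a Hurewicz (respectively Serre) morphism. *)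

(* Defs.v *)
From HB Require Import structures.
From mathcomp Require Import all_boot all_order all_algebra generic_quotient.
From mathcomp Require Import all_classical all_reals topology.

Set Implicit Arguments.
Unset Strict Implicit.
Unset Printing Implicit Defensive.

Import Order.TTheory GRing.Theory Num.Theory numFieldTopology.Exports.
Local Open Scope classical_set_scope.
Local Open Scope quotient_scope.

(* [U] meets every compact set [K] in a relatively open subset of [K]. *)
Definition k_open (T : topologicalType) (U : set T) : Prop :=
  forall (K : set T) (x : T), compact K -> K x -> U x -> within K (nbhs x) U.

Definition compactly_generated (T : topologicalType) : Prop :=
  forall U : set T, k_open U -> open U.

(* [T] with the k-open sets as its open sets; limits in the category of
   compactly generated Hausdorff spaces are the usual ones, kified. *)
Definition kify (T : topologicalType) : Type := T.

Section Kify.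
Variable T : topologicalType.

Lemma k_openT : k_open [set: T].
Proof. by move=> K x _ _ _; exact: nearW. Qed.

Lemma k_openI : setI_closed (@k_open T).
Proof. by move=> A B oA oB K x cK Kx [Ax Bx]; apply: filterI; [exact: oA|exact: oB]. Qed.

Lemma k_open_bigcup (I : Type) (f : I -> set T) :
  (forall i, k_open (f i)) -> k_open (\bigcup_i f i).
Proof.
move=> of_ K x cK Kx [i _ fx].
by apply: (@filterS _ (within K (nbhs x)) _ (f i)); [move=> y fy; exists i|exact: of_].
Qed.

HB.instance Definition _ := Choice.on (kify T).
HB.instance Definition _ :=
  isOpenTopological.Build (kify T) k_openT k_openI k_open_bigcup.

Lemma open_k_open (U : set T) : open U -> k_open U.
Proof.
move=> oU K x _ _ Ux; by apply: (filterS _ (open_nbhs_nbhs (conj oU Ux))).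
Qed.

Lemma nbhs_kify (x : T) (U : set T) : nbhs x U -> @nbhs _ (kify T) x U.
Proof.
rewrite nbhsE => -[V [oV Vx] VU]; rewrite nbhsE; exists V => //.
by split=> //; exact: open_k_open.
Qed.

Lemma unkify_continuous : continuous (id : kify T -> T).
Proof. by move=> x U; exact: nbhs_kify. Qed.

Lemma within_kify (K : set T) (x : T) (U : set T) : compact K -> K x ->
  @nbhs _ (kify T) x U -> within K (nbhs x) U.
Proof.
move=> cK Kx; rewrite (@nbhsE (kify T)) => -[V [oV Vx] VU].
have := oV K x cK Kx Vx; by apply: filterS => y Vy; exact: VU.
Qed.

Lemma compact_kify (K : set T) : compact K -> @compact (kify T) K.
Proof.
move=> cK F PF FK; have [x [Kx clx]] := cK F PF FK.
exists x; split=> // A B FA Bx.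
have W := within_kify cK Kx Bx.
have [y [[Ay Ky] By]] := clx (A `&` K) _ (filterI FA FK) W.
by exists y; split=> //; exact: By.
Qed.

Lemma compact_unkify (K : set T) : @compact (kify T) K -> compact K.
Proof.
move=> cK F PF FK; have [x [Kx clx]] := cK F PF FK.
by exists x; split=> // A B FA Bx; apply: clx => //; exact: nbhs_kify.
Qed.

Lemma kify_hausdorff : hausdorff_space T -> hausdorff_space (kify T).
Proof.
move=> hT x y cl; apply: hT => A B Ax By; apply: cl; exact: nbhs_kify.
Qed.

Lemma kify_compactly_generated : compactly_generated (kify T).
Proof.
move=> U kU; suff: @k_open T U by [].
move=> K x cK Kx Ux; have := kU K x (compact_kify cK) Kx Ux => /(within_kify cK Kx).
by apply: (@filterS _ (nbhs x)) => y h Ky; exact: h.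
Qed.

End Kify.

Record cgtop := CGTop {
  cg_sort :> topologicalType;
  cg_hausdorff : hausdorff_space cg_sort;
  cg_generated : compactly_generated cg_sort }.

Lemma continuous_compact_image (X Y : topologicalType) (f : X -> Y) (K : set X) :
  continuous f -> compact K -> compact (f @` K).
Proof.
by move=> cf cK; apply: continuous_compact => //; exact: continuous_subspaceT.
Qed.

Lemma kify_continuous (X : cgtop) (T : topologicalType) (f : X -> T) :
  continuous f -> continuous (f : X -> kify T).
Proof.
move=> cf; apply/continuousP => U oU.
apply: (@cg_generated X) => K x cK Kx Ux.
have h := oU (f @` K) (f x) (continuous_compact_image cf cK) (imageP _ Kx) Ux.
apply: (@filterS _ (nbhs x) _ _ _ _ (cf x _ h)) => y Uy Ky.
by apply: Uy; exact: imageP.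
Qed.

Definition cg_kify (T : topologicalType) (hT : hausdorff_space T) : cgtop :=
  CGTop (kify_hausdorff hT) (@kify_compactly_generated T).

Lemma set_type_hausdorff (T : topologicalType) (A : set T) :
  hausdorff_space T -> hausdorff_space A.
Proof.
move=> hT x y cl; apply: val_inj; apply: hT => U V Ux Vy.
have cv : continuous (set_val : A -> T) by exact: initial_continuous.
have [z [Uz Vz]] := cl _ _ (cv x _ Ux) (cv y _ Vy).
by exists (set_val z).
Qed.

Lemma prod_hausdorff (X Y : topologicalType) :
  hausdorff_space X -> hausdorff_space Y -> hausdorff_space (X * Y)%type.
Proof.
move=> hX hY [x y] [x' y'] cl; congr pair.
- apply: hX => A B Ax Bx.
  have [[a b] [/= [? ?] [? ?]]] := cl (A `*` setT) (B `*` setT)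
    (ex_intro2 _ _ (A, setT) (conj Ax filterT) (@subset_refl _ _))
    (ex_intro2 _ _ (B, setT) (conj Bx filterT) (@subset_refl _ _)).
  by exists a.
- apply: hY => A B Ax Bx.
  have [[a b] [/= [? ?] [? ?]]] := cl (setT `*` A) (setT `*` B)
    (ex_intro2 _ _ (setT, A) (conj filterT Ax) (@subset_refl _ _))
    (ex_intro2 _ _ (setT, B) (conj filterT Bx) (@subset_refl _ _)).
  by exists b.
Qed.

(* For [A] open (or closed) this is the ordinary subspace topology; the open
   case is [open_incl_image] below together with [incl_continuous]. *)
Definition cg_sub (X : cgtop) (A : set X) : cgtop :=
  cg_kify (set_type_hausdorff (A := A) (@cg_hausdorff X)).

Section Sub.
Variables (X : cgtop) (A : set X).

Definition incl_fun (x : cg_sub A) : X := set_val (x : A).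
Lemma incl_continuous : continuous incl_fun.
Proof.
move=> x; apply: (@continuous_comp (kify A) A X); first exact: unkify_continuous.
exact: initial_continuous.
Qed.
HB.instance Definition _ := isContinuous.Build _ _ incl_fun incl_continuous.
Definition incl : continuousType (cg_sub A) X := incl_fun.

Definition sub_elt (x : X) (Ax : A x) : cg_sub A := exist _ x (mem_set Ax) : A.

Lemma inclK (x : X) (Ax : A x) : incl (sub_elt Ax) = x. Proof. by []. Qed.
Lemma incl_inj : injective incl. Proof. exact: val_inj. Qed.
Lemma inclP (x : cg_sub A) : A (incl x). Proof. exact: set_mem (valP (x : A)). Qed.

Lemma cg_sub_continuous (Y : cgtop) (f : Y -> cg_sub A) :
  continuous (incl \o f) -> continuous f.
Proof.
move=> cf; apply: (@kify_continuous Y (A : topologicalType) f).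
exact: continuous_comp_initial.
Qed.

End Sub.

Lemma compact_avoid (T : topologicalType) (C : set T) (x : T) :
  hausdorff_space T -> compact C -> ~ C x ->
  exists2 W, nbhs x W & forall y, C y -> ~ closure W y.
Proof.
move=> hT /compact_near_coveringP cC Cx.
have := cC _ (powerset_filter_from (nbhs x)) (fun W y => ~ closure W y) _.
case.
  move=> y Cy; have xy : x != y by apply: contra_notN Cx => /eqP ->.
  move: hT; rewrite open_hausdorff => /(_ _ _ xy)[[A B]] [/=].
  rewrite !inE => Ax By [oA oB AB0].
  exists (B, [set V | nbhs x V /\ V `<=` A]).
    split=> /=; first exact: open_nbhs_nbhs.
    apply: powerset_filter_fromP; exact: open_nbhs_nbhs.
  move=> [z V] /= [Bz [_ VA]] /(_ B (open_nbhs_nbhs (conj oB Bz))).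
  by move=> [t [/VA At Bt]]; have : (A `&` B) t by []; rewrite [X in X t]AB0.
move=> M [MF _ [V MV]] MC; exists V; first exact: MF.
by move=> y Cy; exact: MC.
Qed.

Lemma open_incl_image (X : cgtop) (A : set X) (B : set (cg_sub A)) :
  open A -> open B -> open (incl A @` B).
Proof.
move=> oA oB; apply: (@cg_generated X) => K x cK Kx [b Bb bx].
have hX := @cg_hausdorff X.
have cKA : compact (K `\` A).
  by apply: (subclosed_compact _ cK) => [|? []//]; apply: closedI;
    [exact: compact_closed|exact: open_closedC].
have Ax : A x by rewrite -bx; exact: inclP.
have [|W Wx WC] := compact_avoid hX cKA (x := x); first by move=> [].
pose L := K `&` closure W.
have cL : compact L.
  by apply: (subclosed_compact _ cK) => [|? []//]; apply: closedI;
    [exact: compact_closed|exact: closed_closure].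
have LA y : L y -> A y.
  by move=> [Ky Wy]; apply: contrapT => nA; exact: (WC y).
pose L' : set A := [set z | L (set_val z)].
have cL' : compact L'.
  move=> F PF FL'.
  have [|y [Ly cy]] := cL (set_val @ F) _ _.
    by apply: (@filterS _ F _ L').
  exists (exist _ y (mem_set (LA y Ly))); split=> // P Q FP Qy.
  case: Qy => Q' [[O oO OQ'] Q'y Q'Q].
  have Oy : nbhs y O.
    by apply: open_nbhs_nbhs; split=> //; rewrite -OQ' in Q'y; exact: Q'y.
  have FP' : (set_val @ F) (set_val @` P).
    by apply: (@filterS _ F _ P) => // p Pp; exact: imageP.
  have [_ [[p Pp <-] Op]] := cy _ _ FP' Oy.
  by exists p; split=> //; apply: Q'Q; rewrite -OQ'.
have L'b : L' b.
  split; first by rewrite -[set_val _]/(incl A b) bx.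
  by apply: subset_closure; rewrite -[set_val _]/(incl A b) bx; exact: nbhs_singleton.
have := oB L' b cL' L'b Bb; case=> Q' [[O oO OQ'] Q'b Q'B].
have Ox : nbhs x O.
  by apply: open_nbhs_nbhs; split=> //; rewrite -bx; move: Q'b; rewrite -OQ'.
have nAx : nbhs x A by exact: open_nbhs_nbhs.
apply: (@filterS _ (nbhs x) _ _ _ _ (filterI Wx (filterI Ox nAx))) => y [Wy [Oy Ay]] Ky.
exists (sub_elt Ay) => //; apply: Q'B; first by rewrite -OQ'.
by split=> //; exact: subset_closure.
Qed.

Notation cmap X Y := (continuousType (cg_sort X) (cg_sort Y)).

Definition cm (X Y : cgtop) (f : X -> Y) (cf : continuous f) : cmap X Y :=
  mkcts cf.
Definition cm_id (X : cgtop) : cmap X X := idfun.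
Definition cm_comp (X Y Z : cgtop) (g : cmap Y Z) (f : cmap X Y) : cmap X Z :=
  g \o f.

Lemma cm_ext (X Y : cgtop) (f g : cmap X Y) : f =1 g -> f = g.
Proof. by move=> /continuousEP. Qed.

Section FiberProduct.
Variables (X Y Z : cgtop) (f : cmap X Z) (g : cmap Y Z).

Definition fp_set : set (X * Y) := [set p | f p.1 = g p.2].

(* The pullback of [f] and [g] in the category of compactly generated
   Hausdorff spaces. *)
Definition fp : cgtop := cg_kify (set_type_hausdorff (A := fp_set)
  (prod_hausdorff (@cg_hausdorff X) (@cg_hausdorff Y))).

Let fp_val_continuous : continuous (fun z : fp => set_val (z : fp_set)).
Proof.
move=> z; apply: (@continuous_comp (kify fp_set) fp_set (X * Y)%type).
  exact: unkify_continuous.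
exact: initial_continuous.
Qed.

Let fp1_continuous : continuous (fun z : fp => (set_val (z : fp_set)).1 : X).
Proof.
by move=> z; apply: (@continuous_comp _ _ _
  (fun z : fp => set_val (z : fp_set)) fst); [exact: fp_val_continuous|exact: cvg_fst].
Qed.

Let fp2_continuous : continuous (fun z : fp => (set_val (z : fp_set)).2 : Y).
Proof.
by move=> z; apply: (@continuous_comp _ _ _
  (fun z : fp => set_val (z : fp_set)) snd); [exact: fp_val_continuous|exact: cvg_snd].
Qed.

Definition fp1 : cmap fp X := cm fp1_continuous.
Definition fp2 : cmap fp Y := cm fp2_continuous.

Lemma fpP (z : fp) : f (fp1 z) = g (fp2 z).
Proof. exact: set_mem (valP (z : fp_set)). Qed.

Definition fpmk (x : X) (y : Y) (e : f x = g y) : fp :=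
  exist _ (x, y) (mem_set (e : fp_set (x, y))) : fp_set.

Lemma fp1K (x : X) (y : Y) (e : f x = g y) : fp1 (fpmk e) = x. Proof. by []. Qed.
Lemma fp2K (x : X) (y : Y) (e : f x = g y) : fp2 (fpmk e) = y. Proof. by []. Qed.

Lemma fp_ext (z z' : fp) : fp1 z = fp1 z' -> fp2 z = fp2 z' -> z = z'.
Proof.
move=> e1 e2; apply: (@val_inj _ _ (fp_set : Type)).
by rewrite [LHS]surjective_pairing [RHS]surjective_pairing; congr pair.
Qed.

Lemma fp_continuous (W : cgtop) (h : W -> fp) :
  continuous (fun w => fp1 (h w)) -> continuous (fun w => fp2 (h w)) ->
  continuous h.
Proof.
move=> c1 c2; apply: (@kify_continuous W (fp_set : topologicalType) h).
apply: continuous_comp_initial => w.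
have -> : set_val \o h = (fun w => (fp1 (h w), fp2 (h w))).
  by apply: funext => v; exact: surjective_pairing.
by apply: cvg_pair; [exact: c1|exact: c2].
Qed.

End FiberProduct.
Arguments fp1 {X Y Z f g}.
Arguments fp2 {X Y Z f g}.

Lemma fpmk_continuous (W X Y Z : cgtop) (f : cmap X Z) (g : cmap Y Z)
  (u : W -> X) (v : W -> Y) (e : forall w, f (u w) = g (v w)) :
  continuous u -> continuous v -> continuous (fun w => fpmk (e w)).
Proof. by move=> cu cv; apply: fp_continuous. Qed.

Lemma fpmk_eq (X Y Z : cgtop) (f : cmap X Z) (g : cmap Y Z)
  (x x' : X) (y y' : Y) (e : f x = g y) (e' : f x' = g y') :
  x = x' -> y = y' -> fpmk e = fpmk e'.
Proof. by move=> ? ?; apply: fp_ext. Qed.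

Definition homeomorphism (X Y : cgtop) (f : cmap X Y) : Prop :=
  exists g : cmap Y X, cancel f g /\ cancel g f.

Record opencover (X : cgtop) := OpenCover {
  cov_index : Type;
  cov_set :> cov_index -> set X;
  cov_open : forall i, open (cov_set i);
  cov_cover : forall x, exists i, cov_set i x }.

Definition local_sections (X Y : cgtop) (f : cmap X Y) : Prop :=
  exists U : opencover Y, forall i,
    exists s : cmap (cg_sub (U i)) X, forall y, f (s y) = incl (U i) y.

Lemma local_sections_continuous (X Y : cgtop) (T : topologicalType)
  (q : cmap X Y) (g : Y -> T) :
  local_sections q -> continuous (g \o q) -> continuous g.
Proof.
move=> [U hU] /continuousP cgq; apply/continuousP => W oW.
rewrite openE => y Wy; have [i Uy] := cov_cover U y.
have [s hs] := hU i.
pose B : set (cg_sub (U i)) := s @^-1` ((g \o q) @^-1` W).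
have oB : open B.
  move: (@cts_fun _ _ s) => /continuousP; apply; exact: cgq.
have oI := open_incl_image (cov_open i) oB.
apply: (@filterS _ (nbhs y) _ (incl (U i) @` B)).
  by move=> _ [z Bz <-]; rewrite /= -hs.
by apply: open_nbhs_nbhs; split=> //; exists (sub_elt Uy) => //; rewrite /B /= hs.
Qed.

Lemma local_sections_id (X : cgtop) : local_sections (cm_id X).
Proof.
unshelve eexists (@OpenCover X unit (fun _ => setT) _ _).
- by move=> ?; exact: openT.
- by move=> x; exists tt.
- by move=> ?; exists (incl setT).
Qed.

Section FpMap.
Variables (X Y X' Y' Z : cgtop) (q : cmap X Y) (q' : cmap X' Y')
  (f : cmap Y Z) (f' : cmap Y' Z) (h : cmap X Z) (h' : cmap X' Z)
  (fq : forall x, h x = f (q x)) (fq' : forall x, h' x = f' (q' x)).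

Lemma fp_map_subproof (z : fp h h') :
  f (q (fp1 z)) = f' (q' (fp2 z)).
Proof. by rewrite -fq -fq'; exact: fpP. Qed.

Lemma fp_map_continuous :
  continuous (fun z : fp h h' => fpmk (fp_map_subproof z)).
Proof.
apply: fpmk_continuous => z.
  by apply: (@continuous_comp _ _ _ fp1 q); exact: cts_fun.
by apply: (@continuous_comp _ _ _ fp2 q'); exact: cts_fun.
Qed.

Definition fp_map : cmap (fp h h') (fp f f') := cm fp_map_continuous.

Lemma fp_map_local_sections :
  local_sections q -> local_sections q' -> local_sections fp_map.
Proof.
move=> [U hU] [U' hU'].
pose V (ij : cov_index U * cov_index U') : set (fp f f') :=
  [set z | U ij.1 (fp1 z) /\ U' ij.2 (fp2 z)].
unshelve eexists (@OpenCover _ _ V _ _).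
- move=> [i j]; apply: openI.
    by move/continuousP: (@cts_fun _ _ (@fp1 _ _ _ f f')); apply; exact: cov_open.
  by move/continuousP: (@cts_fun _ _ (@fp2 _ _ _ f f')); apply; exact: cov_open.
- move=> z; have [i Ui] := cov_cover U (fp1 z).
  by have [j Uj] := cov_cover U' (fp2 z); exists (i, j).
move=> [i j] /=; have [s hs] := hU i; have [s' hs'] := hU' j.
pose a (z : cg_sub (V (i, j))) : cg_sub (U i) := sub_elt (inclP z).1.
pose b (z : cg_sub (V (i, j))) : cg_sub (U' j) := sub_elt (inclP z).2.
have ca : continuous a.
  apply: cg_sub_continuous => z.
  by apply: (@continuous_comp _ _ _ (incl _) fp1); exact: cts_fun.
have cb : continuous b.
  apply: cg_sub_continuous => z.
  by apply: (@continuous_comp _ _ _ (incl _) fp2); exact: cts_fun.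
have e z : h (s (a z)) = h' (s' (b z)).
  by rewrite fq fq' hs hs'; exact: fpP.
have ct : continuous (fun z => fpmk (e z)).
  apply: fpmk_continuous => z.
    by apply: (@continuous_comp _ _ _ a s); [exact: ca|exact: cts_fun].
  by apply: (@continuous_comp _ _ _ b s'); [exact: cb|exact: cts_fun].
exists (cm ct) => z; apply: fp_ext; first exact: hs.
exact: hs'.
Qed.

End FpMap.

(* A category over the category of spaces. The objects are indexed by the space
   they lie over, while an arrow carries its image [base]; an arrow lying over a
   given map [f] is thus an arrow [h] with [base h = f]. *)
Record catover := CatOver {
  ob : cgtop -> Type;
  hom : forall U V : cgtop, ob U -> ob V -> Type;
  base : forall (U V : cgtop) (x : ob U) (y : ob V), hom x y -> cmap U V;
  idm : forall (U : cgtop) (x : ob U), hom x x;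
  compm : forall (U V W : cgtop) (x : ob U) (y : ob V) (z : ob W),
    hom y z -> hom x y -> hom x z;
  compm1 : forall (U V : cgtop) (x : ob U) (y : ob V) (h : hom x y),
    compm h (idm x) = h;
  comp1m : forall (U V : cgtop) (x : ob U) (y : ob V) (h : hom x y),
    compm (idm y) h = h;
  compmA : forall (U V W T : cgtop) (x : ob U) (y : ob V) (z : ob W) (t : ob T)
    (h : hom z t) (k : hom y z) (l : hom x y),
    compm h (compm k l) = compm (compm h k) l;
  base_id : forall (U : cgtop) (x : ob U), base (idm x) = cm_id U;
  base_comp : forall (U V W : cgtop) (x : ob U) (y : ob V) (z : ob W)
    (h : hom y z) (k : hom x y), base (compm h k) = cm_comp (base h) (base k) }.

Arguments ob c U : rename.
Arguments hom {c U V} x y : rename.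
Arguments base {c U V x y} h : rename.
Arguments idm {c U} x : rename.
Arguments compm {c U V W x y z} h k : rename.

Definition is_iso (C : catover) (U V : cgtop) (x : ob C U) (y : ob C V)
    (h : hom x y) : Prop :=
  exists k : hom y x, compm k h = idm x /\ compm h k = idm y.

Record fibered_in_groupoids (C : catover) : Prop := FiberedInGroupoids {
  fib_pullback : forall (U V : cgtop) (f : cmap U V) (y : ob C V),
    exists (x : ob C U) (h : hom x y), base h = f;
  fib_lift : forall (U V W : cgtop) (x : ob C U) (y : ob C V) (z : ob C W)
    (h : hom x z) (k : hom y z) (f : cmap U V),
    cm_comp (base k) f = base h ->
    exists! l : hom x y, base l = f /\ compm k l = h }.

Definition over_incl (C : catover) (U : cgtop) (A : set U)
    (x : ob C (cg_sub A)) (y : ob C U) (h : hom x y) : Prop :=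
  base h = incl A.

(* [h] lies over the inclusion of [A] in [B]; that [A] is contained in [B]
   follows from the existence of [base h]. *)
Definition over_incl2 (C : catover) (U : cgtop) (A B : set U)
    (x : ob C (cg_sub A)) (y : ob C (cg_sub B)) (h : hom x y) : Prop :=
  cm_comp (incl B) (base h) = incl A.

(* Descent for open covers, stated without choosing pullbacks.
   In [stack_glue_arrows], [r i] is any restriction of [x] to [V i], and [f i] is
   an arrow from that restriction to [y].
   In [stack_glue_objects], the span [p i j], [q i j] is the gluing isomorphism
   between the restrictions of [x i] and [x j] to [V i `&` V j]; the hypothesis
   on triples is the cocycle condition on [V i `&` V j `&` V k]. *)
Record is_stack (C : catover) : Prop := IsStack {
  stack_fibered : fibered_in_groupoids C;
  stack_glue_arrows : forall (U : cgtop) (V : opencover U) (x y : ob C U)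
    (r : forall i, ob C (cg_sub (V i)))
    (e : forall i, hom (r i) x) (f : forall i, hom (r i) y),
    (forall i, over_incl (e i)) -> (forall i, over_incl (f i)) ->
    (forall i j (z : ob C (cg_sub (V i `&` V j)))
       (a : hom z (r i)) (b : hom z (r j)),
       over_incl2 a -> over_incl2 b ->
       compm (e i) a = compm (e j) b -> compm (f i) a = compm (f j) b) ->
    exists! m : hom x y, base m = cm_id U /\ forall i, compm m (e i) = f i;
  stack_glue_objects : forall (U : cgtop) (V : opencover U)
    (x : forall i, ob C (cg_sub (V i)))
    (d : forall i j, ob C (cg_sub (V i `&` V j)))
    (p : forall i j, hom (d i j) (x i)) (q : forall i j, hom (d i j) (x j)),
    (forall i j, over_incl2 (p i j)) -> (forall i j, over_incl2 (q i j)) ->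
    (forall i j k (z : ob C (cg_sub (V i `&` V j `&` V k)))
       (a : hom z (d i j)) (b : hom z (d j k)) (c : hom z (d i k)),
       over_incl2 a -> over_incl2 b -> over_incl2 c ->
       compm (p i j) a = compm (p i k) c ->
       compm (q i j) a = compm (p j k) b ->
       compm (q j k) b = compm (q i k) c) ->
    exists (y : ob C U) (e : forall i, hom (x i) y),
      (forall i, over_incl (e i)) /\
      forall i j, compm (e i) (p i j) = compm (e j) (q i j) }.

(* Morphisms of fibered categories, commuting strictly with the projections. *)
Record fmor (C D : catover) := FMor {
  fob :> forall U : cgtop, ob C U -> ob D U;
  fhom : forall (U V : cgtop) (x : ob C U) (y : ob C V),
    hom x y -> hom (fob x) (fob y);
  fhom_id : forall (U : cgtop) (x : ob C U), fhom (idm x) = idm (fob x);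
  fhom_comp : forall (U V W : cgtop) (x : ob C U) (y : ob C V) (z : ob C W)
    (h : hom y z) (k : hom x y), fhom (compm h k) = compm (fhom h) (fhom k);
  fhom_base : forall (U V : cgtop) (x : ob C U) (y : ob C V) (h : hom x y),
    base (fhom h) = base h }.

Arguments fob {C D} f U x : rename.
Arguments fhom {C D} f {U V x y} h : rename.

Definition fmor_id (C : catover) : fmor C C :=
  @FMor C C (fun U x => x) (fun U V x y h => h)
    (fun _ _ => erefl) (fun _ _ _ _ _ _ _ _ => erefl)
    (fun _ _ _ _ _ => erefl).

Section Comp.
Variables (C D E : catover) (G : fmor D E) (F : fmor C D).

Lemma fmor_comp_id (U : cgtop) (x : ob C U) :
  fhom G (fhom F (idm x)) = idm (G U (F U x)).
Proof. by rewrite !fhom_id. Qed.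

Lemma fmor_comp_comp (U V W : cgtop) (x : ob C U) (y : ob C V) (z : ob C W)
  (h : hom y z) (k : hom x y) : fhom G (fhom F (compm h k)) =
  compm (fhom G (fhom F h)) (fhom G (fhom F k)).
Proof. by rewrite !fhom_comp. Qed.

Lemma fmor_comp_base (U V : cgtop) (x : ob C U) (y : ob C V) (h : hom x y) :
  base (fhom G (fhom F h)) = base h.
Proof. by rewrite !fhom_base. Qed.

Definition fmor_comp : fmor C E :=
  FMor fmor_comp_id fmor_comp_comp fmor_comp_base.
End Comp.

(* 2-isomorphism: an invertible natural transformation over the identity. *)
Definition iso2 (C D : catover) (F G : fmor C D) : Prop :=
  exists tau : forall (U : cgtop) (x : ob C U), hom (F U x) (G U x),
    [/\ forall (U : cgtop) (x : ob C U), base (tau U x) = cm_id U,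
        forall (U V : cgtop) (x : ob C U) (y : ob C V) (h : hom x y),
          compm (tau V y) (fhom F h) = compm (fhom G h) (tau U x) &
        forall (U : cgtop) (x : ob C U), is_iso (tau U x)].

Definition equivalent (C D : catover) : Prop :=
  exists (F : fmor C D) (G : fmor D C),
    iso2 (fmor_comp G F) (fmor_id C) /\ iso2 (fmor_comp F G) (fmor_id D).

(* The stack represented by [U]. *)
Section Repr.
Variable U : cgtop.

Record repr_hom (V W : cgtop) (a : cmap V U) (b : cmap W U) := ReprHom {
  rh_map : cmap V W;
  rh_comm : forall v, b (rh_map v) = a v }.

Lemma repr_hom_ext (V W : cgtop) (a : cmap V U) (b : cmap W U)
  (h k : repr_hom a b) : rh_map h = rh_map k -> h = k.
Proof.
case: h k => [h eh] [k ek] /= hk; rewrite hk in eh *.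
by congr ReprHom; exact: Prop_irrelevance.
Qed.

Definition repr_id (V : cgtop) (a : cmap V U) : repr_hom a a.
Proof. by exists (cm_id V). Defined.

Definition repr_comp (V W T : cgtop) (a : cmap V U) (b : cmap W U)
  (c : cmap T U) (h : repr_hom b c) (k : repr_hom a b) : repr_hom a c.
Proof.
exists (cm_comp (rh_map h) (rh_map k)).
by move=> v; rewrite /= !rh_comm.
Defined.

Definition repstack : catover.
Proof.
refine (@CatOver (fun V => cmap V U) repr_hom rh_map repr_id repr_comp
  _ _ _ _ _).
- by move=> *; apply: repr_hom_ext; exact: cm_ext.
- by move=> *; apply: repr_hom_ext; exact: cm_ext.
- by move=> *; apply: repr_hom_ext; exact: cm_ext.
- by [].
- by [].
Defined.
End Repr.

Section ReprMor.
Variables (U V : cgtop) (f : cmap U V).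

Definition repr_mor_hom (W T : cgtop) (a : ob (repstack U) W) (b : ob (repstack U) T)
  (h : hom a b) :
  @hom (repstack V) W T (cm_comp f a) (cm_comp f b).
Proof.
by exists (rh_map h) => w /=; rewrite rh_comm.
Defined.

Definition repr_mor : fmor (repstack U) (repstack V).
Proof.
refine (@FMor (repstack U) (repstack V) (fun W a => cm_comp f a) repr_mor_hom _ _ _).
- by move=> *; exact: repr_hom_ext.
- by move=> *; exact: repr_hom_ext.
- by [].
Defined.
End ReprMor.

Section TwoFiber.
Variables (Y Z X : catover) (f : fmor Y X) (g : fmor Z X).

Record tf_ob (U : cgtop) := TfOb {
  tf_fst : ob Y U;
  tf_snd : ob Z U;
  tf_arr : hom (f U tf_fst) (g U tf_snd);
  tf_base : base tf_arr = cm_id U }.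

Record tf_hom (U V : cgtop) (a : tf_ob U) (b : tf_ob V) := TfHom {
  tfh_fst : hom (tf_fst a) (tf_fst b);
  tfh_snd : hom (tf_snd a) (tf_snd b);
  tfh_base : base tfh_fst = base tfh_snd;
  tfh_comm : compm (tf_arr b) (fhom f tfh_fst) =
             compm (fhom g tfh_snd) (tf_arr a) }.

Lemma tf_hom_ext (U V : cgtop) (a : tf_ob U) (b : tf_ob V) (h k : tf_hom a b) :
  tfh_fst h = tfh_fst k -> tfh_snd h = tfh_snd k -> h = k.
Proof.
case: h k => [h1 h2 eb ec] [k1 k2 eb' ec'] /= e1 e2.
rewrite e1 e2 in eb ec *.
by congr TfHom; exact: Prop_irrelevance.
Qed.

Definition tf_id (U : cgtop) (a : tf_ob U) : tf_hom a a.
Proof.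
exists (idm (tf_fst a)) (idm (tf_snd a)).
  by rewrite !base_id.
by rewrite !fhom_id compm1 comp1m.
Defined.

Definition tf_comp (U V W : cgtop) (a : tf_ob U) (b : tf_ob V) (c : tf_ob W)
  (h : tf_hom b c) (k : tf_hom a b) : tf_hom a c.
Proof.
exists (compm (tfh_fst h) (tfh_fst k)) (compm (tfh_snd h) (tfh_snd k)).
  by rewrite !base_comp !tfh_base.
by rewrite !fhom_comp compmA tfh_comm -compmA tfh_comm compmA.
Defined.

Definition two_fiber : catover.
Proof.
refine (@CatOver tf_ob tf_hom (fun U V a b h => base (tfh_fst h)) tf_id tf_comp
  _ _ _ _ _).
- by move=> *; apply: tf_hom_ext; exact: compm1.
- by move=> *; apply: tf_hom_ext; exact: comp1m.
- by move=> *; apply: tf_hom_ext; exact: compmA.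
- by move=> *; exact: base_id.
- by move=> *; exact: base_comp.
Defined.
End TwoFiber.

Section Diagonal.
Variables (D C : catover) (F : fmor D C).

Definition diag_ob (U : cgtop) (d : ob D U) : ob (two_fiber F F) U :=
  @TfOb _ _ _ F F U d d (idm (F U d)) (base_id (F U d)).

Definition diag_hom (U V : cgtop) (d : ob D U) (d' : ob D V) (h : hom d d') :
  hom (diag_ob d) (diag_ob d').
Proof. by exists h h => //=; rewrite compm1 comp1m. Defined.

Definition diagonal : fmor D (two_fiber F F).
Proof.
refine (@FMor D (two_fiber F F) diag_ob diag_hom _ _ _).
- by move=> *; exact: tf_hom_ext.
- by move=> *; exact: tf_hom_ext.
- by [].
Defined.
End Diagonal.

Definition epimorphism (D C : catover) (F : fmor D C) : Prop :=
  forall (U : cgtop) (q : fmor (repstack U) C),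
  exists V : opencover U, forall i,
  exists r : fmor (repstack (cg_sub (V i))) D,
    iso2 (fmor_comp F r) (fmor_comp q (repr_mor (incl (V i)))).

(* [gcomp (a, b)] is the composite [a o b], defined when [src a = tgt b]. *)
Record tgroupoid (M : cgtop) := TGroupoid {
  arr : cgtop;
  src : cmap arr M;
  tgt : cmap arr M;
  gone : cmap M arr;
  ginv : cmap arr arr;
  gcomp : cmap (fp src tgt) arr;
  src_one : forall x, src (gone x) = x;
  tgt_one : forall x, tgt (gone x) = x;
  src_inv : forall a, src (ginv a) = tgt a;
  tgt_inv : forall a, tgt (ginv a) = src a;
  src_comp : forall a b (e : src a = tgt b), src (gcomp (fpmk e)) = src b;
  tgt_comp : forall a b (e : src a = tgt b), tgt (gcomp (fpmk e)) = tgt a;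
  comp_one : forall a x (e : src a = tgt (gone x)), gcomp (fpmk e) = a;
  one_comp : forall x a (e : src (gone x) = tgt a), gcomp (fpmk e) = a;
  comp_inv : forall a (e : src a = tgt (ginv a)),
    gcomp (fpmk e) = gone (tgt a);
  inv_comp : forall a (e : src (ginv a) = tgt a),
    gcomp (fpmk e) = gone (src a);
  comp_assoc : forall a b c (ab : src a = tgt b) (bc : src b = tgt c)
    (abc : src a = tgt (gcomp (fpmk bc))) (abc' : src (gcomp (fpmk ab)) = tgt c),
    gcomp (fpmk abc) = gcomp (fpmk abc') }.

Arguments src {M} t.
Arguments tgt {M} t.
Arguments gone {M} t.
Arguments ginv {M t}.
Arguments gcomp {M t}.

Definition gmul (M : cgtop) (G : tgroupoid M) (a b : arr G)
  (e : src G a = tgt G b) : arr G := gcomp (fpmk e).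

Lemma gmul_eq (M : cgtop) (G : tgroupoid M) (a a' b b' : arr G)
  (e : src G a = tgt G b) (e' : src G a' = tgt G b') :
  a = a' -> b = b' -> gmul e = gmul e'.
Proof. by move=> ? ?; rewrite /gmul; congr (gcomp _); exact: fpmk_eq. Qed.

Record tgroupoid_mor (M N : cgtop) (G : tgroupoid M) (H : tgroupoid N) :=
  TGroupoidMor {
  mor0 : cmap M N;
  mor1 : cmap (arr G) (arr H);
  mor_src : forall a, src H (mor1 a) = mor0 (src G a);
  mor_tgt : forall a, tgt H (mor1 a) = mor0 (tgt G a);
  mor_one : forall x, mor1 (gone G x) = gone H (mor0 x);
  mor_mul : forall a b (e : src G a = tgt G b)
    (e' : src H (mor1 a) = tgt H (mor1 b)), mor1 (gmul e) = gmul e' }.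

Record is_extension (M : cgtop) (G H : tgroupoid M) (F : tgroupoid_mor G H) :
    Prop := IsExtension {
  ext_objects : mor0 F = cm_id M;
  ext_sections : local_sections (mor1 F) }.

(* [act (p, a)] is [p . a], defined when [anchor p = tgt a]. *)
Record right_action (M : cgtop) (G : tgroupoid M) (P : cgtop) := RightAction {
  anchor : cmap P M;
  act : cmap (fp anchor (tgt G)) P;
  anchor_act : forall p a (e : anchor p = tgt G a),
    anchor (act (fpmk e)) = src G a;
  act_one : forall p (e : anchor p = tgt G (gone G (anchor p))),
    act (fpmk e) = p;
  act_mul : forall p a b (e : anchor p = tgt G a) (ab : src G a = tgt G b)
    (e' : anchor (act (fpmk e)) = tgt G b) (e'' : anchor p = tgt G (gmul ab)),
    act (fpmk e') = act (fpmk e'') }.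

Arguments anchor {M G P} r.
Arguments act {M G P} r.

Section Shear.
Variables (M : cgtop) (G : tgroupoid M) (P N : cgtop) (r : right_action G P)
  (proj : cmap P N)
  (inv : forall p a (e : anchor r p = tgt G a), proj (act r (fpmk e)) = proj p).

Lemma shear_subproof (z : fp (anchor r) (tgt G)) :
  proj (fp1 z) = proj (act r z).
Proof.
have <- : fpmk (fpP z) = z by exact: fp_ext.
by rewrite (inv (fpP z)) fp1K.
Qed.

Lemma shear_continuous : continuous (fun z => fpmk (shear_subproof z)).
Proof. by apply: fpmk_continuous; exact: cts_fun. Qed.

Definition shear : cmap (fp (anchor r) (tgt G)) (fp proj proj) :=
  cm shear_continuous.

End Shear.

Record principal_bundle (M : cgtop) (G : tgroupoid M) (N : cgtop) :=
  PrincipalBundle {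
  total : cgtop;
  raction : right_action G total;
  proj : cmap total N;
  proj_act : forall p a (e : anchor raction p = tgt G a),
    proj (act raction (fpmk e)) = proj p;
  proj_sections : local_sections proj;
  shear_homeo : homeomorphism (shear proj_act) }.

Arguments total {M G N} P : rename.
Arguments raction {M G N} P : rename.
Arguments proj {M G N} P : rename.

Section BG.
Variables (M : cgtop) (G : tgroupoid M).

Record bundle_mor (N N' : cgtop) (P : principal_bundle G N)
    (P' : principal_bundle G N') := BundleMor {
  bm_base : cmap N N';
  bm_total : cmap (total P) (total P');
  bm_proj : forall p, proj P' (bm_total p) = bm_base (proj P p);
  bm_anchor : forall p,
    anchor (raction P') (bm_total p) = anchor (raction P) p;
  bm_act : forall p a (e : anchor (raction P) p = tgt G a)
    (e' : anchor (raction P') (bm_total p) = tgt G a),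
    bm_total (act (raction P) (fpmk e)) = act (raction P') (fpmk e') }.

Lemma bundle_mor_ext (N N' : cgtop) (P : principal_bundle G N)
    (P' : principal_bundle G N') (h k : bundle_mor P P') :
  bm_base h = bm_base k -> bm_total h = bm_total k -> h = k.
Proof.
case: h k => [h1 h2 a b c] [k1 k2 a' b' c'] /= e1 e2.
rewrite e1 e2 in a b c *.
by congr BundleMor; exact: Prop_irrelevance.
Qed.

Definition bundle_id (N : cgtop) (P : principal_bundle G N) : bundle_mor P P.
Proof.
exists (cm_id N) (cm_id (total P)) => //= p a e e'.
by congr (act _ _); exact: fpmk_eq.
Defined.

Definition bundle_comp (N N' N'' : cgtop) (P : principal_bundle G N)
    (P' : principal_bundle G N') (P'' : principal_bundle G N'')
    (h : bundle_mor P' P'') (k : bundle_mor P P') : bundle_mor P P''.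
Proof.
exists (cm_comp (bm_base h) (bm_base k)) (cm_comp (bm_total h) (bm_total k)).
- by move=> p /=; rewrite !bm_proj.
- by move=> p /=; rewrite !bm_anchor.
- move=> p a e e' /=.
  have e0 : anchor (raction P') (bm_total k p) = tgt G a by rewrite bm_anchor.
  by rewrite (bm_act e e0) (bm_act e0 e').
Defined.

Definition BG : catover.
Proof.
refine (@CatOver (principal_bundle G) bundle_mor bm_base bundle_id bundle_comp
  _ _ _ _ _).
- by move=> *; apply: bundle_mor_ext; exact: cm_ext.
- by move=> *; apply: bundle_mor_ext; exact: cm_ext.
- by move=> *; apply: bundle_mor_ext; exact: cm_ext.
- by [].
- by [].
Defined.

End BG.

Section GroupoidTheory.
Variables (M : cgtop) (G : tgroupoid M).

Lemma gsrc (a b : arr G) (e : src G a = tgt G b) : src G (gmul e) = src G b.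
Proof. exact: src_comp. Qed.

Lemma gtgt (a b : arr G) (e : src G a = tgt G b) : tgt G (gmul e) = tgt G a.
Proof. exact: tgt_comp. Qed.

Lemma gmulA (a b c : arr G) (ab : src G a = tgt G b) (bc : src G b = tgt G c)
  (abc : src G a = tgt G (gmul bc)) (abc' : src G (gmul ab) = tgt G c) :
  gmul abc = gmul abc'.
Proof. exact: comp_assoc. Qed.

Lemma gmul_one (a b : arr G) (e : src G a = tgt G b) :
  b = gone G (src G a) -> gmul e = a.
Proof.
move=> eb; have e' : src G a = tgt G (gone G (src G a)) by rewrite tgt_one.
by rewrite (gmul_eq _ e' erefl eb); exact: comp_one.
Qed.

Lemma one_gmul (a b : arr G) (e : src G a = tgt G b) :
  a = gone G (tgt G b) -> gmul e = b.
Proof.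
move=> ea; have e' : src G (gone G (tgt G b)) = tgt G b by rewrite src_one.
by rewrite (gmul_eq _ e' ea erefl); exact: one_comp.
Qed.

Lemma gmulV (a b : arr G) (e : src G a = tgt G b) :
  b = ginv a -> gmul e = gone G (tgt G a).
Proof. by move=> eb; rewrite /gmul; move: e; rewrite eb => e; exact: comp_inv. Qed.

Lemma gVmul (a b : arr G) (e : src G a = tgt G b) :
  a = ginv b -> gmul e = gone G (src G b).
Proof. by move=> ea; rewrite /gmul; move: e; rewrite ea => e; exact: inv_comp. Qed.

Lemma gmulI (a b b' : arr G) (e : src G a = tgt G b) (e' : src G a = tgt G b') :
  gmul e = gmul e' -> b = b'.
Proof.
move=> h.
have Va x (ex : src G a = tgt G x) :
    exists e1 : src G (ginv a) = tgt G (gmul ex), gmul e1 = x.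
  have e1 : src G (ginv a) = tgt G (gmul ex) by rewrite gtgt src_inv.
  have e2 : src G (ginv a) = tgt G a by rewrite src_inv.
  have e3 : src G (gmul e2) = tgt G x by rewrite gsrc.
  exists e1; rewrite (gmulA e1 e3); apply: one_gmul.
  by rewrite (gVmul e2 erefl) ex.
have [e1 <-] := Va _ e; have [e2 <-] := Va _ e'.
exact: gmul_eq.
Qed.

Lemma gmul_continuous (W : cgtop) (u v : W -> arr G)
  (e : forall w, src G (u w) = tgt G (v w)) :
  continuous u -> continuous v -> continuous (fun w => gmul (e w)).
Proof.
move=> cu cv w.
apply: (@continuous_comp _ _ _ (fun w => fpmk (e w)) gcomp).
  exact: fpmk_continuous.
exact: cts_fun.
Qed.

Lemma act_continuous (W P : cgtop) (r : right_action G P) (u : W -> P)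
  (v : W -> arr G) (e : forall w, anchor r (u w) = tgt G (v w)) :
  continuous u -> continuous v -> continuous (fun w => act r (fpmk (e w))).
Proof.
move=> cu cv w.
apply: (@continuous_comp _ _ _ (fun w => fpmk (e w)) (act r)).
  exact: fpmk_continuous.
exact: cts_fun.
Qed.

Lemma act_eq (P : cgtop) (r : right_action G P) (p p' : P) (a a' : arr G)
  (e : anchor r p = tgt G a) (e' : anchor r p' = tgt G a') :
  p = p' -> a = a' -> act r (fpmk e) = act r (fpmk e').
Proof. by move=> ? ?; congr (act _ _); exact: fpmk_eq. Qed.

Lemma act_oneE (P : cgtop) (r : right_action G P) (p : P) (a : arr G)
  (e : anchor r p = tgt G a) : a = gone G (anchor r p) -> act r (fpmk e) = p.
Proof. by move=> ea; move: e; rewrite ea => e; exact: act_one. Qed.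

Variables (N : cgtop) (P : principal_bundle G N).

Lemma bundle_div : exists d : cmap (fp (proj P) (proj P)) (arr G),
  forall z, exists e : anchor (raction P) (fp1 z) = tgt G (d z),
    act (raction P) (fpmk e) = fp2 z.
Proof.
have [k [kK Kk]] := shear_homeo P.
exists (cm_comp fp2 k) => z /=.
have ez := Kk z.
have e1 : fp1 (k z) = fp1 z by rewrite -[in RHS]ez.
have e : anchor (raction P) (fp1 z) = tgt G (fp2 (k z)) by rewrite -e1 fpP.
exists e; rewrite -[in RHS]ez /= fp2K; congr (act _ _).
exact: fp_ext.
Qed.

Lemma bundle_free (p : total P) (a b : arr G)
  (e : anchor (raction P) p = tgt G a) (e' : anchor (raction P) p = tgt G b) :
  act (raction P) (fpmk e) = act (raction P) (fpmk e') -> a = b.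
Proof.
move=> h; have [k [kK _]] := shear_homeo P.
have : fpmk e = fpmk e'.
  by apply: (can_inj kK); apply: fpmk_eq.
by move=> /(congr1 fp2).
Qed.

End GroupoidTheory.

Section Associated.
Variables (M L : cgtop) (G : tgroupoid M) (H : tgroupoid L)
  (phi : tgroupoid_mor G H).

(* [G_0 x_(phi_0, H_0, t) H_1], called Q in the comments below. *)
Definition transl : cgtop := fp (mor0 phi) (tgt H).

Lemma lact_subproof1 (a : arr G) (q : transl) :
  src G a = fp1 q -> src H (mor1 phi a) = tgt H (fp2 q).
Proof. by move=> e; rewrite mor_src e; exact: fpP. Qed.

Lemma lact_subproof2 (a : arr G) (q : transl) (e : src G a = fp1 q) :
  mor0 phi (tgt G a) = tgt H (gmul (lact_subproof1 e)).
Proof. by rewrite gtgt mor_tgt. Qed.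

(* [a . (x, delta) = (t a, phi_1 a o delta)], defined when [src a = x]. *)
Definition lact (a : arr G) (q : transl) (e : src G a = fp1 q) : transl :=
  fpmk (lact_subproof2 e).

Lemma lact_eq (a a' : arr G) (q q' : transl) (e : src G a = fp1 q)
  (e' : src G a' = fp1 q') : a = a' -> q = q' -> lact e = lact e'.
Proof.
move=> ea eq; apply: fpmk_eq; first by rewrite ea.
by apply: gmul_eq; rewrite ?ea ?eq.
Qed.

Lemma lact_mul (a b : arr G) (q : transl) (eb : src G b = fp1 q)
  (ea : src G a = fp1 (lact eb)) (ab : src G a = tgt G b)
  (e : src G (gmul ab) = fp1 q) : lact ea = lact e.
Proof.
apply: fpmk_eq; first by rewrite gtgt.
have e1 : src H (mor1 phi a) = tgt H (mor1 phi b) by rewrite mor_src mor_tgt ab.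
have e2 : src H (gmul e1) = tgt H (fp2 q) by rewrite gsrc mor_src eb fpP.
transitivity (gmul e2); first exact: gmulA.
by apply: gmul_eq => //; rewrite (mor_mul ab e1).
Qed.

Lemma lact_one (a : arr G) (q : transl) (e : src G a = fp1 q) :
  a = gone G (fp1 q) -> lact e = q.
Proof.
move=> ea; apply: fp_ext; first by rewrite fp1K ea tgt_one.
by rewrite fp2K; apply: one_gmul; rewrite ea mor_one fpP.
Qed.

Lemma lactK (a : arr G) (q : transl) (e : src G a = fp1 q)
  (e' : src G (ginv a) = fp1 (lact e)) : lact e' = q.
Proof.
have e1 : src G (ginv a) = tgt G a by rewrite src_inv.
have e2 : src G (gmul e1) = fp1 q by rewrite gsrc.
by rewrite (lact_mul e' e2); apply: lact_one; rewrite (gVmul e1 erefl) e.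
Qed.

Lemma lactVK (a : arr G) (q : transl) (e : src G (ginv a) = fp1 q)
  (e' : src G a = fp1 (lact e)) : lact e' = q.
Proof.
have e1 : src G a = tgt G (ginv a) by rewrite tgt_inv.
have e2 : src G (gmul e1) = fp1 q by rewrite gsrc.
rewrite (lact_mul e' e2); apply: lact_one.
by rewrite (gmulV e1 erefl) -e src_inv.
Qed.

Lemma lact_continuous (W : cgtop) (u : W -> arr G) (v : W -> transl)
  (e : forall w, src G (u w) = fp1 (v w)) :
  continuous u -> continuous v -> continuous (fun w => lact (e w)).
Proof.
move=> cu cv; apply: fpmk_continuous.
  by move=> w; apply: (@continuous_comp _ _ _ u (tgt G)); [exact: cu|exact: cts_fun].
apply: gmul_continuous.
  by move=> w; apply: (@continuous_comp _ _ _ u (mor1 phi)); [exact: cu|exact: cts_fun].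
by move=> w; apply: (@continuous_comp _ _ _ v fp2); [exact: cv|exact: cts_fun].
Qed.

Section Bundle.
Variables (N : cgtop) (P : principal_bundle G N).

(* P x_(G_0) Q *)
Definition ptransl : cgtop :=
  fp (anchor (raction P)) (fp1 : cmap transl M).

(* [w' = (p . a, a^-1 . q)] for some arrow [a], where [w = (p, q)]. *)
Definition orb (w w' : ptransl) : Prop :=
  exists (a : arr G) (e : anchor (raction P) (fp1 w) = tgt G a)
    (e' : src G (ginv a) = fp1 (fp2 w)),
    fp1 w' = act (raction P) (fpmk e) /\ fp2 w' = lact e'.

Lemma orbE (w w' : ptransl) : orb w w' <->
  exists (a : arr G) (e : anchor (raction P) (fp1 w) = tgt G a)
    (e' : src G a = fp1 (fp2 w')),
    fp1 w' = act (raction P) (fpmk e) /\ fp2 w = lact e'.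
Proof.
split=> -[a [e [e' [h1 h2]]]].
  have e1 : src G a = fp1 (lact e') by rewrite fp1K tgt_inv.
  have e2 : src G a = fp1 (fp2 w') by rewrite h2.
  by exists a, e, e2; split=> //; rewrite -(lactVK e1); exact: lact_eq.
have e1 : src G (ginv a) = fp1 (lact e') by rewrite fp1K src_inv.
have e2 : src G (ginv a) = fp1 (fp2 w) by rewrite h2.
by exists a, e, e2; split=> //; rewrite -(lactK e1); exact: lact_eq.
Qed.

Lemma orb_refl (w : ptransl) : orb w w.
Proof.
apply/orbE.
have e : anchor (raction P) (fp1 w) =
    tgt G (gone G (anchor (raction P) (fp1 w))) by rewrite tgt_one.
have e' : src G (gone G (anchor (raction P) (fp1 w))) = fp1 (fp2 w).
  by rewrite src_one fpP.
exists (gone G (anchor (raction P) (fp1 w))), e, e'; split.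
  by rewrite act_oneE.
by rewrite lact_one // fpP.
Qed.

Lemma orb_sym (w w' : ptransl) : orb w w' -> orb w' w.
Proof.
move=> /orbE[a [e [e' [h1 h2]]]].
have e1 : anchor (raction P) (fp1 w') = tgt G (ginv a).
  by rewrite h1 (anchor_act e) tgt_inv.
have e2 : src G (ginv a) = fp1 (fp2 w) by rewrite h2 fp1K src_inv.
apply/orbE; exists (ginv a), e1, e2; split.
  have e3 : anchor (raction P) (act (raction P) (fpmk e)) = tgt G (ginv a).
    by rewrite -h1.
  have e4 : src G a = tgt G (ginv a) by rewrite tgt_inv.
  have e5 : anchor (raction P) (fp1 w) = tgt G (gmul e4) by rewrite gtgt.
  rewrite (act_eq e1 e3 h1 erefl) (act_mul e3 e5) act_oneE //.
  by rewrite (gmulV e4 erefl) e.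
have e3 : src G (ginv a) = fp1 (lact e') by rewrite fp1K src_inv.
by rewrite -(lactK e3); exact: lact_eq.
Qed.

Lemma orb_trans (w2 w1 w3 : ptransl) : orb w1 w2 -> orb w2 w3 -> orb w1 w3.
Proof.
move=> /orbE[a [e [e' [h1 h2]]]] /orbE[b [f [f' [k1 k2]]]].
have ab : src G a = tgt G b by rewrite e' k2.
have e1 : anchor (raction P) (fp1 w1) = tgt G (gmul ab) by rewrite gtgt.
have e2 : src G (gmul ab) = fp1 (fp2 w3) by rewrite gsrc.
apply/orbE; exists (gmul ab), e1, e2; split.
  have e3 : anchor (raction P) (act (raction P) (fpmk e)) = tgt G b.
    by rewrite -h1.
  by rewrite k1 (act_eq f e3 h1 erefl); exact: act_mul.
have e3 : src G a = fp1 (lact f') by rewrite -k2.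
by rewrite h2 (lact_eq e' e3 erefl k2); exact: lact_mul.
Qed.

Lemma orb_proj (w w' : ptransl) :
  orb w w' -> proj P (fp1 w) = proj P (fp1 w').
Proof. by move=> [a [e [e' [-> _]]]]; rewrite proj_act. Qed.

Lemma orb_src (w w' : ptransl) :
  orb w w' -> src H (fp2 (fp2 w)) = src H (fp2 (fp2 w')).
Proof. by move=> [a [e [e' [_ ->]]]]; rewrite fp2K gsrc. Qed.

Lemma orb_free (w w' : ptransl) : orb w w' -> fp1 w = fp1 w' -> w = w'.
Proof.
move=> /orbE[a [e [e' [h1 h2]]]] h; apply: fp_ext => //.
rewrite h2; apply: lact_one.
have e1 : anchor (raction P) (fp1 w) =
  tgt G (gone G (anchor (raction P) (fp1 w))) by rewrite tgt_one.
have ea : a = gone G (anchor (raction P) (fp1 w)).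
  by apply: (bundle_free (e := e) (e' := e1)); rewrite -h1 -h act_oneE.
by rewrite -e' ea src_one.
Qed.

Lemma local_slice : exists U : opencover N, forall i,
  exists t : cmap (cg_sub [set w : ptransl | U i (proj P (fp1 w))]) ptransl,
    (forall v, orb (incl _ v) (t v)) /\
    (forall v v', orb (incl _ v) (incl _ v') -> t v = t v').
Proof.
have [U hU] := proj_sections P; exists U => i.
have [s hs] := hU i; have [d hd] := bundle_div P.
set D := [set w : ptransl | U i (proj P (fp1 w))].
have Dv (v : cg_sub D) : U i (proj P (fp1 (incl D v))) by exact: (inclP v).
pose n (v : cg_sub D) : cg_sub (U i) := sub_elt (Dv v).
have nE v : incl (U i) (n v) = proj P (fp1 (incl D v)) by [].
have cn : continuous n.
  apply: cg_sub_continuous => v.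
  apply: (@continuous_comp _ _ _ (fun v : cg_sub D => fp1 (incl D v)) (proj P)).
    by apply: (@continuous_comp _ _ _ (incl D) fp1); exact: cts_fun.
  exact: cts_fun.
have csn : continuous (fun v => s (n v)).
  by move=> v; apply: (@continuous_comp _ _ _ n s); [exact: cn|exact: cts_fun].
have ez v : proj P (s (n v)) = proj P (fp1 (incl D v)) by rewrite hs.
have cd : continuous (fun v => d (fpmk (ez v))).
  move=> v; apply: (@continuous_comp _ _ _ (fun v => fpmk (ez v)) d).
    apply: fpmk_continuous => // w.
    by apply: (@continuous_comp _ _ _ (incl D) fp1); exact: cts_fun.
  exact: cts_fun.
have e1 v : anchor (raction P) (s (n v)) = tgt G (d (fpmk (ez v))).
  by have [] := hd (fpmk (ez v)).
have e2 v : act (raction P) (fpmk (e1 v)) = fp1 (incl D v).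
  by have [e he] := hd (fpmk (ez v)); apply: etrans he; exact: act_eq.
have e3 v : src G (d (fpmk (ez v))) = fp1 (fp2 (incl D v)).
  by rewrite -fpP -(anchor_act (e1 v)) e2.
have e4 v : anchor (raction P) (s (n v)) = fp1 (lact (e3 v)).
  by rewrite fp1K -e1.
have ct : continuous (fun v => fpmk (e4 v) : ptransl).
  apply: fpmk_continuous => //; apply: lact_continuous => // v.
  by apply: (@continuous_comp _ _ _ (incl D) fp2); exact: cts_fun.
have ho v : orb (incl D v) (fpmk (e4 v)).
  apply/orb_sym/orbE; exists (d (fpmk (ez v))), (e1 v), (e3 v).
  by rewrite e2.
exists (cm ct); split=> [v|v v' hv]; first exact: ho.
apply: orb_free.
  apply: (orb_trans (orb_sym (ho v))); exact: (orb_trans hv (ho v')).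
rewrite !fp1K; congr (s _); apply: incl_inj.
by rewrite !nE; exact: orb_proj.
Qed.

Definition orb_rel : rel ptransl := fun w w' => `[< orb w w' >].

Lemma orb_rel_refl : reflexive orb_rel.
Proof. by move=> w; apply/asboolP; exact: orb_refl. Qed.

Lemma orb_rel_sym : symmetric orb_rel.
Proof. by move=> w w'; apply/asboolP/asboolP; exact: orb_sym. Qed.

Lemma orb_rel_trans : transitive orb_rel.
Proof.
by move=> w w' w'' /asboolP h /asboolP k; apply/asboolP; exact: orb_trans h k.
Qed.

Definition orb_equiv : equiv_rel ptransl :=
  EquivRel orb_rel orb_rel_refl orb_rel_sym orb_rel_trans.

(* (P x_(G_0) Q) / G_1, with the quotient topology *)
Definition assoc : topologicalType := quotient_topology {eq_quot orb_equiv}.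

Definition assoc_pi (w : ptransl) : assoc := \pi_({eq_quot orb_equiv}) w.
Definition assoc_repr (x : assoc) : ptransl := repr (x : {eq_quot orb_equiv}).

Lemma assoc_reprK (x : assoc) : assoc_pi (assoc_repr x) = x.
Proof. exact: reprK. Qed.

Lemma assoc_piP (w w' : ptransl) : assoc_pi w = assoc_pi w' <-> orb w w'.
Proof.
by split=> [/eqmodP/asboolP//|h]; apply/eqmodP/asboolP.
Qed.

Lemma assoc_repr_orb (w : ptransl) : orb (assoc_repr (assoc_pi w)) w.
Proof. by apply/assoc_piP; exact: assoc_reprK. Qed.

Lemma assoc_openE (O : set assoc) : open O = open (assoc_pi @^-1` O).
Proof. by []. Qed.

Lemma assoc_pi_continuous : continuous assoc_pi.
Proof. by apply/continuousP => O. Qed.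

Lemma assoc_continuous (T : topologicalType) (f : assoc -> T) :
  continuous (fun w => f (assoc_pi w)) -> continuous f.
Proof. by move=> /continuousP h; apply/continuousP => O oO; exact: h. Qed.

Definition assoc_proj_fun (x : assoc) : N := proj P (fp1 (assoc_repr x)).

Lemma assoc_proj_funE (w : ptransl) :
  assoc_proj_fun (assoc_pi w) = proj P (fp1 w).
Proof. exact/orb_proj/assoc_repr_orb. Qed.

Lemma assoc_proj_continuous : continuous assoc_proj_fun.
Proof.
apply: assoc_continuous.
rewrite (_ : (fun w => _) = fun w => proj P (fp1 w)); last first.
  by apply: funext => w; exact: assoc_proj_funE.
by move=> w; apply: (@continuous_comp _ _ _ fp1 (proj P)); exact: cts_fun.
Qed.

Lemma slice_open (U : set N)
  (t : cmap (cg_sub [set w : ptransl | U (proj P (fp1 w))]) ptransl)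
  (W : set ptransl) : open U ->
  (forall v v', orb (incl _ v) (incl _ v') -> t v = t v') -> open W ->
  open [set x : assoc | exists v, assoc_pi (incl _ v) = x /\ W (t v)].
Proof.
move=> oU ht oW; rewrite assoc_openE.
set D := [set w : ptransl | U (proj P (fp1 w))] in t ht *.
rewrite (_ : _ @^-1` _ = incl D @` (t @^-1` W)).
  apply: open_incl_image; last first.
    by move: (@cts_fun _ _ t) => /continuousP; exact.
  have c : continuous (fun w : ptransl => proj P (fp1 w)).
    by move=> w; apply: (@continuous_comp _ _ _ fp1 (proj P)); exact: cts_fun.
  by move/continuousP: c; apply.
apply/seteqP; split=> [w [v [/assoc_piP vw Wv]]|_ [v Wv <-]]; last by exists v.
have Dw : D w by rewrite /D /= -(orb_proj vw); exact: (inclP v).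
by exists (sub_elt Dw) => //=; rewrite -(ht v).
Qed.

Lemma assoc_hausdorff : hausdorff_space assoc.
Proof.
move=> x y cl; have [U hU] := local_slice.
have exy : assoc_proj_fun x = assoc_proj_fun y.
  apply: (@cg_hausdorff N) => A B nA nB.
  have [z [Az Bz]] := cl _ _ (assoc_proj_continuous nA) (assoc_proj_continuous nB).
  by exists (assoc_proj_fun z).
have [i Ui] := cov_cover U (assoc_proj_fun x).
have [t [ht ht']] := hU i; set D := [set w : ptransl | _] in t ht ht'.
have Dx : D (assoc_repr x) by [].
have Dy : D (assoc_repr y) by rewrite exy in Ui.
suff e : t (sub_elt Dx) = t (sub_elt Dy).
  rewrite -(assoc_reprK x) -(assoc_reprK y); apply/assoc_piP.
  apply: orb_trans (ht (sub_elt Dx)) _; rewrite e.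
  exact: (orb_sym (ht (sub_elt Dy))).
have slice_nbhs z (Dz : D (assoc_repr z)) A : nbhs (t (sub_elt Dz)) A ->
    nbhs z [set x : assoc | exists v, assoc_pi (incl D v) = x /\ A (t v)].
  rewrite (@nbhsE ptransl) => -[B [oB Bz] BA].
  apply: (@filterS _ (nbhs z) _
    [set x : assoc | exists v, assoc_pi (incl D v) = x /\ B (t v)]).
    by move=> _ [v [<- Bv]]; exists v; split=> //; exact: BA.
  apply: open_nbhs_nbhs; split.
    exact: slice_open (cov_open i) ht' oB.
  by exists (sub_elt Dz); split=> //; exact: assoc_reprK.
apply: (@cg_hausdorff ptransl) => A B nA nB.
have [_ [[v [<- Av]] [v' [/assoc_piP vv' Bv]]]] :=
  cl _ _ (slice_nbhs _ _ _ nA) (slice_nbhs _ _ _ nB).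
by exists (t v); split=> //; rewrite -(ht' _ _ vv').
Qed.

Lemma assoc_generated : compactly_generated assoc.
Proof.
move=> O kO; rewrite assoc_openE; apply: (@cg_generated ptransl).
move=> K w cK Kw Ow.
have cK' := continuous_compact_image assoc_pi_continuous cK.
have h := kO _ _ cK' (imageP assoc_pi Kw) Ow.
apply: (@filterS _ (nbhs w) _ _ _ _ (assoc_pi_continuous h)) => v hv Kv.
by apply: hv; exact: imageP.
Qed.

Definition assoc_space : cgtop := CGTop assoc_hausdorff assoc_generated.

Definition assoc_pim : cmap ptransl assoc_space :=
  @cm ptransl assoc_space assoc_pi assoc_pi_continuous.

Lemma assoc_pim_sections : local_sections assoc_pim.
Proof.
have [U hU] := local_slice.
have oV i : open (assoc_proj_fun @^-1` U i).
  by move/continuousP: assoc_proj_continuous; apply; exact: cov_open.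
exists (@OpenCover assoc_space (cov_index U)
  (fun i => assoc_proj_fun @^-1` U i) oV
  (fun x => cov_cover U (assoc_proj_fun x))) => i.
have [t [ht ht']] := hU i.
set D := [set w : ptransl | _] in t ht ht'.
pose E : set assoc_space := assoc_proj_fun @^-1` U i.
have DE (z : cg_sub E) : D (assoc_repr (incl E z)) := inclP z.
have c : continuous (fun z : cg_sub E => t (sub_elt (DE z))).
  apply/continuousP => W oW.
  have oS := slice_open (@cov_open N U i) ht' oW.
  rewrite (_ : _ @^-1` W = incl E @^-1`
    [set x : assoc | exists v, assoc_pi (incl D v) = x /\ W (t v)]).
    by move: (@cts_fun _ _ (incl E)) => /continuousP; apply.
  apply/seteqP; split=> [z Wz|z [v [vz Wv]]].
    by exists (sub_elt (DE z)); split=> //; exact: assoc_reprK.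
  rewrite /= -(ht' v) //; apply/assoc_piP; rewrite vz; exact/esym/assoc_reprK.
exists (cm c) => z; rewrite -[RHS]assoc_reprK; apply/assoc_piP.
exact: (orb_sym (ht (sub_elt (DE z)))).
Qed.

Definition assoc_proj : cmap assoc_space N :=
  @cm assoc_space N assoc_proj_fun assoc_proj_continuous.

Lemma assoc_projE (w : ptransl) : assoc_proj (assoc_pi w) = proj P (fp1 w).
Proof. exact: assoc_proj_funE. Qed.

Definition assoc_anchor_fun (x : assoc) : L :=
  src H (fp2 (fp2 (assoc_repr x))).

Lemma assoc_anchor_funE (w : ptransl) :
  assoc_anchor_fun (assoc_pi w) = src H (fp2 (fp2 w)).
Proof. exact/orb_src/assoc_repr_orb. Qed.

Lemma assoc_anchor_continuous : continuous assoc_anchor_fun.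
Proof.
apply: assoc_continuous.
rewrite (_ : (fun w => _) = fun w => src H (fp2 (fp2 w))); last first.
  by apply: funext => w; exact: assoc_anchor_funE.
move=> w; apply: (@continuous_comp _ _ _ (fun w => fp2 (fp2 w)) (src H)).
  by apply: (@continuous_comp _ _ _ fp2 fp2); exact: cts_fun.
exact: cts_fun.
Qed.

Definition assoc_anchor : cmap assoc_space L :=
  @cm assoc_space L assoc_anchor_fun assoc_anchor_continuous.

Lemma assoc_anchorE (w : ptransl) :
  assoc_anchor (assoc_pi w) = src H (fp2 (fp2 w)).
Proof. exact: assoc_anchor_funE. Qed.

Lemma ract_subproof (w : ptransl) (b : arr H)
  (e : src H (fp2 (fp2 w)) = tgt H b) :
  mor0 phi (fp1 (fp2 w)) = tgt H (gmul e).
Proof. by rewrite gtgt; exact: fpP. Qed.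

(* [(p, (a, delta)) . b = (p, (a, delta o b))] *)
Definition ract (w : ptransl) (b : arr H)
    (e : src H (fp2 (fp2 w)) = tgt H b) : ptransl :=
  fpmk (fpP w : _ = fp1 (fpmk (ract_subproof e) : transl)).

Lemma ract_eq (w w' : ptransl) (b b' : arr H)
  (e : src H (fp2 (fp2 w)) = tgt H b) (e' : src H (fp2 (fp2 w')) = tgt H b') :
  w = w' -> b = b' -> ract e = ract e'.
Proof.
move=> ew eb; apply: fp_ext; first by rewrite !fp1K ew.
apply: fp_ext; first by rewrite !fp1K ew.
by rewrite !fp2K; apply: gmul_eq; rewrite ?ew.
Qed.

Lemma ract_orb (w w' : ptransl) (b : arr H)
  (e : src H (fp2 (fp2 w)) = tgt H b) (e' : src H (fp2 (fp2 w')) = tgt H b) :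
  orb w w' -> orb (ract e) (ract e').
Proof.
move=> /orbE[a [f [f' [h1 h2]]]]; apply/orbE.
have f'' : src G a = fp1 (fp2 (ract e')) by rewrite fp2K fp1K.
exists a, f, f''; split=> //.
apply: fp_ext; first by rewrite fp2K fp1K h2.
rewrite /lact !fp2K.
have e1 : src H (gmul (lact_subproof1 f')) = tgt H b by rewrite gsrc.
transitivity (gmul e1); first by apply: gmul_eq; rewrite ?h2.
exact/esym/gmulA.
Qed.

Lemma ract_continuous (W : cgtop) (u : W -> ptransl) (v : W -> arr H)
  (e : forall x, src H (fp2 (fp2 (u x))) = tgt H (v x)) :
  continuous u -> continuous v -> continuous (fun x => ract (e x)).
Proof.
move=> cu cv.
have cu2 : continuous (fun x => fp2 (u x)).
  by move=> x; apply: (@continuous_comp _ _ _ u fp2); [exact: cu|exact: cts_fun].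
apply: fpmk_continuous.
  by move=> x; apply: (@continuous_comp _ _ _ u fp1); [exact: cu|exact: cts_fun].
apply: fpmk_continuous.
  by move=> x; apply: (@continuous_comp _ _ _ (fun x => fp2 (u x)) fp1);
    [exact: cu2|exact: cts_fun].
apply: gmul_continuous => // x.
by apply: (@continuous_comp _ _ _ (fun x => fp2 (u x)) fp2);
    [exact: cu2|exact: cts_fun].
Qed.

Lemma assoc_act_subproof (z : fp assoc_anchor (tgt H)) :
  src H (fp2 (fp2 (assoc_repr (fp1 z)))) = tgt H (fp2 z).
Proof. exact: (fpP z). Qed.

Definition assoc_act_fun (z : fp assoc_anchor (tgt H)) : assoc_space :=
  assoc_pi (ract (assoc_act_subproof z)).

Lemma assoc_act_funE (w : ptransl) (b : arr H)
  (e : assoc_anchor (assoc_pi w) = tgt H b)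
  (e' : src H (fp2 (fp2 w)) = tgt H b) :
  assoc_act_fun (fpmk e) = assoc_pi (ract e').
Proof.
apply/assoc_piP.
exact: (ract_orb (assoc_act_subproof (fpmk e)) e' (assoc_repr_orb w)).
Qed.

Lemma assoc_act_continuous : continuous assoc_act_fun.
Proof.
have hs w : (src H \o (fp2 \o fp2)) w = assoc_anchor (assoc_pim w).
  by rewrite /= assoc_anchorE.
have ht b : tgt H b = tgt H (cm_id (arr H) b) by [].
pose h : cmap ptransl L := cm_comp (src H) (cm_comp fp2 fp2).
have sec := fp_map_local_sections (h := h) (h' := tgt H) hs ht
  assoc_pim_sections (local_sections_id (arr H)).
apply: (local_sections_continuous sec).
have e (z : fp h (tgt H)) : src H (fp2 (fp2 (fp1 z))) = tgt H (fp2 z).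
  exact: (fpP z).
have ck : continuous (fun z => assoc_pim (ract (e z))).
  move=> z; apply: (@continuous_comp _ _ _ (fun z => ract (e z)) assoc_pim).
    by apply: ract_continuous; exact: cts_fun.
  exact: cts_fun.
rewrite (_ : _ \o _ = fun z => assoc_pim (ract (e z))) //.
by apply: funext => z; exact: assoc_act_funE.
Qed.

Definition assoc_act : cmap (fp assoc_anchor (tgt H)) assoc_space :=
  cm assoc_act_continuous.

Lemma assoc_actE (w : ptransl) (b : arr H)
  (e : assoc_anchor (assoc_pi w) = tgt H b)
  (e' : src H (fp2 (fp2 w)) = tgt H b) :
  assoc_act (fpmk e) = assoc_pi (ract e').
Proof. exact: assoc_act_funE. Qed.

Lemma assoc_ind (T : assoc -> Prop) :
  (forall w, T (assoc_pi w)) -> forall x, T x.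
Proof. by move=> h x; rewrite -(assoc_reprK x). Qed.

Lemma assoc_anchor_act (x : assoc_space) (b : arr H)
  (e : assoc_anchor x = tgt H b) : assoc_anchor (assoc_act (fpmk e)) = src H b.
Proof.
elim/assoc_ind: x e => w e.
have e' : src H (fp2 (fp2 w)) = tgt H b by rewrite -assoc_anchorE.
by rewrite (assoc_actE e e') assoc_anchorE !fp2K gsrc.
Qed.

Lemma assoc_act_one (x : assoc_space)
  (e : assoc_anchor x = tgt H (gone H (assoc_anchor x))) :
  assoc_act (fpmk e) = x.
Proof.
elim/assoc_ind: x e => w e.
have e' : src H (fp2 (fp2 w)) = tgt H (gone H (assoc_anchor (assoc_pi w))).
  by rewrite -assoc_anchorE.
rewrite (assoc_actE e e'); congr assoc_pi.
apply: fp_ext => //; apply: fp_ext => //.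
by rewrite !fp2K; apply: gmul_one; rewrite assoc_anchorE.
Qed.

Lemma assoc_act_mul (x : assoc_space) (a b : arr H)
  (e : assoc_anchor x = tgt H a) (ab : src H a = tgt H b)
  (e' : assoc_anchor (assoc_act (fpmk e)) = tgt H b)
  (e'' : assoc_anchor x = tgt H (gmul ab)) :
  assoc_act (fpmk e') = assoc_act (fpmk e'').
Proof.
elim/assoc_ind: x e e' e'' => w e e' e''.
have f : src H (fp2 (fp2 w)) = tgt H a by rewrite -assoc_anchorE.
have f'' : src H (fp2 (fp2 w)) = tgt H (gmul ab) by rewrite -assoc_anchorE.
have g : assoc_anchor (assoc_pi (ract f)) = tgt H b.
  by rewrite -(assoc_actE e f).
have f' : src H (fp2 (fp2 (ract f))) = tgt H b by rewrite -assoc_anchorE.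
rewrite (assoc_actE e'' f'').
have -> : fpmk e' = fpmk g by apply: fpmk_eq => //; exact: assoc_actE.
rewrite (assoc_actE g f'); congr assoc_pi.
apply: fp_ext => //; apply: fp_ext => //.
exact/esym/gmulA.
Qed.

Definition assoc_raction : right_action H assoc_space :=
  RightAction assoc_anchor_act assoc_act_one assoc_act_mul.

Lemma assoc_proj_act (x : assoc_space) (b : arr H)
  (e : anchor assoc_raction x = tgt H b) :
  assoc_proj (act assoc_raction (fpmk e)) = assoc_proj x.
Proof.
elim/assoc_ind: x e => w e.
have e' : src H (fp2 (fp2 w)) = tgt H b by rewrite -assoc_anchorE.
by rewrite [act _ _](assoc_actE e e') !assoc_projE.
Qed.

Lemma assoc_proj_sections : local_sections assoc_proj.
Proof.
have [U hU] := proj_sections P; exists U => i; have [s hs] := hU i.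
have e1 n : mor0 phi (anchor (raction P) (s n)) =
    tgt H (gone H (mor0 phi (anchor (raction P) (s n)))) by rewrite tgt_one.
pose q n : transl := fpmk (e1 n).
have e2 n : anchor (raction P) (s n) = fp1 (q n) by [].
have ca : continuous (fun n => anchor (raction P) (s n)).
  by move=> n; apply: (@continuous_comp _ _ _ s (anchor (raction P)));
    exact: cts_fun.
have c : continuous (fun n => assoc_pim (fpmk (e2 n))).
  move=> n; apply: (@continuous_comp _ _ _ (fun n => fpmk (e2 n)) assoc_pim).
    apply: fpmk_continuous; first exact: cts_fun.
    apply: fpmk_continuous => // {}n.
    apply: (@continuous_comp _ _ _
      (fun n => mor0 phi (anchor (raction P) (s n))) (gone H)).
      apply: (@continuous_comp _ _ _ (fun n => anchor (raction P) (s n))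
        (mor0 phi)); first exact: ca.
      exact: cts_fun.
    exact: cts_fun.
  exact: cts_fun.
exists (@cm _ assoc_space _ c) => n.
by rewrite -hs; exact: assoc_projE.
Qed.

Lemma assoc_free (x : assoc_space) (b b' : arr H)
  (e : assoc_anchor x = tgt H b) (e' : assoc_anchor x = tgt H b') :
  assoc_act (fpmk e) = assoc_act (fpmk e') -> b = b'.
Proof.
elim/assoc_ind: x e e' => w e e'.
have f : src H (fp2 (fp2 w)) = tgt H b by rewrite -assoc_anchorE.
have f' : src H (fp2 (fp2 w)) = tgt H b' by rewrite -assoc_anchorE.
rewrite (assoc_actE e f) (assoc_actE e' f') => /assoc_piP/orb_free.
move=> /(_ erefl) /(congr1 fp2) /(congr1 fp2).
exact: gmulI.
Qed.

Lemma assoc_div : exists d : cmap (fp assoc_proj assoc_proj) (arr H),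
  forall z, exists e : assoc_anchor (fp1 z) = tgt H (d z),
    assoc_act (fpmk e) = fp2 z.
Proof.
have [d hd] := bundle_div P.
have [h hE] : exists h : cmap ptransl N, forall w, h w = proj P (fp1 w).
  by exists (cm_comp (proj P) fp1).
(* on representatives: [delta^-1 o (phi_1 (p'/p) o delta')] *)
have e0 (z : fp h h) : proj P (fp1 (fp1 z)) = proj P (fp1 (fp2 z)).
  by rewrite -!hE; exact: fpP.
pose p z : fp (proj P) (proj P) := fpmk (e0 z).
have cp : continuous p.
  apply: fpmk_continuous => z.
    by apply: (@continuous_comp _ _ _ fp1 fp1); exact: cts_fun.
  by apply: (@continuous_comp _ _ _ fp2 fp1); exact: cts_fun.
have e1 z : anchor (raction P) (fp1 (fp1 z)) = tgt G (d (p z)).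
  by have [] := hd (p z).
have e2 z : act (raction P) (fpmk (e1 z)) = fp1 (fp2 z).
  by have [e he] := hd (p z); apply: etrans he; exact: act_eq.
have e3 z : src G (d (p z)) = fp1 (fp2 (fp2 z)).
  by rewrite -(fpP (fp2 z)) -(anchor_act (e1 z)) e2.
pose q z := lact (e3 z).
have e4 z : src H (ginv (fp2 (fp2 (fp1 z)))) = tgt H (fp2 (q z)).
  rewrite src_inv -(fpP (q z)) -(fpP (fp2 (fp1 z))) fp1K -(e1 z).
  by rewrite (fpP (fp1 z)).
pose b z := gmul (e4 z).
have cb : continuous b.
  apply: gmul_continuous => z.
    apply: (@continuous_comp _ _ _ (fun z : fp h h => fp2 (fp2 (fp1 z))) ginv).
      apply: (@continuous_comp _ _ _ (fun z : fp h h => fp2 (fp1 z)) fp2).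
        by apply: (@continuous_comp _ _ _ fp1 fp2); exact: cts_fun.
      exact: cts_fun.
    exact: cts_fun.
  apply: (@continuous_comp _ _ _ q fp2); last exact: cts_fun.
  apply: lact_continuous => {}z.
    by apply: (@continuous_comp _ _ _ p d); [exact: cp|exact: cts_fun].
  by apply: (@continuous_comp _ _ _ fp2 fp2); exact: cts_fun.
have e5 z : src H (fp2 (fp2 (fp1 z))) = tgt H (b z).
  by rewrite gtgt tgt_inv.
have hb z : assoc_pi (ract (e5 z)) = assoc_pi (fp2 z).
  apply/assoc_piP/orbE; exists (d (p z)), (e1 z), (e3 z); split.
    by rewrite e2.
  apply: fp_ext; first by rewrite fp2K !fp1K -(e1 z) (fpP (fp1 z)).
  rewrite !fp2K.
  have e6 : src H (fp2 (fp2 (fp1 z))) = tgt H (ginv (fp2 (fp2 (fp1 z)))).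
    by rewrite tgt_inv.
  have e7 : src H (gmul e6) = tgt H (fp2 (q z)) by rewrite gsrc.
  rewrite (gmulA _ e7); apply: one_gmul; rewrite (gmulV e6 erefl).
  by rewrite -e7 gsrc src_inv.
have ho (w : ptransl) : h w = assoc_proj (assoc_pim w).
  by rewrite hE; exact/esym/assoc_projE.
have sec := fp_map_local_sections (h := h) (h' := h) ho ho
  assoc_pim_sections assoc_pim_sections.
have e8 (z : fp assoc_proj assoc_proj) :
  h (assoc_repr (fp1 z)) = h (assoc_repr (fp2 z)).
  by rewrite !hE; exact: (fpP z).
pose c z := b (fpmk (e8 z)).
have hc z : exists e : assoc_anchor (fp1 z) = tgt H (c z),
    assoc_act (fpmk e) = fp2 z.
  have e : assoc_anchor (fp1 z) = tgt H (c z) by exact: (e5 (fpmk (e8 z))).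
  exists e; rewrite -[RHS]assoc_reprK -[RHS](hb (fpmk (e8 z))).
  by congr assoc_pi; apply: ract_eq.
suff cc : continuous c by exists (cm cc).
apply: (local_sections_continuous sec).
suff cE : c \o fp_map ho ho = b by rewrite cE.
apply: funext => z; have [e he] := hc (fp_map ho ho z).
have e' : assoc_anchor (assoc_pi (fp1 z)) = tgt H (b z) by rewrite assoc_anchorE.
apply: (assoc_free (x := assoc_pi (fp1 z)) (e := e) (e' := e')).
by rewrite (assoc_actE e' (e5 z)) hb; exact: he.
Qed.

Lemma assoc_shear_homeo : homeomorphism (shear assoc_proj_act).
Proof.
have [d hd] := assoc_div.
have e z : assoc_anchor (fp1 z) = tgt H (d z) by have [] := hd z.
have eE z : assoc_act (fpmk (e z)) = fp2 z.
  by have [e' <-] := hd z; exact: (act_eq (r := assoc_raction)).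
have c : continuous (fun z => fpmk (e z)).
  by apply: fpmk_continuous; exact: cts_fun.
exists (cm c); split=> z; last by apply: fp_ext => //; exact: eE.
apply: fp_ext => //; set y := shear _ z.
apply: (assoc_free (e := e y) (e' := fpP z)).
by rewrite eE; congr (assoc_act _); exact: fp_ext.
Qed.

Definition assoc_bundle : principal_bundle H N :=
  PrincipalBundle assoc_proj_sections assoc_shear_homeo.

End Bundle.

Section BundleMor.
Variables (N N' : cgtop) (P : principal_bundle G N) (P' : principal_bundle G N')
  (f : bundle_mor P P').

Lemma ptransl_map_subproof (w : ptransl P) :
  anchor (raction P') (bm_total f (fp1 w)) = fp1 (fp2 w).
Proof. by rewrite bm_anchor fpP. Qed.

Definition ptransl_map (w : ptransl P) : ptransl P' :=
  fpmk (ptransl_map_subproof w).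

Lemma ptransl_map_continuous : continuous ptransl_map.
Proof.
apply: fpmk_continuous; last exact: cts_fun.
by move=> w; apply: (@continuous_comp _ _ _ fp1 (bm_total f)); exact: cts_fun.
Qed.

Lemma ptransl_map_orb (w w' : ptransl P) :
  orb w w' -> orb (ptransl_map w) (ptransl_map w').
Proof.
move=> [a [e [e' [h1 h2]]]].
have g : anchor (raction P') (fp1 (ptransl_map w)) = tgt G a.
  by rewrite -e; exact: bm_anchor.
by exists a, g, e'; split=> //; rewrite fp1K h1; exact: bm_act.
Qed.

Definition assoc_map_fun (x : assoc P) : assoc P' :=
  assoc_pi (ptransl_map (assoc_repr x)).

Lemma assoc_map_funE (w : ptransl P) :
  assoc_map_fun (assoc_pi w) = assoc_pi (ptransl_map w).
Proof. by apply/assoc_piP/ptransl_map_orb; exact: assoc_repr_orb. Qed.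

Lemma assoc_map_continuous : continuous assoc_map_fun.
Proof.
apply: assoc_continuous.
rewrite (_ : (fun w => _) = fun w => assoc_pim P' (ptransl_map w)); last first.
  by apply: funext => w; exact: assoc_map_funE.
move=> w; apply: (@continuous_comp _ _ _ ptransl_map (assoc_pim P')).
  exact: ptransl_map_continuous.
exact: cts_fun.
Qed.

Definition assoc_map : cmap (assoc_space P) (assoc_space P') :=
  @cm (assoc_space P) (assoc_space P') assoc_map_fun assoc_map_continuous.

Lemma assoc_mapE (w : ptransl P) :
  assoc_map (assoc_pi w) = assoc_pi (ptransl_map w).
Proof. exact: assoc_map_funE. Qed.

Definition assoc_mor : bundle_mor (assoc_bundle P) (assoc_bundle P').
Proof.
exists (bm_base f) assoc_map.
- elim/assoc_ind => w; rewrite assoc_mapE [LHS]assoc_projE [in RHS]assoc_projE.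
  by rewrite fp1K; exact: bm_proj.
- by elim/assoc_ind => w; rewrite assoc_mapE [LHS]assoc_anchorE [RHS]assoc_anchorE.
- elim/assoc_ind => w b e e'.
  have g : src H (fp2 (fp2 w)) = tgt H b by rewrite -assoc_anchorE.
  have g1 : assoc_anchor P' (assoc_pi (ptransl_map w)) = tgt H b.
    by rewrite -assoc_mapE.
  rewrite [act _ _](assoc_actE e g) assoc_mapE.
  transitivity (assoc_act P' (fpmk g1)).
    rewrite (assoc_actE g1 g); congr assoc_pi; apply: fp_ext => //.
    exact: fp_ext.
  by congr (assoc_act _ _); apply: fpmk_eq; rewrite ?assoc_mapE.
Defined.

End BundleMor.

(* The morphism of stacks associated with [phi]. *)
Definition BG_map : fmor (BG G) (BG H).
Proof.
refine (@FMor (BG G) (BG H) assoc_bundle assoc_mor _ _ _).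
- move=> N P; apply: bundle_mor_ext => //; apply: cm_ext.
  elim/assoc_ind => w; rewrite [LHS]assoc_mapE; congr assoc_pi.
  exact: fp_ext.
- move=> N N' N'' P P' P'' h k; apply: bundle_mor_ext => //; apply: cm_ext.
  elim/assoc_ind => w; rewrite [LHS]assoc_mapE.
  transitivity (assoc_map h (assoc_map k (assoc_pi w))) => //.
  by rewrite !assoc_mapE; congr assoc_pi; exact: fp_ext.
- by [].
Defined.

End Associated.

Section Fibrations.
Variable R : realType.

Definition unit_interval : cgtop :=
  cg_kify (set_type_hausdorff (A := [set x : R | (0 <= x <= 1)%R])
    (@Rhausdorff R)).

Lemma zero_in_interval : (0 <= (0 : R) <= 1)%R.
Proof. by rewrite lexx ler01. Qed.

Definition interval0 : unit_interval :=
  exist _ 0%R (mem_set zero_in_interval) : [set x : R | (0 <= x <= 1)%R].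

Definition cube (n : nat) : cgtop :=
  cg_kify (@hausdorff_product 'I_n (fun _ => unit_interval)
    (fun _ => @cg_hausdorff unit_interval)).

Definition cg_prod (X Y : cgtop) : cgtop :=
  cg_kify (prod_hausdorff (@cg_hausdorff X) (@cg_hausdorff Y)).

Definition homotopy_lifting (Z X Y : cgtop) (f : cmap X Y) : Prop :=
  forall (h : cmap (cg_prod Z unit_interval) Y) (g : cmap Z X),
    (forall z, f (g z) = h (z, interval0)) ->
    exists k : cmap (cg_prod Z unit_interval) X,
      (forall z, k (z, interval0) = g z) /\ (forall w, f (k w) = h w).

Definition hurewicz_fibration (X Y : cgtop) (f : cmap X Y) : Prop :=
  forall Z : cgtop, homotopy_lifting Z f.

Definition serre_fibration (X Y : cgtop) (f : cmap X Y) : Prop :=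
  forall n : nat, homotopy_lifting (cube n) f.

End Fibrations.

Definition locally_fibration
    (Fib : forall X Y : cgtop, cmap X Y -> Prop)
    (X Y : cgtop) (f : cmap X Y) : Prop :=
  forall x : X, exists (U : set X) (V : set Y)
    (g : cmap (cg_sub U) (cg_sub V)),
    [/\ open U /\ U x, open V /\ V (f x),
        forall u, incl V (g u) = f (incl U u) & Fib _ _ g].

Definition topological_stack (D : catover) : Prop :=
  is_stack D /\
  exists (M : cgtop) (G : tgroupoid M), equivalent D (BG G).

Definition is_gerbe (D C : catover) (F : fmor D C) : Prop :=
  [/\ topological_stack D, topological_stack C,
      epimorphism F & epimorphism (diagonal F)].

(* [Fib] is to be instantiated by the Hurewicz or by the Serre fibrations. *)
Section FibrationStacks.
Variable Fib : forall X Y : cgtop, cmap X Y -> Prop.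

Definition fibration_stack (D : catover) : Prop :=
  is_stack D /\
  exists (M : cgtop) (G : tgroupoid M),
    locally_fibration Fib (src G) /\ equivalent D (BG G).

Definition fibration_morphism (D C : catover) (F : fmor D C) : Prop :=
  [/\ topological_stack D, topological_stack C &
      forall (U : cgtop) (q : fmor (repstack U) C),
        fibration_stack (two_fiber F q)].

Definition fibration_gerbe (D C : catover) (F : fmor D C) : Prop :=
  is_gerbe F /\ fibration_morphism F.

End FibrationStacks.

Definition hurewicz_gerbe (R : realType) (D C : catover) (F : fmor D C) :=
  fibration_gerbe (@hurewicz_fibration R) F.

Definition serre_gerbe (R : realType) (D C : catover) (F : fmor D C) :=
  fibration_gerbe (@serre_fibration R) F.

(* Main.v *)
From HB Require Import structures.
Require Import Defs.
From mathcomp Require Import all_boot all_order all_algebra.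
From mathcomp Require Import all_classical all_reals topology.
From mathcomp Require Import generic_quotient.
(* Once more, so that [incl] is the inclusion of a subspace. *)
Import Defs.

(** Let [q : U -> BH] be a morphism of stacks and let [Q] be the principal
    [H]-bundle over [U] that it classifies. Since [F] is the identity on objects,
    [G] acts on the total space of [Q] through [F]. An object over [N] of the
    2-fiber product of [BG -> BH] and [q] is a principal [G]-bundle [P] over [N],
    a map [u : N -> U] and an isomorphism from the induced [H]-bundle of [P] to
    the pullback of [Q] along [u]. By the universal property of the induced
    bundle ([assoc_mor_ex], [assoc_mor_eq]) and because bundle morphisms are
    pullback squares, such data amount to a [G]-equivariant map [P -> Q], that is,
    to a principal bundle for the action groupoid of [G] on [Q]. The 2-fiber
    product is therefore the stack of principal bundles of this action groupoid
    ([fiber_functor_ff], [fiber_functor_es]); the descent conditions are inherited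
    along the equivalence ([stack_of_ff_es]).

    An arrow of the action groupoid is determined by its source [y] in [Q] and its
    component [a] in [G], which are only subject to [src a = anchor y]: the target
    is [y . a^-1]. Hence the source map of the action groupoid is the pullback of
    the source map of [G] along the anchor of [Q]
    ([src_action_groupoid_pullback]). Fibrations are defined by homotopy lifting,
    so being locally a fibration is stable under pullback
    ([locally_fibration_pullback]), for Hurewicz and for Serre fibrations alike.

    That [BG -> BH] is a gerbe is a matter of local lifting. By the Yoneda lemma a
    morphism is an epimorphism as soon as every object is locally isomorphic to an
    image ([epimorphism_of_local]). For [BG -> BH], a local section of an
    [H]-bundle trivializes it, and a trivial [H]-bundle is induced by a trivial
    [G]-bundle with the same anchor. For the diagonal, an isomorphism between the
    bundles induced by [P] and [P'] is described, in terms of local sections of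
    [P] and [P'], by a map to the arrows of [H]; the local sections of [F] lift
    this map to the arrows of [G], and so lift the isomorphism to one between the
    restrictions of [P] and [P'].

    The stack condition for principal bundles ([is_stack_BG]) rests on the fact
    that a bundle morphism is a pullback square of spaces
    ([bundle_mor_cartesian]). It makes [BG] fibered in groupoids and makes the
    restriction to an open subset an open embedding of total spaces, so that
    morphisms glue; bundles are glued by forming the quotient of the disjoint
    union of their total spaces ([glue_exists]). *)

Set Implicit Arguments.
Unset Strict Implicit.
Unset Printing Implicit Defensive.

Local Open Scope classical_set_scope.
Local Open Scope quotient_scope.

(** * Continuity and local sections *)

Lemma ccomp (X Y Z : cgtop) (f : X -> Y) (g : cmap Y Z) :
  continuous f -> continuous (fun x => g (f x)).
Proof.
by move=> cf x; apply: (@continuous_comp _ _ _ f g); [exact: cf|exact: cts_fun].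
Qed.

Lemma sub_elt_continuous (W X : cgtop) (A : set X) (u : W -> X)
  (h : forall w, A (u w)) : continuous u -> continuous (fun w => sub_elt (h w)).
Proof. by move=> cu; apply: cg_sub_continuous. Qed.

Lemma cts_idfun (X : cgtop) : continuous (fun x : X => x).
Proof. exact: (cts_fun (s := cm_id X)). Qed.

(** Continuity of a map assembled from the operations of pullbacks, groupoids
    and actions is proved by following the shape of the expression. *)
Ltac cont :=
  repeat first [ exact: cts_fun | exact: cts_idfun | assumption | apply: fpmk_continuous
    | apply: sub_elt_continuous | apply: gmul_continuous
    | apply: act_continuous | apply: lact_continuous | apply: ract_continuous
    | apply: ccomp ].

(** Continuity may be checked on open subspaces; their topology is the kified
    one, so this needs that open subspaces are embedded by open maps. *)
Lemma continuous_local (X : cgtop) (T : topologicalType) (f : X -> T) :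
  (forall x, exists A : set X,
    [/\ open A, A x & continuous (fun z : cg_sub A => f (incl A z))]) ->
  continuous f.
Proof.
move=> h; apply/continuousP => W oW.
rewrite openE => y Wy; have [A [oA Ay /continuousP cA]] := h y.
have oI := open_incl_image oA (cA _ oW).
apply: (@filterS _ (nbhs y) _ _ _ _ (open_nbhs_nbhs (conj oI _))).
  by move=> _ [z Bz <-].
by exists (sub_elt Ay).
Qed.

Lemma open_preimage (X Y : cgtop) (f : X -> Y) (A : set Y) :
  continuous f -> open A -> open [set x | A (f x)].
Proof. by move=> /continuousP h /h. Qed.

Lemma local_sections_surj (X Y : cgtop) (f : cmap X Y) :
  local_sections f -> forall y, exists x, f x = y.
Proof.
move=> [U hU] y; have [i Uy] := cov_cover U y; have [s hs] := hU i.
by exists (s (sub_elt Uy)); rewrite hs.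
Qed.

Lemma local_sections_pt (X Y : cgtop) (f : cmap X Y) :
  (forall y, exists (A : set Y) (s : cg_sub A -> X),
    [/\ open A, A y, continuous s & forall z, f (s z) = incl A z]) ->
  local_sections f.
Proof.
move=> h; have [A hA] := choice h.
have oA y : open (A y) by have [s []] := hA y.
have cA y : exists i, A i y by exists y; have [s []] := hA y.
exists (OpenCover oA cA) => y; have [s [_ _ cs hs]] := hA y.
by exists (cm cs).
Qed.

Lemma local_sections_at (X Y : cgtop) (f : cmap X Y) : local_sections f ->
  forall y, exists (A : set Y) (s : cmap (cg_sub A) X),
    [/\ open A, A y & forall z, f (s z) = incl A z].
Proof.
move=> [U hU] y; have [i Uy] := cov_cover U y; have [s hs] := hU i.
by exists (U i), s; split=> //; exact: cov_open.
Qed.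

Lemma fp1_local_sections (X Y Z : cgtop) (f : cmap X Z) (g : cmap Y Z) :
  local_sections g -> local_sections (fp1 : cmap (fp f g) X).
Proof.
move=> /local_sections_at hg; apply: local_sections_pt => x.
have [A [s [oA Ax hs]]] := hg (f x).
pose B : set X := [set x | A (f x)].
have e (z : cg_sub B) : f (incl B z) = 
    g (s (sub_elt (inclP z : A (f (incl B z))))) by rewrite hs.
exists B, (fun z => fpmk (e z)); split=> //.
- by apply: open_preimage => //; exact: cts_fun.
- by cont.
Qed.

(** * Principal bundles *)

Section Bundles.
Variables (M : cgtop) (G : tgroupoid M).

Section BundleOfDiv.
Variables (N P : cgtop) (r : right_action G P) (p : cmap P N).
Hypothesis inv : forall x a (e : anchor r x = tgt G a), p (act r (fpmk e)) = p x.
Hypothesis sec : local_sections p.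
Hypothesis free : forall x a b (e : anchor r x = tgt G a)
  (e' : anchor r x = tgt G b), act r (fpmk e) = act r (fpmk e') -> a = b.
Hypothesis div : exists d : cmap (fp p p) (arr G), forall z,
  exists e : anchor r (fp1 z) = tgt G (d z), act r (fpmk e) = fp2 z.

(** The second component of the inverse of the shear map sends [(p, p')] to the
    unique arrow [a] with [p . a = p']; conversely such a continuous division
    inverts the shear map. *)
Lemma shear_homeo_of_div : homeomorphism (shear inv).
Proof.
have [d dE] := div.
have e z : anchor r (fp1 z) = tgt G (d z) by have [] := dE z.
have eE z : act r (fpmk (e z)) = fp2 z.
  by have [e' <-] := dE z; exact: act_eq.
have c : continuous (fun z => fpmk (e z)) by cont.
exists (cm c); split=> z; last by apply: fp_ext => //; exact: eE.
apply: fp_ext => //; set y := shear _ z.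
apply: (free (e := e y) (e' := fpP z)).
by rewrite eE; congr (act _ _); exact: fp_ext.
Qed.

Definition bundle_of_div : principal_bundle G N :=
  PrincipalBundle sec shear_homeo_of_div.

End BundleOfDiv.

Lemma bundle_divE (N : cgtop) (P : principal_bundle G N) :
  exists d : cmap (fp (proj P) (proj P)) (arr G),
  forall x y (h : proj P x = proj P y),
  exists e : anchor (raction P) x = tgt G (d (fpmk h)),
    act (raction P) (fpmk e) = y.
Proof. by have [d hd] := bundle_div P; exists d => x y h; exact: (hd (fpmk h)). Qed.

(** Two points of a fibre differ by a unique arrow, and this arrow can be read
    off from their images. *)
Lemma bundle_mor_inj (V W : cgtop) (P' : principal_bundle G V)
  (P : principal_bundle G W) (k : bundle_mor P' P) (x y : total P') :
  bm_total k x = bm_total k y -> proj P' x = proj P' y -> x = y.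
Proof.
move=> ek ep; have [d hd] := bundle_divE P'.
have [e eE] := hd _ _ ep.
rewrite -eE; apply/esym/act_oneE.
have e' : anchor (raction P) (bm_total k x) = tgt G (d (fpmk ep)).
  by rewrite bm_anchor.
have e1 : anchor (raction P) (bm_total k x) =
    tgt G (gone G (anchor (raction P') x)) by rewrite tgt_one bm_anchor.
apply: (bundle_free (e := e') (e' := e1)).
rewrite -(bm_act e e') eE -ek act_oneE //.
by rewrite bm_anchor.
Qed.

(** A bundle morphism is a pullback square of spaces. Over a point [p] of the
    fibre over [n x], the lift of [f x] is [p . a], where [a] carries the image of
    [p] to [f x]; it does not depend on [p], and it is continuous because [p] can
    be chosen continuously near each point. *)
Lemma bundle_mor_cartesian (V W : cgtop) (P' : principal_bundle G V)
  (P : principal_bundle G W) (k : bundle_mor P' P)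
  (X : cgtop) (f : cmap X (total P)) (n : cmap X V) :
  (forall x, bm_base k (n x) = proj P (f x)) ->
  exists g : cmap X (total P'),
    forall x, bm_total k (g x) = f x /\ proj P' (g x) = n x.
Proof.
move=> e; have [d hd] := bundle_divE P.
pose q : cmap (fp n (proj P')) X := fp1.
have sq : local_sections q by exact/fp1_local_sections/proj_sections.
have e1 (z : fp n (proj P')) :
    proj P (bm_total k (fp2 z)) = proj P (f (q z)).
  by rewrite bm_proj -e -(fpP z).
have e2 z : anchor (raction P') (fp2 z) = tgt G (d (fpmk (e1 z))).
  by have [e2 _] := hd _ _ (e1 z); rewrite -e2 bm_anchor.
pose h z := act (raction P') (fpmk (e2 z)).
have ch : continuous h by cont.
have hE z : bm_total k (h z) = f (q z) /\ proj P' (h z) = n (q z).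
  split; last by rewrite proj_act -(fpP z).
  have [e3 <-] := hd _ _ (e1 z).
  exact: bm_act.
have /choice[g gE] : forall x, exists y,
    bm_total k y = f x /\ proj P' y = n x.
  move=> x; have [z <-] := local_sections_surj sq x.
  by exists (h z).
have cg : continuous g.
  apply: (local_sections_continuous sq).
  rewrite (_ : _ \o _ = h) //; apply: funext => z /=.
  have [h1 h2] := hE z; have [g1 g2] := gE (q z).
  by apply: (bundle_mor_inj (k := k)); rewrite ?g1 ?g2.
by exists (cm cg).
Qed.

Section Pullback.
Variables (V W : cgtop) (f : cmap V W) (P : principal_bundle G W).

Definition pb_space : cgtop := fp f (proj P).

Lemma pb_act_subproof0 (z : fp (cm_comp (anchor (raction P))
    (fp2 : cmap pb_space _)) (tgt G)) :
  anchor (raction P) (fp2 (fp1 z)) = tgt G (fp2 z).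
Proof. exact: (fpP z). Qed.

Lemma pb_act_subproof z :
  f (fp1 (fp1 z)) = proj P (act (raction P) (fpmk (pb_act_subproof0 z))).
Proof. by rewrite proj_act; exact: fpP. Qed.

Lemma pb_act_continuous : continuous (fun z => fpmk (pb_act_subproof z)).
Proof. by cont. Qed.

Definition pb_raction : right_action G pb_space.
Proof.
refine (@RightAction _ G pb_space (cm_comp (anchor (raction P)) fp2)
  (@cm _ pb_space _ pb_act_continuous) _ _ _).
- by move=> p a e; exact: (anchor_act (pb_act_subproof0 (fpmk e))).
- move=> p e; apply: fp_ext => //; rewrite [LHS]fp2K; exact: act_oneE.
- move=> p a b e ab e' e''; apply: fp_ext => //.
  rewrite [LHS]fp2K [RHS]fp2K.
  have e1 : anchor (raction P) (fp2 (p : pb_space)) = tgt G a by exact: e.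
  have e2 : anchor (raction P) (act (raction P) (fpmk e1)) = tgt G b.
    by rewrite anchor_act.
  transitivity (act (raction P) (fpmk e2)).
    by apply: act_eq => //; exact: act_eq.
  by rewrite (act_mul (ab := ab) e2 e''); exact: act_eq.
Defined.

Definition pb_bundle : principal_bundle G V.
Proof.
apply: (@bundle_of_div _ pb_space pb_raction fp1).
- by [].
- exact/fp1_local_sections/proj_sections.
- by move=> x a b e e' /(congr1 fp2); rewrite [LHS]fp2K [RHS]fp2K => /bundle_free.
have [d hd] := bundle_divE P.
have e0 (z : fp (fp1 : cmap pb_space V) (fp1 : cmap pb_space V)) :
    proj P (fp2 (fp1 z)) = proj P (fp2 (fp2 z)).
  by rewrite -!fpP (fpP z).
have cd : continuous (fun z => d (fpmk (e0 z))) by cont.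
exists (cm cd) => z; have [e eE] := hd _ _ (e0 z); exists e.
apply: fp_ext; first exact: (fpP z).
rewrite [LHS]fp2K -[RHS]eE; exact: act_eq.
Defined.

Definition pb_mor : bundle_mor pb_bundle P.
Proof.
exists f fp2.
- by move=> p; exact/esym/fpP.
- by [].
- by move=> p a e e'; rewrite [LHS]fp2K; exact: act_eq.
Defined.

End Pullback.

(** The trivial bundle with anchor [m] consists of the arrows of [G] with target
    on [m]; it is the pullback along [m] of the bundle of arrows of [G]. *)
Section Trivial.
Variables (V : cgtop) (m : cmap V M).

Definition triv_space : cgtop := fp m (tgt G).

Lemma triv_act_subproof0 (z : fp (cm_comp (src G)
    (fp2 : cmap triv_space _)) (tgt G)) :
  src G (fp2 (fp1 z)) = tgt G (fp2 z).
Proof. exact: (fpP z). Qed.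

Lemma triv_act_subproof z :
  m (fp1 (fp1 z)) = tgt G (gmul (triv_act_subproof0 z)).
Proof. by rewrite gtgt; exact: fpP. Qed.

Lemma triv_act_continuous : continuous (fun z => fpmk (triv_act_subproof z)).
Proof. by cont. Qed.

Definition triv_raction : right_action G triv_space.
Proof.
refine (@RightAction _ G triv_space (cm_comp (src G) fp2)
  (@cm _ triv_space _ triv_act_continuous) _ _ _).
- by move=> p a e /=; rewrite fp2K gsrc.
- by move=> p e; apply: fp_ext => //; rewrite [LHS]fp2K; exact: gmul_one.
- move=> p a b e ab e' e''; apply: fp_ext => //.
  rewrite [LHS]fp2K [RHS]fp2K.
  have e1 : src G (gmul (e : src G (fp2 p) = tgt G a)) = tgt G b by rewrite gsrc.
  transitivity (gmul e1); first by apply: gmul_eq => //; exact: gmul_eq.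
  by rewrite -(gmulA (ab := e) e'' e1); exact: gmul_eq.
Defined.

Definition triv_bundle : principal_bundle G V.
Proof.
apply: (@bundle_of_div _ triv_space triv_raction fp1).
- by [].
- have e1 v : m v = tgt G (gone G (m v)) by rewrite tgt_one.
  apply: local_sections_pt => v.
  exists setT, (fun z => fpmk (e1 (incl setT z))); split=> //; first exact: openT.
  by cont.
- by move=> x a b e e' /(congr1 fp2); rewrite [LHS]fp2K [RHS]fp2K => /gmulI.
have e0 (z : fp (fp1 : cmap triv_space V) (fp1 : cmap triv_space V)) :
    src G (ginv (fp2 (fp1 z))) = tgt G (fp2 (fp2 z)).
  by rewrite src_inv -!fpP (fpP z).
have cd : continuous (fun z => gmul (e0 z)) by cont.
exists (cm cd) => z.
have e : src G (fp2 (fp1 z)) = tgt G (gmul (e0 z)) by rewrite gtgt tgt_inv.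
exists e; apply: fp_ext; first exact: (fpP z).
rewrite [LHS]fp2K.
have e2 : src G (fp2 (fp1 z)) = tgt G (ginv (fp2 (fp1 z))) by rewrite tgt_inv.
have e3 : src G (gmul e2) = tgt G (fp2 (fp2 z)) by rewrite gsrc.
transitivity (gmul e3).
  by rewrite -(gmulA e e3); exact: gmul_eq.
by apply: one_gmul; rewrite (gmulV e2 erefl) -!fpP (fpP z).
Defined.

Variables (N : cgtop) (P : principal_bundle G N) (s : cmap V (total P)).
Hypothesis ms : forall v, anchor (raction P) (s v) = m v.

Lemma triv_mor_subproof (z : triv_space) :
  anchor (raction P) (s (fp1 z)) = tgt G (fp2 z).
Proof. by rewrite ms; exact: fpP. Qed.

Lemma triv_mor_continuous :
  continuous (fun z => act (raction P) (fpmk (triv_mor_subproof z))).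
Proof. by cont. Qed.

(** A trivial bundle is free on its unit section: a lift [s] of the base with
    anchor [m] extends to it by equivariance. *)
Definition triv_mor : bundle_mor triv_bundle P.
Proof.
exists (cm_comp (proj P) s) (@cm triv_space _ _ triv_mor_continuous).
- by move=> p; exact: proj_act.
- by move=> p; exact: anchor_act.
- move=> p a e e'; rewrite [LHS]/=; symmetry.
  have ab : src G (fp2 (p : triv_space)) = tgt G a by exact: e.
  have e'' : anchor (raction P) (s (fp1 (p : triv_space))) = tgt G (gmul ab).
    by rewrite gtgt ms; exact: fpP.
  transitivity (act (raction P) (fpmk e'')); last first.
    by apply: act_eq => //; exact: gmul_eq.
  by rewrite -(act_mul (ab := ab) e' e'').
Defined.

End Trivial.

End Bundles.

(** * Gluing spaces over an open cover *)

(** Spaces [gl_sp i] over the members of a cover, with a relation that identifies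
    each of them with each other over the common part of the base. Openness of
    the saturations replaces the continuity of the transition maps. *)
Record glue_data (U : cgtop) (V : opencover U) := GlueData {
  gl_sp : cov_index V -> cgtop;
  gl_pr : forall i, cmap (gl_sp i) U;
  gl_rel : forall i j, gl_sp i -> gl_sp j -> Prop;
  gl_prV : forall i a, V i (gl_pr i a);
  gl_relE : forall i (a b : gl_sp i), gl_rel a b <-> a = b;
  gl_sym : forall i j (a : gl_sp i) (b : gl_sp j), gl_rel a b -> gl_rel b a;
  gl_trans : forall i j k (a : gl_sp i) (b : gl_sp j) (c : gl_sp k),
    gl_rel a b -> gl_rel b c -> gl_rel a c;
  gl_rel_pr : forall i j (a : gl_sp i) (b : gl_sp j),
    gl_rel a b -> gl_pr i a = gl_pr j b;
  gl_ex : forall i j (a : gl_sp i), V j (gl_pr i a) ->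
    exists b : gl_sp j, gl_rel a b;
  gl_open : forall i j (W : set (gl_sp j)), open W ->
    open [set a : gl_sp i | exists b, W b /\ gl_rel a b] }.

Section Glue.
Variables (U : cgtop) (V : opencover U) (D : glue_data V).

(* The index type of a cover has no choice structure of its own. *)
Definition gl_sum : Type := {classic {i : cov_index V & gl_sp D i}}.
HB.instance Definition _ := Choice.on gl_sum.

Definition gl_eqv : rel gl_sum :=
  fun a b => `[< gl_rel (projT2 a) (projT2 b) >].

Lemma gl_eqv_refl : reflexive gl_eqv.
Proof. by move=> a; apply/asboolP/gl_relE. Qed.

Lemma gl_eqv_sym : symmetric gl_eqv.
Proof. by move=> a b; apply/asboolP/asboolP; exact: gl_sym. Qed.

Lemma gl_eqv_trans : transitive gl_eqv.
Proof.
by move=> b a c /asboolP h /asboolP k; apply/asboolP; exact: gl_trans h k.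
Qed.

Definition gl_equiv : equiv_rel gl_sum :=
  EquivRel gl_eqv gl_eqv_refl gl_eqv_sym gl_eqv_trans.

Definition gl_quot : Type := {eq_quot gl_equiv}.
HB.instance Definition _ := Choice.on gl_quot.

Definition gl_in i (a : gl_sp D i) : gl_quot :=
  \pi_({eq_quot gl_equiv}) (existT _ i a : gl_sum).

Lemma gl_inP i j (a : gl_sp D i) (b : gl_sp D j) :
  gl_in a = gl_in b <-> gl_rel a b.
Proof.
by split=> [/eqmodP/asboolP//|h]; apply/eqmodP/asboolP.
Qed.

Lemma gl_in_inj i : injective (@gl_in i).
Proof. by move=> a b /gl_inP/gl_relE. Qed.

Lemma gl_in_surj (y : gl_quot) : exists i (a : gl_sp D i), gl_in a = y.
Proof.
exists (projT1 (repr (y : {eq_quot gl_equiv}))).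
exists (projT2 (repr (y : {eq_quot gl_equiv}))).
by rewrite -[RHS](reprK (y : {eq_quot gl_equiv})) /gl_in; case: (repr _).
Qed.

Definition gl_op (W : set gl_quot) : Prop :=
  forall i, open (@gl_in i @^-1` W).

Lemma gl_opT : gl_op setT.
Proof. by move=> i; exact: openT. Qed.

Lemma gl_opI : setI_closed gl_op.
Proof. by move=> A B oA oB i; exact: openI. Qed.

Lemma gl_op_bigcup (J : Type) (f : J -> set gl_quot) :
  (forall j, gl_op (f j)) -> gl_op (\bigcup_j f j).
Proof.
move=> of_ i; rewrite preimage_bigcup; apply: bigcup_open => j _; exact: of_.
Qed.

HB.instance Definition _ :=
  isOpenTopological.Build gl_quot gl_opT gl_opI gl_op_bigcup.

Lemma gl_in_continuous i : continuous (@gl_in i).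
Proof. by apply/continuousP => W oW; exact: oW. Qed.

Lemma gl_in_open i (W : set (gl_sp D i)) : open W -> open (@gl_in i @` W).
Proof.
move=> oW; suff: gl_op (@gl_in i @` W) by [].
move=> j; rewrite (_ : _ @^-1` _ = [set a | exists b, W b /\ gl_rel a b]).
  exact: gl_open.
apply/seteqP; split=> [a [b Wb /gl_inP/gl_sym ab]|a [b [Wb ab]]].
  by exists b.
by exists b => //; apply/gl_inP/gl_sym.
Qed.

Lemma gl_proj_ex : exists f : gl_quot -> U, forall i a, f (@gl_in i a) = gl_pr D i a.
Proof.
have /choice[f fE] : forall y, exists n, forall i a, @gl_in i a = y ->
    gl_pr D i a = n.
  move=> y; have [i [a <-]] := gl_in_surj y.
  by exists (gl_pr D i a) => j b /gl_inP; exact: gl_rel_pr.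
by exists f => i a; exact/esym/fE.
Qed.

Lemma gl_continuous (T : topologicalType) (f : gl_quot -> T) :
  (forall i, continuous (fun a => f (@gl_in i a))) -> continuous f.
Proof.
move=> h; apply/continuousP => W oW; suff: gl_op (f @^-1` W) by [].
by move=> i; move/continuousP: (h i); apply.
Qed.

Lemma gl_nbhs i (a : gl_sp D i) A : nbhs a A -> nbhs (gl_in a) (@gl_in i @` A).
Proof.
rewrite (@nbhsE (gl_sp D i)) => -[B [oB Ba] BA].
apply: (@filterS _ (nbhs (gl_in a)) _ (@gl_in i @` B)); first exact: image_subset.
by apply: open_nbhs_nbhs; split; [exact: gl_in_open|exists a].
Qed.

(** Points with distinct projections are separated in the base. Points with the
    same projection come from one and the same [gl_sp i], which is Hausdorff and
    open in the quotient. *)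
Lemma gl_hausdorff : hausdorff_space gl_quot.
Proof.
move=> x y; have [f fE] := gl_proj_ex.
have [i [a <-]] := gl_in_surj x; have [j [b <-]] := gl_in_surj y => cl.
have cf : continuous f.
  apply: gl_continuous => k.
  rewrite (_ : (fun _ => _) = gl_pr D k); first exact: cts_fun.
  by apply: funext => c; exact: fE.
have eab : gl_pr D i a = gl_pr D j b.
  rewrite -!fE; apply: (@cg_hausdorff U) => A B nA nB.
  by have [z [Az Bz]] := cl _ _ (cf _ _ nA) (cf _ _ nB); exists (f z).
have [|c /gl_sym bc] := gl_ex (i := j) (j := i) (a := b).
  by rewrite -eab; exact: gl_prV.
have e : gl_in b = gl_in c by apply/gl_inP/gl_sym.
rewrite e in cl *; congr gl_in; apply: (@cg_hausdorff (gl_sp D i)) => A B nA nB.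
have [_ [[u Au <-] [v Bv /gl_in_inj uv]]] := cl _ _ (gl_nbhs nA) (gl_nbhs nB).
by exists u; split=> //; rewrite -uv.
Qed.

(** A quotient of compactly generated spaces is compactly generated, since a
    compact subset of a piece has compact image. *)
Lemma gl_generated : compactly_generated gl_quot.
Proof.
move=> O kO; suff: gl_op O by [].
move=> i; apply: (@cg_generated (gl_sp D i)) => K w cK Kw Ow.
have cK' := continuous_compact_image (@gl_in_continuous i) cK.
have h := kO _ _ cK' (imageP (@gl_in i) Kw) Ow.
apply: (@filterS _ (nbhs w) _ _ _ _ (gl_in_continuous h)) => v hv Kv.
by apply: hv; exact: imageP.
Qed.

Definition gl_space : cgtop := CGTop gl_hausdorff gl_generated.

End Glue.

Lemma glue_exists (U : cgtop) (V : opencover U) (D : glue_data V) :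
  exists (Y : cgtop) (h : forall i, cmap (gl_sp D i) Y) (f : cmap Y U),
    [/\ forall i j a b, h i a = h j b <-> gl_rel a b,
        forall i a, f (h i a) = gl_pr D i a,
        forall y, exists i a, h i a = y,
        forall i W, open W -> open (h i @` W) &
        forall (T : topologicalType) (g : Y -> T),
          (forall i, continuous (fun a => g (h i a))) -> continuous g].
Proof.
exists (gl_space D), (fun i => @cm _ (gl_space D) _ (@gl_in_continuous _ _ D i)).
have [f fE] := gl_proj_ex D.
have cf : continuous f.
  apply: gl_continuous => k.
  rewrite (_ : (fun _ => _) = gl_pr D k); first exact: cts_fun.
  by apply: funext => c; exact: fE.
exists (@cm (gl_space D) _ _ cf); split.
- exact: gl_inP.
- exact: fE.
- exact: gl_in_surj.
- exact: gl_in_open.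
- exact: gl_continuous.
Qed.

Lemma incl_map_continuous (U : cgtop) (A B : set U) (AB : A `<=` B) :
  continuous (fun z : cg_sub A => sub_elt (AB _ (inclP z))).
Proof. by cont. Qed.

Definition incl_map (U : cgtop) (A B : set U) (AB : A `<=` B) :
  cmap (cg_sub A) (cg_sub B) := cm (@incl_map_continuous U A B AB).

(** * Descent for principal bundles *)

Section StackBG.
Variables (M : cgtop) (G : tgroupoid M).

(** Bundle morphisms are cartesian, because they are pullback squares; the lift
    is equivariant since [k] is injective on fibres. *)
Lemma lift_bundle_mor (U V W : cgtop) (P : principal_bundle G U)
  (P' : principal_bundle G V) (P'' : principal_bundle G W)
  (h : bundle_mor P P'') (k : bundle_mor P' P'') (f : cmap U V) :
  cm_comp (bm_base k) f = bm_base h ->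
  exists! l : bundle_mor P P', bm_base l = f /\ bundle_comp k l = h.
Proof.
move=> hf.
have e1 x : bm_base k (cm_comp f (proj P) x) = proj P'' (bm_total h x).
  by rewrite bm_proj -hf.
have [g gE] := bundle_mor_cartesian (k := k) e1.
have gk x : bm_total k (g x) = bm_total h x by have [] := gE x.
have gp x : proj P' (g x) = f (proj P x) by have [] := gE x.
have ga x : anchor (raction P') (g x) = anchor (raction P) x.
  by rewrite -(bm_anchor k) gk bm_anchor.
have gact x a (e : anchor (raction P) x = tgt G a)
    (e' : anchor (raction P') (g x) = tgt G a) :
  g (act (raction P) (fpmk e)) = act (raction P') (fpmk e').
  have e'' : anchor (raction P'') (bm_total h x) = tgt G a by rewrite bm_anchor.
  have e3 : anchor (raction P'') (bm_total k (g x)) = tgt G a by rewrite gk.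
  apply: (bundle_mor_inj (k := k)).
    rewrite gk (bm_act e e'') (bm_act e' e3); exact: act_eq.
  by rewrite gp !proj_act gp.
exists (BundleMor gp ga gact); split=> [|l [lb lk]].
  by split=> //; apply: bundle_mor_ext; [exact: hf|apply: cm_ext => x; exact: gk].
apply: bundle_mor_ext => //=; apply: cm_ext => x.
apply: (bundle_mor_inj (k := k)).
  by rewrite gk -lk.
by rewrite gp bm_proj lb.
Qed.

Lemma fibered_BG : fibered_in_groupoids (BG G).
Proof.
split=> [U V f P|U V W P P' P'' h k f e].
  by exists (pb_bundle f P), (pb_mor f P).
exact: (lift_bundle_mor (h := h) (k := k) e).
Qed.

(** A bundle morphism [k] over the inclusion of an open subset is an open
    embedding of total spaces, its inverse being a lift along the pullback square.
    The map [j] serves to treat the inclusion of [A] in [U] and the inclusion of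
    an intersection in one of the members of a cover at the same time. *)
Section OpenArrow.
Variables (U W : cgtop) (A : set U) (j : cmap W U).
Variables (P' : principal_bundle G (cg_sub A)) (P : principal_bundle G W).
Variable k : bundle_mor P' P.
Hypotheses (oA : open A) (jI : injective j).
Hypothesis jk : forall n, j (bm_base k n) = incl A n.

Lemma oa_inj : injective (bm_total k).
Proof.
move=> x y e; apply: (bundle_mor_inj e); apply: incl_inj.
by rewrite -!jk -!bm_proj e.
Qed.

Lemma oa_mem c : A (j (proj P (bm_total k c))).
Proof. by rewrite bm_proj jk; exact: inclP. Qed.

Lemma oa_section :
  exists g : cmap (cg_sub [set a | A (j (proj P a))]) (total P'),
    forall z, bm_total k (g z) = incl _ z.
Proof.
set O := [set a | _].
pose n (z : cg_sub O) : cg_sub A :=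
  sub_elt (inclP z : A (j (proj P (incl O z)))).
have cn : continuous n by apply: sub_elt_continuous; cont.
have e (z : cg_sub O) : bm_base k (cm cn z) = proj P (incl O z).
  by apply: jI; rewrite jk.
have [g gE] := bundle_mor_cartesian (k := k) e.
by exists g => z; have [] := gE z.
Qed.

Lemma oa_surj a : A (j (proj P a)) -> exists c, bm_total k c = a.
Proof.
move=> Aa; have [g gE] := oa_section; exists (g (sub_elt (Aa : [set a | A _] a))).
by rewrite gE.
Qed.

Lemma oa_open (B : set (total P')) : open B -> open (bm_total k @` B).
Proof.
move=> oB; have [g gE] := oa_section; set O := [set a | _] in g gE.
have -> : bm_total k @` B = incl O @` [set z | B (g z)].
  apply/seteqP; split=> _ [c Bc <-]; last by exists (g c).
  exists (sub_elt (oa_mem c : O _)) => //=.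
  by rewrite (_ : g _ = c) //; apply: oa_inj; rewrite gE.
apply: open_incl_image.
  by apply: open_preimage => //; cont.
by apply: open_preimage => //; exact: cts_fun.
Qed.

End OpenArrow.

Section GlueArrows.
Variables (U : cgtop) (V : opencover U) (x y : principal_bundle G U).
Variables (r : forall i, principal_bundle G (cg_sub (V i)))
  (e : forall i, bundle_mor (r i) x) (f : forall i, bundle_mor (r i) y).
Hypotheses (eV : forall i, bm_base (e i) = incl (V i))
  (fV : forall i, bm_base (f i) = incl (V i)).
Hypothesis agree : forall i j (z : principal_bundle G (cg_sub (V i `&` V j)))
  (a : bundle_mor z (r i)) (b : bundle_mor z (r j)),
  cm_comp (incl (V i)) (bm_base a) = incl (V i `&` V j) ->
  cm_comp (incl (V j)) (bm_base b) = incl (V i `&` V j) ->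
  bundle_comp (e i) a = bundle_comp (e j) b ->
  bundle_comp (f i) a = bundle_comp (f j) b.

Let eVE i n : cm_id U (bm_base (e i) n) = incl (V i) n.
Proof. by rewrite eV. Qed.

Let idI : injective (cm_id U). Proof. by []. Qed.

(** Both points come from a single point of the restriction of [x] to the
    intersection, to which the hypothesis applies. *)
Lemma agree_pt i j (w : total (r i)) (w' : total (r j)) :
  bm_total (e i) w = bm_total (e j) w' -> bm_total (f i) w = bm_total (f j) w'.
Proof.
move=> ew; pose z := pb_bundle (incl (V i `&` V j)) x.
pose zx : bundle_mor z x := pb_mor _ x.
have [] := @lift_bundle_mor _ _ _ z (r i) x zx (e i) (incl_map (@subIsetl _ _ _)).
  by rewrite eV; exact: cm_ext.
move=> a [[ab ak] _].
have [] := @lift_bundle_mor _ _ _ z (r j) x zx (e j) (incl_map (@subIsetr _ _ _)).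
  by rewrite eV; exact: cm_ext.
move=> b [[bb bk] _].
have h := agree (a := a) (b := b) _ _ (etrans ak (esym bk)).
have {h}h : bundle_comp (f i) a = bundle_comp (f j) b.
  by apply: h; rewrite ?ab ?bb; exact: cm_ext.
have Vij : (V i `&` V j) (proj x (bm_total (e i) w)).
  split; first exact: (oa_mem (eVE (i := i))).
  by rewrite ew; exact: (oa_mem (eVE (i := j))).
have pe : incl _ (sub_elt Vij) = proj x (bm_total (e i) w) by [].
pose t : total z := fpmk pe.
have at_ : bm_total a t = w.
  apply: (oa_inj (@eVE i)).
  exact: (congr1 (fun m => bm_total m t) ak).
have bt : bm_total b t = w'.
  apply: (oa_inj (@eVE j)); rewrite -ew.
  exact: (congr1 (fun m => bm_total m t) bk).
by rewrite -at_ -bt; exact: (congr1 (fun m => bm_total m t) h).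
Qed.

Lemma bundle_glue_arrows : exists! m : bundle_mor x y,
  bm_base m = cm_id U /\ forall i, bundle_comp m (e i) = f i.
Proof.
have cov p : exists i w, bm_total (e i) w = p.
  have [i Vi] := cov_cover V (proj x p); exists i.
  exact: (oa_surj idI (@eVE i) (a := p) Vi).
have /choice[m mE] : forall p, exists q, forall i w,
    bm_total (e i) w = p -> bm_total (f i) w = q.
  move=> p; have [i [w <-]] := cov p.
  by exists (bm_total (f i) w) => j w' /agree_pt.
have mE' i w : m (bm_total (e i) w) = bm_total (f i) w.
  exact/esym/mE.
have mc : continuous m.
  apply: continuous_local => p; have [i [w ew]] := cov p.
  have [g gE] := oa_section idI (@eVE i).
  exists [set a | V i (cm_id U (proj x a))]; split.
  - by apply: open_preimage; [cont|exact: cov_open].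
  - by rewrite /= -ew; exact: (oa_mem (@eVE i)).
  - rewrite (_ : (fun _ => _) = fun z => bm_total (f i) (g z)); last first.
      by apply: funext => z; rewrite -gE mE'.
    by cont.
have mp p : proj y (cm mc p) = cm_id U (proj x p).
  by have [i [w <-]] := cov p; rewrite [cm _ _]mE' !bm_proj eV fV.
have ma p : anchor (raction y) (cm mc p) = anchor (raction x) p.
  by have [i [w <-]] := cov p; rewrite [cm _ _]mE' !bm_anchor.
have mact p a (h : anchor (raction x) p = tgt G a)
    (h' : anchor (raction y) (cm mc p) = tgt G a) :
  cm mc (act (raction x) (fpmk h)) = act (raction y) (fpmk h').
  have [i [w ew]] := cov p; subst p.
  have h0 : anchor (raction (r i)) w = tgt G a by rewrite -(bm_anchor (e i)).
  have h1 : anchor (raction y) (bm_total (f i) w) = tgt G a by rewrite bm_anchor.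
  rewrite -(bm_act h0 h) [cm _ _]mE' (bm_act h0 h1); apply: act_eq => //.
exists (BundleMor mp ma mact); split=> [|m' [bm' m'E]].
  split=> // i; apply: bundle_mor_ext; apply: cm_ext => w; last exact: mE'.
  by rewrite fV -(eV i).
apply: bundle_mor_ext; first by rewrite bm'.
apply: cm_ext => p; have [i [w <-]] := cov p.
by rewrite [LHS]mE' -m'E.
Qed.

End GlueArrows.

Section GlueObjects.
Variables (U : cgtop) (V : opencover U).
Variables (x : forall i, principal_bundle G (cg_sub (V i)))
  (d : forall i j, principal_bundle G (cg_sub (V i `&` V j)))
  (p : forall i j, bundle_mor (d i j) (x i))
  (q : forall i j, bundle_mor (d i j) (x j)).
Hypotheses
  (pV : forall i j, cm_comp (incl (V i)) (bm_base (p i j)) = incl (V i `&` V j))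
  (qV : forall i j, cm_comp (incl (V j)) (bm_base (q i j)) = incl (V i `&` V j)).
Hypothesis cocycle : forall i j k
  (z : principal_bundle G (cg_sub (V i `&` V j `&` V k)))
  (a : bundle_mor z (d i j)) (b : bundle_mor z (d j k)) (c : bundle_mor z (d i k)),
  cm_comp (incl (V i `&` V j)) (bm_base a) = incl (V i `&` V j `&` V k) ->
  cm_comp (incl (V j `&` V k)) (bm_base b) = incl (V i `&` V j `&` V k) ->
  cm_comp (incl (V i `&` V k)) (bm_base c) = incl (V i `&` V j `&` V k) ->
  bundle_comp (p i j) a = bundle_comp (p i k) c ->
  bundle_comp (q i j) a = bundle_comp (p j k) b ->
  bundle_comp (q j k) b = bundle_comp (q i k) c.

Let pE i j n : incl (V i) (bm_base (p i j) n) = incl (V i `&` V j) n.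
Proof. by rewrite -(pV i j). Qed.

Let qE i j n : incl (V j) (bm_base (q i j) n) = incl (V i `&` V j) n.
Proof. by rewrite -(qV i j). Qed.

Let oV i j : open (V i `&` V j).
Proof. by apply: openI; exact: cov_open. Qed.

(** The cocycle condition for points: the three points come from a single point
    of the restriction of [x i] to the triple intersection. *)
Lemma cocycle_pt i j k (c1 : total (d i j)) (c2 : total (d j k))
  (c3 : total (d i k)) :
  bm_total (p i j) c1 = bm_total (p i k) c3 ->
  bm_total (q i j) c1 = bm_total (p j k) c2 ->
  bm_total (q j k) c2 = bm_total (q i k) c3.
Proof.
move=> e13 e12.
have s1 : V i `&` V j `&` V k `<=` V i `&` V j by move=> ? [].
have s2 : V i `&` V j `&` V k `<=` V j `&` V k by move=> ? [[]].
have s3 : V i `&` V j `&` V k `<=` V i `&` V k by move=> ? [[]].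
have s0 : V i `&` V j `&` V k `<=` V i by move=> ? [[]].
pose z := pb_bundle (incl_map s0) (x i).
pose zx : bundle_mor z (x i) := pb_mor _ (x i).
have [] := @lift_bundle_mor _ _ _ z (d i j) (x i) zx (p i j) (incl_map s1).
  by apply: cm_ext => n; apply: incl_inj; rewrite [LHS]pE.
move=> a [[ab ak] _].
have [] := @lift_bundle_mor _ _ _ z (d j k) (x j) (bundle_comp (q i j) a)
    (p j k) (incl_map s2).
  apply: cm_ext => n; apply: incl_inj; rewrite [LHS]pE /= qE.
  by rewrite ab.
move=> b [[bb bk] _].
have [] := @lift_bundle_mor _ _ _ z (d i k) (x i) zx (p i k) (incl_map s3).
  by apply: cm_ext => n; apply: incl_inj; rewrite [LHS]pE.
move=> c [[cb ck] _].
have h : bundle_comp (q j k) b = bundle_comp (q i k) c.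
  apply: (cocycle (a := a)).
  - by rewrite ab; exact: cm_ext.
  - by rewrite bb; exact: cm_ext.
  - by rewrite cb; exact: cm_ext.
  - by rewrite ak ck.
  - by rewrite bk.
have Vijk : (V i `&` V j `&` V k) (incl _ (proj (x i) (bm_total (p i j) c1))).
  have [h1 h2] := oa_mem (@pE i j) c1; split=> //.
  by rewrite e13; have [] := oa_mem (@pE i k) c3.
have pe : incl_map s0 (sub_elt Vijk) = proj (x i) (bm_total (p i j) c1).
  exact: incl_inj.
pose t : total z := fpmk pe.
have at_ : bm_total a t = c1.
  apply: (oa_inj (@pE i j)); exact: (congr1 (fun m => bm_total m t) ak).
have bt : bm_total b t = c2.
  apply: (oa_inj (@pE j k)); rewrite -e12 -at_.
  exact: (congr1 (fun m => bm_total m t) bk).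
have ct : bm_total c t = c3.
  apply: (oa_inj (@pE i k)); rewrite -e13.
  exact: (congr1 (fun m => bm_total m t) ck).
by rewrite -bt -ct; exact: (congr1 (fun m => bm_total m t) h).
Qed.

Let pr i : cmap (total (x i)) U := cm_comp (incl (V i)) (proj (x i)).

Let rel i j (a : total (x i)) (b : total (x j)) : Prop :=
  exists c, bm_total (p i j) c = a /\ bm_total (q i j) c = b.

Let pS i j (a : total (x i)) : V j (pr i a) ->
  exists c, bm_total (p i j) c = a.
Proof.
move=> Va; apply: (oa_surj (@incl_inj _ _) (@pE i j)).
by split=> //; exact: inclP.
Qed.

Let qS i j (b : total (x j)) : V i (pr j b) ->
  exists c, bm_total (q i j) c = b.
Proof.
move=> Va; apply: (oa_surj (@incl_inj _ _) (@qE i j)).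
by split=> //; exact: inclP.
Qed.

Let prV i a : V i (pr i a). Proof. exact: inclP. Qed.

(* The cocycle condition forces the transition from [x i] to itself to be the
   identity, as it is idempotent and invertible. *)
Let pq i (c : total (d i i)) : bm_total (p i i) c = bm_total (q i i) c.
Proof.
have [c' c'E] := @qS i i (bm_total (p i i) c) (prV _).
by rewrite -c'E; apply/esym/cocycle_pt.
Qed.

Let relE i (a b : total (x i)) : rel a b <-> a = b.
Proof.
split=> [[c [<- <-]]|<-]; first exact: pq.
by have [c cE] := @pS i i a (prV _); exists c; rewrite -pq.
Qed.

Let rel_pr i j (a : total (x i)) (b : total (x j)) : rel a b -> pr i a = pr j b.
Proof. by move=> [c [<- <-]]; rewrite /pr /= !bm_proj pE qE. Qed.

Let rel_trans i j k (a : total (x i)) (b : total (x j)) (c : total (x k)) :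
  rel a b -> rel b c -> rel a c.
Proof.
move=> ab bc; have Vk : V k (pr i a).
  by rewrite (rel_pr ab) (rel_pr bc); exact: prV.
have [c3 c3E] := pS Vk; case: ab bc => c1 [p1 q1] [c2 [p2 q2]].
exists c3; split=> //; rewrite -q2; apply/esym/(cocycle_pt (c1 := c1)).
  by rewrite p1 c3E.
by rewrite q1 p2.
Qed.

Let rel_ex i j (a : total (x i)) : V j (pr i a) -> exists b : total (x j), rel a b.
Proof. by move=> /pS[c cE]; exists (bm_total (q i j) c), c. Qed.

Let rel_sym i j (a : total (x i)) (b : total (x j)) : rel a b -> rel b a.
Proof.
move=> ab; have [|a' ba'] := @rel_ex j i b; first by rewrite -(rel_pr ab).
have /relE -> : rel a a' by exact: rel_trans ab ba'.
by [].
Qed.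

Let rel_open i j (W : set (total (x j))) : open W ->
  open [set a : total (x i) | exists b, W b /\ rel a b].
Proof.
move=> oW; rewrite (_ : [set a | _] = bm_total (p i j) @`
  [set c | W (bm_total (q i j) c)]).
  apply: (oa_open (oV i j) (@incl_inj _ _) (@pE i j)).
  by apply: open_preimage => //; exact: cts_fun.
apply/seteqP; split=> [a [b [Wb [c [<- cb]]]]|_ [c Wc <-]].
  by exists c => //=; rewrite cb.
by exists (bm_total (q i j) c); split=> //; exists c.
Qed.

Let data := @GlueData U V (fun i => total (x i)) pr rel
  prV relE rel_sym rel_trans rel_pr rel_ex rel_open.

(** Anchor, action and division are defined on the glued space by the pieces
    [x i], and each is continuous because the pieces are open in it. *)
Lemma bundle_glue_objects :
  exists (y : principal_bundle G U) (e : forall i, bundle_mor (x i) y),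
    (forall i, bm_base (e i) = incl (V i)) /\
    forall i j, bundle_comp (e i) (p i j) = bundle_comp (e j) (q i j).
Proof.
have [Y [h [f [hP hf hS hO hC]]]] := glue_exists data.
rewrite /= in h hP hf hS hO hC.
have hI i : injective (h i) by move=> a b /hP/relE.
have hV i y : V i (f y) -> exists a, h i a = y.
  have [j [b <-]] := hS y; rewrite hf => /rel_ex[a ba].
  by exists a; apply/hP/rel_sym.
have hfV i a : V i (f (h i a)) by rewrite hf; exact: prV.
pose S i : set Y := [set y | V i (f y)].
have oO i : open (S i).
  by apply: open_preimage; [exact: cts_fun|exact: cov_open].
have inv i : exists g : cmap (cg_sub (S i)) (total (x i)),
    forall z, h i (g z) = incl _ z.
  have /choice[g gE] : forall z : cg_sub (S i), exists a, h i a = incl _ z.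
    by move=> z; apply: hV; exact: (inclP z).
  suff cg : continuous g by exists (cm cg).
  apply/continuousP => W oW.
  rewrite (_ : _ @^-1` W = [set z | (h i @` W) (incl (S i) z)]).
    by apply: open_preimage; [exact: cts_fun|exact: hO].
  apply/seteqP; split=> [z Wz|z [a Wa]]; first by exists (g z).
  by rewrite -gE => /hI e; rewrite /preimage /= -e.
have relanchor i j (a : total (x i)) (b : total (x j)) : rel a b ->
    anchor (raction (x i)) a = anchor (raction (x j)) b.
  by move=> [c [<- <-]]; rewrite !bm_anchor.
have relact i j (a : total (x i)) (b : total (x j)) g
    (e : anchor (raction (x i)) a = tgt G g)
    (e' : anchor (raction (x j)) b = tgt G g) : rel a b ->
    rel (act (raction (x i)) (fpmk e)) (act (raction (x j)) (fpmk e')).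
  move=> [c [ca cb]]; subst a b.
  have e0 : anchor (raction (d i j)) c = tgt G g by rewrite -(bm_anchor (p i j)).
  exists (act (raction (d i j)) (fpmk e0)).
  by rewrite (bm_act e0 e) (bm_act e0 e').
have /choice[an anE] : forall y, exists m, forall i a, h i a = y ->
    anchor (raction (x i)) a = m.
  move=> y; have [i [a <-]] := hS y.
  by exists (anchor (raction (x i)) a) => j b /hP; exact: relanchor.
have {}anE i a : an (h i a) = anchor (raction (x i)) a by exact/esym/anE.
have can : continuous an.
  apply: hC => i; rewrite (_ : (fun _ => _) = anchor (raction (x i))).
    exact: cts_fun.
  by apply: funext => a; exact: anE.
pose anc : cmap Y M := cm can.
have /choice[ac acE] : forall z : fp anc (tgt G), exists y, forall i a
    (e : anchor (raction (x i)) a = tgt G (fp2 z)), h i a = fp1 z ->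
    h i (act (raction (x i)) (fpmk e)) = y.
  move=> z; have [i [a az]] := hS (fp1 z).
  have e : anchor (raction (x i)) a = tgt G (fp2 z).
    by rewrite -anE az; exact: (fpP z).
  exists (h i (act (raction (x i)) (fpmk e))) => j b e' bz.
  by apply/hP/relact/hP; rewrite bz.
have {}acE i a g (e : anc (h i a) = tgt G g)
    (e' : anchor (raction (x i)) a = tgt G g) :
  ac (fpmk e) = h i (act (raction (x i)) (fpmk e')).
  by have := acE (fpmk e) i a e' erefl.
have cac : continuous ac.
  apply: continuous_local => z; have [i Vi] := cov_cover V (f (fp1 z)).
  have [g gE] := inv i.
  pose O : set (fp anc (tgt G)) := [set z | V i (f (fp1 z))].
  have Oz (w : cg_sub O) : S i (fp1 (incl O w)) by exact: (inclP w).
  have e (w : cg_sub O) :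
      anchor (raction (x i)) (g (sub_elt (Oz w))) = tgt G (fp2 (incl O w)).
    by rewrite -anE gE; exact: (fpP (incl O w)).
  exists O; split=> //.
    by apply: open_preimage; [cont|exact: cov_open].
  rewrite (_ : (fun _ => _) = fun w => h i (act (raction (x i)) (fpmk (e w)))).
    by cont.
  apply: funext => w.
  have e' : anc (h i (g (sub_elt (Oz w)))) = tgt G (fp2 (incl O w)).
    by rewrite gE; exact: (fpP (incl O w)).
  by rewrite -(acE _ _ _ e'); congr ac; apply: fp_ext => //; rewrite fp1K gE.
pose act' : cmap (fp anc (tgt G)) Y := cm cac.
have act_anchor y g (e : anc y = tgt G g) : anc (act' (fpmk e)) = src G g.
  have [i [a ay]] := hS y; subst y.
  have e' : anchor (raction (x i)) a = tgt G g by rewrite -anE.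
  by rewrite [act' _](acE _ _ _ e e') [anc _]anE anchor_act.
have act_1 y (e : anc y = tgt G (gone G (anc y))) : act' (fpmk e) = y.
  have [i [a ay]] := hS y; subst y.
  have e' : anchor (raction (x i)) a = tgt G (gone G (anc (h i a))).
    by rewrite -anE.
  rewrite [act' _](acE _ _ _ e e') act_oneE //.
  by congr (gone G _); exact: anE.
have act_M y g k (e : anc y = tgt G g) (gk : src G g = tgt G k)
    (e' : anc (act' (fpmk e)) = tgt G k) (e'' : anc y = tgt G (gmul gk)) :
    act' (fpmk e') = act' (fpmk e'').
  have [i [a ay]] := hS y; subst y.
  have e1 : anchor (raction (x i)) a = tgt G g by rewrite -anE.
  have e2 : anchor (raction (x i)) a = tgt G (gmul gk) by rewrite -anE.
  have e3 : anchor (raction (x i)) (act (raction (x i)) (fpmk e1)) = tgt G k.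
    by rewrite anchor_act.
  have e4 : anc (h i (act (raction (x i)) (fpmk e1))) = tgt G k.
    by rewrite [anc _]anE.
  rewrite [RHS](acE _ _ _ e'' e2) -(act_mul (ab := gk) e3 e2) -(acE _ _ _ e4 e3).
  by congr ac; apply: fpmk_eq => //; exact: acE.
pose ra := RightAction act_anchor act_1 act_M.
have inv_f y g (e : anchor ra y = tgt G g) : f (act ra (fpmk e)) = f y.
  have [i [a ay]] := hS y; subst y.
  have e1 : anchor (raction (x i)) a = tgt G g by rewrite -anE.
  by rewrite [act _ _](acE _ _ _ e e1) !hf /pr /= proj_act.
have sec : local_sections f.
  apply: local_sections_pt => n; have [i Vi] := cov_cover V n.
  have [A [s [oA An sE]]] := local_sections_at (proj_sections (x i)) (sub_elt Vi).
  pose B := incl (V i) @` A.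
  have BV u : B u -> V i u by move=> [v _ <-]; exact: inclP.
  have BA (u : cg_sub B) : A (sub_elt (BV _ (inclP u))).
    have [v Av vu] := inclP u; rewrite (_ : sub_elt _ = v) //.
    by apply: incl_inj; rewrite vu.
  exists B, (fun u => h i (s (sub_elt (BA u)))); split.
  - by apply: open_incl_image => //; exact: cov_open.
  - by exists (sub_elt Vi).
  - by cont.
  - by move=> u; rewrite hf /pr /= sE.
have free y g k (e : anchor ra y = tgt G g) (e' : anchor ra y = tgt G k) :
    act ra (fpmk e) = act ra (fpmk e') -> g = k.
  have [i [a ay]] := hS y; subst y.
  have e1 : anchor (raction (x i)) a = tgt G g by rewrite -anE.
  have e2 : anchor (raction (x i)) a = tgt G k by rewrite -anE.
  rewrite [act _ (fpmk e)](acE _ _ _ e e1) [act ra (fpmk e')](acE _ _ _ e' e2).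
  by move=> /hI/bundle_free.
have divx i (a b : total (x i)) (eab : proj (x i) a = proj (x i) b) g
    (e1 : anchor (raction (x i)) a = tgt G g)
    (e2 : act (raction (x i)) (fpmk e1) = b) :
    exists e : anchor ra (h i a) = tgt G g, act ra (fpmk e) = h i b.
  have e : anchor ra (h i a) = tgt G g by rewrite [anchor _ _]anE.
  by exists e; rewrite [act _ _](acE _ _ _ e e1) e2.
have div : exists dv : cmap (fp f f) (arr G), forall z,
    exists e : anchor ra (fp1 z) = tgt G (dv z), act ra (fpmk e) = fp2 z.
  have /choice[dv dvE] : forall z : fp f f, exists g,
      exists e : anchor ra (fp1 z) = tgt G g, act ra (fpmk e) = fp2 z.
    move=> z; have [i Vi] := cov_cover V (f (fp1 z)).
    have [a az] := hV _ _ Vi.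
    have [|b bz] := hV i (fp2 z); first by rewrite -(fpP z).
    have [dx dxE] := bundle_divE (x i).
    have eab : proj (x i) a = proj (x i) b.
      by apply: incl_inj; rewrite -[LHS](hf i a) -[RHS](hf i b) az bz; exact: fpP.
    have [e1 e2] := dxE _ _ eab.
    exists (dx (fpmk eab)); rewrite -az -bz; exact: divx e2.
  suff cdv : continuous dv by exists (cm cdv).
  apply: continuous_local => z; have [i Vi] := cov_cover V (f (fp1 z)).
  have [g gE] := inv i; have [dx dxE] := bundle_divE (x i).
  pose O : set (fp f f) := [set z | V i (f (fp1 z))].
  have O1 (w : cg_sub O) : S i (fp1 (incl O w)) by exact: (inclP w).
  have O2 (w : cg_sub O) : S i (fp2 (incl O w)).
    by rewrite /S /= -(fpP (incl O w)); exact: (inclP w).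
  pose a w := g (sub_elt (O1 w)); pose b w := g (sub_elt (O2 w)).
  have aE w : h i (a w) = fp1 (incl O w) by rewrite gE.
  have bE w : h i (b w) = fp2 (incl O w) by rewrite gE.
  have eab w : proj (x i) (a w) = proj (x i) (b w).
    apply: incl_inj; rewrite -[LHS](hf i) -[RHS](hf i) aE bE.
    exact: (fpP (incl O w)).
  exists O; split=> //.
    by apply: open_preimage; [cont|exact: cov_open].
  rewrite (_ : (fun _ => _) = fun w => dx (fpmk (eab w))); first by cont.
  apply: funext => w; have [e eE] := dvE (incl O w).
  have [e1 e2] := dxE _ _ (eab w).
  have [e3 e3E] := divx _ _ _ (eab w) _ e1 e2.
  have e4 : anchor ra (fp1 (incl O w)) = tgt G (dx (fpmk (eab w))).
    by rewrite -aE.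
  apply: (free _ _ _ e e4); rewrite eE -bE -e3E.
  by apply: act_eq; rewrite ?aE.
pose y := bundle_of_div inv_f sec free div.
have ep i a : proj y (h i a) = incl (V i) (proj (x i) a) by exact: hf.
have ea i a : anchor (raction y) (h i a) = anchor (raction (x i)) a by exact: anE.
have eact i a g (e : anchor (raction (x i)) a = tgt G g)
    (e' : anchor (raction y) (h i a) = tgt G g) :
    h i (act (raction (x i)) (fpmk e)) = act (raction y) (fpmk e').
  exact/esym/acE.
exists y, (fun i => BundleMor (@ep i) (@ea i) (@eact i)); split=> // i j.
apply: bundle_mor_ext => /=; first by rewrite pV qV.
by apply: cm_ext => c; apply/hP; exists c.
Qed.

End GlueObjects.

Lemma is_stack_BG : is_stack (BG G).
Proof.
split; first exact: fibered_BG.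
- by move=> U V x y r e f eV fV; exact: bundle_glue_arrows.
- by move=> U V x d p q pV qV; exact: bundle_glue_objects.
Qed.

End StackBG.

(** * Categories fibered in groupoids *)

Lemma cm_comp1m (U V : cgtop) (f : cmap U V) : cm_comp (cm_id V) f = f.
Proof. exact: cm_ext. Qed.

Lemma cm_compm1 (U V : cgtop) (f : cmap U V) : cm_comp f (cm_id U) = f.
Proof. exact: cm_ext. Qed.

Section Fibered.
Variable C : catover.

Lemma iso_epi (U V W : cgtop) (x : ob C U) (y : ob C V) (z : ob C W)
  (e : hom x y) (a b : hom y z) : is_iso e -> compm a e = compm b e -> a = b.
Proof.
by move=> [e' [_ ee']] h; rewrite -(compm1 a) -(compm1 b) -ee' !compmA h.
Qed.

Hypothesis fC : fibered_in_groupoids C.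

Lemma fib_uniq (U V W : cgtop) (x : ob C U) (y : ob C V) (z : ob C W)
  (k : hom y z) (l l' : hom x y) :
  base l = base l' -> compm k l = compm k l' -> l = l'.
Proof.
move=> eb ek; have [|m [_ mU]] := fib_lift fC (h := compm k l) (k := k) (f := base l).
  by rewrite base_comp.
by rewrite -(mU l) ?(mU l').
Qed.

Lemma fib_liftE (U V W : cgtop) (x : ob C U) (y : ob C V) (z : ob C W)
  (h : hom x z) (k : hom y z) (f : cmap U V) : cm_comp (base k) f = base h ->
  exists l : hom x y, base l = f /\ compm k l = h.
Proof. by move=> /(fib_lift fC)[l [lE _]]; exists l. Qed.

(** The lift of the identity along [h] is a right inverse of [h], and a left
    inverse by the uniqueness of lifts along [h]. *)
Lemma fib_iso (U : cgtop) (x y : ob C U) (h : hom x y) :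
  base h = cm_id U -> is_iso h.
Proof.
move=> hb; have [|k [kb kE]] := fib_liftE (h := idm y) (k := h) (f := cm_id U).
  by rewrite hb base_id cm_compm1.
exists k; split=> //; apply: (fib_uniq (k := h)).
  by rewrite base_comp kb hb base_id cm_comp1m.
by rewrite compmA kE comp1m compm1.
Qed.

(** The existence half of the Yoneda lemma: an object over [U] is the value at
    the identity of a morphism from the stack represented by [U]. *)
Lemma yoneda_ex (U : cgtop) (d : ob C U) :
  exists (r : fmor (repstack U) C) (p : forall W (a : ob (repstack U) W),
    hom (r W a) d), (forall W a, base (p W a) = a) /\
    forall W W' (a : ob (repstack U) W) (b : ob (repstack U) W')
      (f : hom a b), compm (p W' b) (fhom r f) = p W a.
Proof.
pose pb W (a : cmap W U) := cid (fib_pullback fC a d).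
pose o W a := projT1 (pb W a).
pose p' W (a : cmap W U) := cid (projT2 (pb W a)).
pose p W a : hom (o W a) d := projT1 (p' W a).
have pE W a : base (p W a) = a := projT2 (p' W a).
have li W W' (a : cmap W U) (b : cmap W' U) (f : repr_hom a b) :
    exists l : hom (o W a) (o W' b), base l = rh_map f /\ compm (p W' b) l = p W a.
  by apply: fib_liftE; rewrite !pE; apply: cm_ext => w; exact: rh_comm.
pose l W W' (a : cmap W U) (b : cmap W' U) (f : repr_hom a b) :=
  projT1 (cid (li _ _ _ _ f)).
have lb W W' a b f : base (l W W' a b f) = rh_map f.
  by rewrite /l; case: cid => ? [].
have lp W W' a b f : compm (p W' b) (l W W' a b f) = p W a.
  by rewrite /l; case: cid => ? [].
have l1 W (a : cmap W U) : l _ _ _ _ (repr_id a) = idm (o W a).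
  by apply: (fib_uniq (k := p W a)); rewrite ?lb ?base_id // lp compm1.
have l2 W W' W'' (a : cmap W U) (b : cmap W' U) (c : cmap W'' U)
    (h : repr_hom b c) (k : repr_hom a b) :
    l _ _ _ _ (repr_comp h k) = compm (l _ _ _ _ h) (l _ _ _ _ k).
  apply: (fib_uniq (k := p _ c)); first by rewrite base_comp !lb.
  by rewrite compmA !lp.
by exists (@FMor (repstack U) C o l l1 l2 lb), p.
Qed.

End Fibered.

Section YonedaArrow.
Variables (U : cgtop) (C : catover) (q : fmor (repstack U) C).

Definition to_id (W : cgtop) (a : cmap W U) :
  @hom (repstack U) W U a (cm_id U) := @ReprHom U W U a (cm_id U) a (fun=> erefl).

(** An object [a] of the represented stack maps uniquely to the identity of [U],
    so every value of [q] is a pullback of its value at the identity. *)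
Definition can_arr (W : cgtop) (a : ob (repstack U) W) :
  hom (q W a) (q U (cm_id U)) := fhom q (to_id a).

Lemma can_arr_base W (a : ob (repstack U) W) : base (can_arr a) = a.
Proof. by rewrite fhom_base. Qed.

Lemma can_arr_nat W W' (a : ob (repstack U) W) (b : ob (repstack U) W')
  (f : hom a b) : compm (can_arr b) (fhom q f) = can_arr a.
Proof.
rewrite -fhom_comp; congr fhom; apply: repr_hom_ext.
by apply: cm_ext => w; exact: rh_comm.
Qed.

End YonedaArrow.

(** By the Yoneda lemma [d] and [x] determine morphisms from represented stacks,
    and [h] determines the 2-isomorphism between them. *)
Lemma epimorphism_of_local (D C : catover) (F : fmor D C) :
  fibered_in_groupoids D -> fibered_in_groupoids C ->
  (forall (U : cgtop) (x : ob C U) (n : U), exists A : set U,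
    [/\ open A, A n & exists (d : ob D (cg_sub A)) (h : hom (F _ d) x),
      base h = incl A]) ->
  epimorphism F.
Proof.
move=> fD fC loc U q; have /choice[A hA] := loc U (q U (cm_id U)).
have oA n : open (A n) by have [] := hA n.
have cA n : exists i, A i n by exists n; have [] := hA n.
exists (OpenCover oA cA) => i; have [_ _ [d [h hb]]] := hA i.
have [r [p [pb pn]]] := yoneda_ex fD d; exists r.
have li W (a : cmap W (cg_sub (A i))) :
    exists l : hom (F W (r W a)) (q W (cm_comp (incl (A i)) a)),
    base l = cm_id W /\ compm (can_arr q _) l = compm h (fhom F (p W a)).
  apply: (fib_liftE fC).
  by rewrite can_arr_base cm_compm1 base_comp fhom_base pb hb.
pose l W (a : cmap W (cg_sub (A i))) := projT1 (cid (li W a)).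
have lb W a : base (l W a) = cm_id W by rewrite /l; case: cid => ? [].
have lc W a : compm (can_arr q _) (l W a) = compm h (fhom F (p W a)).
  by rewrite /l; case: cid => ? [].
exists l; split=> [//|W W' a b f|W a]; last exact: (fib_iso fC (lb W a)).
apply: (fib_uniq fC (k := can_arr q _)).
  by rewrite !base_comp !lb cm_compm1 cm_comp1m !fhom_base.
by rewrite !compmA lc can_arr_nat lc -(pn _ _ _ _ f) fhom_comp compmA.
Qed.

(** Pullbacks and lifts are formed in [Y] and [Z]; the arrows of [X] that compare
    them exist and commute by the lifting property in [X]. *)
Lemma two_fiber_fibered (Y Z X : catover) (f : fmor Y X) (g : fmor Z X) :
  fibered_in_groupoids Y -> fibered_in_groupoids Z -> fibered_in_groupoids X ->
  fibered_in_groupoids (two_fiber f g).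
Proof.
move=> fY fZ fX; split=> [U V u b|U V W a b c h k u].
  have [y [hy yb]] := fib_pullback fY u (tf_fst b).
  have [z [hz zb]] := fib_pullback fZ u (tf_snd b).
  have [|l [lb lc]] := fib_liftE fX (h := compm (tf_arr b) (fhom f hy))
      (k := fhom g hz) (f := cm_id U).
    by rewrite base_comp !fhom_base yb zb tf_base cm_comp1m cm_compm1.
  exists (TfOb lb).
  by unshelve eexists (@TfHom _ _ _ f g U V (TfOb lb) b hy hz _ _);
    rewrite ?yb ?zb ?lc.
move=> /= e; have [l1 [b1 c1]] := fib_liftE fY e.
have e2 : cm_comp (base (tfh_snd k)) u = base (tfh_snd h).
  by rewrite -!tfh_base.
have [l2 [b2 c2]] := fib_liftE fZ e2.
have eb : base l1 = base l2 by rewrite b1 b2.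
have ec : compm (tf_arr b) (fhom f l1) = compm (fhom g l2) (tf_arr a).
  apply: (fib_uniq fX (k := fhom g (tfh_snd k))).
    by rewrite !base_comp !fhom_base !tf_base eb cm_comp1m cm_compm1.
  by rewrite !compmA -tfh_comm -fhom_comp c2 -tfh_comm -!compmA -fhom_comp c1.
exists (TfHom eb ec); split=> [|l [lb lc]].
  by split=> //; exact: tf_hom_ext.
apply: tf_hom_ext => /=.
  apply: (fib_uniq fY (k := tfh_fst k)); first by rewrite b1 -lb.
  by rewrite c1 -lc.
apply: (fib_uniq fZ (k := tfh_snd k)); first by rewrite b2 -tfh_base -lb.
by rewrite c2 -lc.
Qed.

Lemma equivalent_refl (C : catover) : equivalent C C.
Proof.
have h : iso2 (fmor_comp (fmor_id C) (fmor_id C)) (fmor_id C).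
  exists (fun U x => idm x); split.
  - by move=> U x; exact: base_id.
  - by move=> U V x y h; rewrite comp1m compm1.
  - by move=> U x; exists (idm x); rewrite compm1.
by exists (fmor_id C), (fmor_id C).
Qed.

(** A fully faithful functor that is essentially surjective on each fibre is an
    equivalence, and its source inherits the stack condition from its target. *)
Section FullyFaithful.
Variables (D E : catover) (F : fmor D E).
Hypothesis ff : forall U V (x : ob D U) (y : ob D V) (h : hom (F U x) (F V y)),
  exists! k : hom x y, fhom F k = h.
Hypothesis es : forall U (y : ob E U),
  exists (x : ob D U) (h : hom (F U x) y), base h = cm_id U /\ is_iso h.

Lemma ff_inj U V (x : ob D U) (y : ob D V) (h k : hom x y) :
  fhom F h = fhom F k -> h = k.
Proof. by move=> e; have [l [_ lU]] := ff (fhom F k); rewrite -(lU h e) (lU k erefl). Qed.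

Lemma ff_full U V (x : ob D U) (y : ob D V) (h : hom (F U x) (F V y)) :
  exists k : hom x y, fhom F k = h /\ base k = base h.
Proof. by have [k [<- _]] := ff h; exists k; rewrite fhom_base. Qed.

Lemma equivalent_of_ff_es : equivalent D E.
Proof.
have inv U (y : ob E U) : exists (x : ob D U) (h : hom (F U x) y)
    (k : hom y (F U x)), [/\ base h = cm_id U, base k = cm_id U,
      compm k h = idm _ & compm h k = idm _].
  have [x [h [hb [k [kh hk]]]]] := es y; exists x, h, k; split=> //.
  have := congr1 (fun l => base l) hk.
  by rewrite base_comp hb base_id cm_comp1m.
pose s U (y : ob E U) := projT1 (cid (inv U y)).
pose i1 U (y : ob E U) := cid (projT2 (cid (inv U y))).
pose eps U (y : ob E U) : hom (F U (s U y)) y := projT1 (i1 U y).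
pose i2 U (y : ob E U) := cid (projT2 (i1 U y)).
pose eta U (y : ob E U) : hom y (F U (s U y)) := projT1 (i2 U y).
have H U y : [/\ base (eps U y) = cm_id U, base (eta U y) = cm_id U,
    compm (eta U y) (eps U y) = idm _ & compm (eps U y) (eta U y) = idm _].
  exact: (projT2 (i2 U y)).
move: eps eta H => eps eta H {i1 i2}.
have epsb U y : base (eps U y) = cm_id U by case: (H U y).
have etab U y : base (eta U y) = cm_id U by case: (H U y).
have etaeps U y : compm (eta U y) (eps U y) = idm _ by case: (H U y).
have epseta U y : compm (eps U y) (eta U y) = idm _ by case: (H U y).
pose g U V (y : ob E U) (z : ob E V) (h : hom y z) : hom (s U y) (s V z) :=
  projT1 (cid (ff_full (compm (eta V z) (compm h (eps U y))))).
have gE U V y z h : fhom F (g U V y z h) = compm (eta V z) (compm h (eps U y)).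
  by rewrite /g; case: cid => ? [].
have g1 U y : g U U y y (idm y) = idm (s U y).
  by apply: ff_inj; rewrite gE comp1m etaeps fhom_id.
have gM U V W (x : ob E U) (y : ob E V) (z : ob E W) (h : hom y z) (k : hom x y) :
    g _ _ _ _ (compm h k) = compm (g _ _ _ _ h) (g _ _ _ _ k).
  apply: ff_inj; rewrite fhom_comp !gE -!compmA; congr compm; congr compm.
  by rewrite [in RHS]compmA epseta comp1m.
have gb U V y z h : base (g U V y z h) = base h.
  rewrite -(fhom_base F) gE !base_comp etab epsb cm_comp1m.
  exact: cm_compm1.
pose K := @FMor E D s g g1 gM gb.
exists F, K; split; last first.
  exists eps; split=> //.
    move=> U V x y h /=; rewrite gE compmA epseta.
    exact: comp1m.
  by move=> U x; exists (eta U x); split; [exact: etaeps|exact: epseta].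
pose t U (x : ob D U) : hom (K U (F U x)) x := projT1 (cid (ff_full (eps _ (F U x)))).
have tE U x : fhom F (t U x) = eps _ (F U x) by rewrite /t; case: cid => ? [].
have tb U x : base (t U x) = cm_id U by rewrite -(fhom_base F) tE.
exists t; split=> //.
  move=> U V x y h; apply: ff_inj; rewrite !fhom_comp !tE /= gE.
  by rewrite compmA epseta comp1m.
move=> U x; have [k [kE _]] := ff_full (eta _ (F U x)).
exists k; split; apply: ff_inj; rewrite fhom_comp tE kE fhom_id.
  exact: etaeps.
exact: epseta.
Qed.

(** Descent data are sent to the target and glued there. The hypotheses on the
    restrictions to intersections quantify over all objects of the target, which
    are images up to isomorphism. *)
Lemma stack_of_ff_es : is_stack E -> is_stack D.
Proof.
move=> sE; have fE := stack_fibered sE; split.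
- split=> [U V f y|U V W x y z h k f e].
    have [x' [h hb]] := fib_pullback fE f (F V y).
    have [x [e [eb _]]] := es x'; have [k [_ kb]] := ff_full (compm h e).
    by exists x, k; rewrite kb base_comp eb hb cm_compm1.
  have [|l' [l'b l'E]] := fib_liftE fE (h := fhom F h) (k := fhom F k) (f := f).
    by rewrite !fhom_base.
  have [l [lE lb]] := ff_full l'; exists l; split=> [|m [mb mE]].
    by rewrite lb; split=> //; apply: ff_inj; rewrite fhom_comp lE.
  apply: ff_inj; apply: (fib_uniq fE (k := fhom F k)).
    by rewrite !fhom_base lb mb.
  by rewrite lE l'E -fhom_comp mE.
- move=> U V x y r e f eV fV agree.
  have [i|i|i j z a b aV bV ab|m [[mb mE] mU]] :=
    stack_glue_arrows sE (V := V) (x := F U x) (y := F U y)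
    (r := fun i => F _ (r i)) (e := fun i => fhom F (e i))
    (f := fun i => fhom F (f i)).
  + by rewrite /over_incl fhom_base; exact: eV.
  + by rewrite /over_incl fhom_base; exact: fV.
  + have [z0 [t [tb tI]]] := es z.
    have [a0 [a0E a0b]] := ff_full (compm a t).
    have [b0 [b0E b0b]] := ff_full (compm b t).
    apply: (iso_epi tI); rewrite -!compmA -a0E -b0E -!fhom_comp; congr fhom.
    apply: agree.
    * by rewrite /over_incl2 a0b base_comp tb cm_compm1.
    * by rewrite /over_incl2 b0b base_comp tb cm_compm1.
    * by apply: ff_inj; rewrite !fhom_comp a0E b0E !compmA ab.
  have [n [nE nb]] := ff_full m; exists n; split=> [|n' [n'b n'E]].
    by rewrite nb; split=> // i; apply: ff_inj; rewrite fhom_comp nE mE.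
  apply: ff_inj; rewrite nE; apply: mU; split; first by rewrite fhom_base.
  by move=> i; rewrite -fhom_comp n'E.
- move=> U V x d p q pV qV coc.
  have [i j|i j|i j k z a b c aV bV cV ac ab|y [e [eV eE]]] :=
    stack_glue_objects sE (V := V)
    (x := fun i => F _ (x i)) (d := fun i j => F _ (d i j))
    (p := fun i j => fhom F (p i j)) (q := fun i j => fhom F (q i j)).
  + by rewrite /over_incl2 fhom_base; exact: pV.
  + by rewrite /over_incl2 fhom_base; exact: qV.
  + have [z0 [t [tb tI]]] := es z.
    have [a0 [a0E a0b]] := ff_full (compm a t).
    have [b0 [b0E b0b]] := ff_full (compm b t).
    have [c0 [c0E c0b]] := ff_full (compm c t).
    apply: (iso_epi tI); rewrite -!compmA -b0E -c0E -!fhom_comp; congr fhom.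
    apply: (coc _ _ _ _ a0).
    * by rewrite /over_incl2 a0b base_comp tb cm_compm1.
    * by rewrite /over_incl2 b0b base_comp tb cm_compm1.
    * by rewrite /over_incl2 c0b base_comp tb cm_compm1.
    * by apply: ff_inj; rewrite !fhom_comp a0E c0E !compmA ac.
    * by apply: ff_inj; rewrite !fhom_comp a0E b0E !compmA ab.
  have [y0 [t [tb [t' [t't tt']]]]] := es y.
  have t'b : base t' = cm_id U.
    have := congr1 (fun l => base l) tt'.
    by rewrite base_comp tb base_id cm_comp1m.
  pose e0 i := projT1 (cid (ff_full (compm t' (e i)))).
  have e0E i : fhom F (e0 i) = compm t' (e i).
    by rewrite /e0; case: cid => ? [].
  exists y0, e0; split=> [i|i j].
    by rewrite /over_incl -(fhom_base F) e0E base_comp t'b cm_comp1m; exact: eV.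
  by apply: ff_inj; rewrite !fhom_comp !e0E -!compmA eE.
Qed.

End FullyFaithful.

(** * The universal property of the associated bundle *)

Section AssocUnit.
Variables (M L : cgtop) (G : tgroupoid M) (H : tgroupoid L)
  (phi : tgroupoid_mor G H).

Section Unit.
Variables (N : cgtop) (P : principal_bundle G N).

Lemma assoc_unit_subproof (p : total P) :
  mor0 phi (anchor (raction P) p) =
  tgt H (gone H (mor0 phi (anchor (raction P) p))).
Proof. by rewrite tgt_one. Qed.

Definition unit_rep (p : total P) : ptransl phi P :=
  fpmk (erefl _ : anchor (raction P) p =
    (fp1 : cmap (transl phi) M) (fpmk (assoc_unit_subproof p))).

Lemma assoc_unit_continuous :
  continuous (fun p => assoc_pim phi P (unit_rep p)).
Proof. by rewrite /unit_rep; cont. Qed.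

(** The universal map along [phi] from [P] to a bundle over [H]. *)
Definition assoc_unit : cmap (total P) (total (assoc_bundle phi P)) :=
  cm assoc_unit_continuous.

Lemma assoc_unit_proj p : proj (assoc_bundle phi P) (assoc_unit p) = proj P p.
Proof. exact: assoc_projE. Qed.

Lemma assoc_unit_anchor p :
  anchor (raction (assoc_bundle phi P)) (assoc_unit p) =
  mor0 phi (anchor (raction P) p).
Proof. by rewrite [LHS]assoc_anchorE !fp2K src_one. Qed.

Lemma assoc_unit_act p a (e : anchor (raction P) p = tgt G a)
  (e' : anchor (raction (assoc_bundle phi P)) (assoc_unit p) =
        tgt H (mor1 phi a)) :
  assoc_unit (act (raction P) (fpmk e)) =
  act (raction (assoc_bundle phi P)) (fpmk e').
Proof.
have e1 : src H (fp2 (fp2 (unit_rep p))) = tgt H (mor1 phi a).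
  by rewrite -e' [RHS]assoc_anchorE.
rewrite [RHS](assoc_actE e' e1); apply/esym/assoc_piP/orbE.
have e2 : src G a = fp1 (fp2 (unit_rep (act (raction P) (fpmk e)))).
  by rewrite fp2K fp1K anchor_act.
exists a, e, e2; split=> //; apply: fp_ext; first by rewrite !fp1K.
rewrite !fp2K [RHS]gmul_one; last first.
  by rewrite fp2K anchor_act mor_src.
by apply: one_gmul; rewrite !fp2K mor_tgt e.
Qed.

Lemma assoc_unit_gen x : exists p d
  (e : anchor (raction (assoc_bundle phi P)) (assoc_unit p) = tgt H d),
  act (raction (assoc_bundle phi P)) (fpmk e) = x.
Proof.
elim/assoc_ind: x => w.
have e0 : mor0 phi (anchor (raction P) (fp1 w)) = tgt H (fp2 (fp2 w)).
  by rewrite (fpP w) (fpP (fp2 w)).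
have e : anchor (raction (assoc_bundle phi P)) (assoc_unit (fp1 w)) =
    tgt H (fp2 (fp2 w)) by rewrite assoc_unit_anchor.
exists (fp1 w), (fp2 (fp2 w)), e.
have e1 : src H (fp2 (fp2 (unit_rep (fp1 w)))) = tgt H (fp2 (fp2 w)).
  by rewrite -e [RHS]assoc_anchorE.
rewrite [LHS](assoc_actE e e1); congr assoc_pi.
apply: fp_ext => //; apply: fp_ext; first by rewrite !fp1K (fpP w).
by rewrite fp2K; apply: one_gmul; rewrite !fp2K e0.
Qed.

Variables (N' : cgtop) (Q : principal_bundle H N').

(** The images of the unit generate the associated bundle under [H]. *)
Lemma assoc_mor_eq (g g' : bundle_mor (assoc_bundle phi P) Q) :
  bm_base g = bm_base g' ->
  (forall p, bm_total g (assoc_unit p) = bm_total g' (assoc_unit p)) -> g = g'.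
Proof.
move=> eb eu; apply: bundle_mor_ext => //; apply: cm_ext => x.
have [p [d [e <-]]] := assoc_unit_gen x.
have e1 : anchor (raction Q) (bm_total g (assoc_unit p)) = tgt H d.
  by rewrite bm_anchor.
have e2 : anchor (raction Q) (bm_total g' (assoc_unit p)) = tgt H d.
  by rewrite bm_anchor.
by rewrite (bm_act e e1) (bm_act e e2); exact: act_eq.
Qed.

Variables (b : cmap N N') (f : cmap (total P) (total Q)).
Hypotheses (fpr : forall p, proj Q (f p) = b (proj P p))
  (fa : forall p, anchor (raction Q) (f p) = mor0 phi (anchor (raction P) p))
  (fact : forall p a (e : anchor (raction P) p = tgt G a)
    (e' : anchor (raction Q) (f p) = tgt H (mor1 phi a)),
    f (act (raction P) (fpmk e)) = act (raction Q) (fpmk e')).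

(** The class of [(p, (m, d))] is [(unit p) . d] and must therefore go to
    [(f p) . d]; equivariance of [f] makes this independent of the
    representative. *)
Lemma assoc_mor_ex : exists g : bundle_mor (assoc_bundle phi P) Q,
  bm_base g = b /\ forall p, bm_total g (assoc_unit p) = f p.
Proof.
have e0 (w : ptransl phi P) :
    anchor (raction Q) (f (fp1 w)) = tgt H (fp2 (fp2 w)).
  by rewrite fa (fpP w) (fpP (fp2 w)).
pose g0 w := act (raction Q) (fpmk (e0 w)).
have g0orb w w' : orb w w' -> g0 w = g0 w'.
  move=> /orbE[a [e [e' [h1 h2]]]].
  have e1 : anchor (raction Q) (f (fp1 w)) = tgt H (mor1 phi a).
    by rewrite fa e mor_tgt.
  have e2 : src H (mor1 phi a) = tgt H (fp2 (fp2 w')) by exact: lact_subproof1.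
  have e3 : anchor (raction Q) (f (fp1 w)) = tgt H (gmul e2) by rewrite gtgt.
  have e4 : anchor (raction Q) (act (raction Q) (fpmk e1)) =
      tgt H (fp2 (fp2 w')) by rewrite anchor_act.
  transitivity (act (raction Q) (fpmk e3)).
    by apply: act_eq => //; rewrite h2 fp2K; exact: gmul_eq.
  rewrite -(act_mul (ab := e2) e4 e3); apply: act_eq => //.
  by rewrite h1; exact/esym/fact.
pose g x := g0 (assoc_repr x).
have gE w : g (assoc_pi w) = g0 w by apply: g0orb; exact: assoc_repr_orb.
have cg : continuous (g : assoc_space phi P -> total Q).
  apply: (@assoc_continuous _ _ _ _ phi _ P).
  rewrite (_ : (fun w => _) = g0); last by apply: funext.
  by rewrite /g0; cont.
pose gc : cmap (total (assoc_bundle phi P)) (total Q) := cm cg.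
have gp x : proj Q (gc x) = b (proj (assoc_bundle phi P) x).
  elim/assoc_ind: x => w; rewrite [gc _]gE proj_act fpr; congr (b _).
  exact/esym/assoc_projE.
have ga x : anchor (raction Q) (gc x) = anchor (raction (assoc_bundle phi P)) x.
  by elim/assoc_ind: x => w; rewrite [gc _]gE anchor_act [RHS]assoc_anchorE.
have gact x a (e : anchor (raction (assoc_bundle phi P)) x = tgt H a)
    (e' : anchor (raction Q) (gc x) = tgt H a) :
    gc (act (raction (assoc_bundle phi P)) (fpmk e)) = act (raction Q) (fpmk e').
  elim/assoc_ind: x e e' => w e e'.
  have e1 : src H (fp2 (fp2 w)) = tgt H a by rewrite -e [RHS]assoc_anchorE.
  rewrite [act _ (fpmk e)](assoc_actE e e1) [gc _]gE.
  have e2 : anchor (raction Q) (f (fp1 w)) = tgt H (gmul e1).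
    by rewrite gtgt e0.
  have e3 : anchor (raction Q) (g0 w) = tgt H a by rewrite anchor_act.
  transitivity (act (raction Q) (fpmk e2)); first by apply: act_eq.
  by rewrite -(act_mul (ab := e1) e3 e2); apply: act_eq => //; rewrite -gE.
exists (BundleMor gp ga gact); split=> // p.
by rewrite [LHS]gE; apply: act_oneE; rewrite !fp2K fa.
Qed.

End Unit.

Lemma assoc_unit_nat (N N' : cgtop) (P : principal_bundle G N)
  (P' : principal_bundle G N') (h : bundle_mor P P') p :
  bm_total (assoc_mor phi h) (assoc_unit P p) = assoc_unit P' (bm_total h p).
Proof.
rewrite [LHS]assoc_mapE; congr assoc_pi; apply: fp_ext => //.
apply: fp_ext; first by rewrite !fp2K !fp1K bm_anchor.
by rewrite !fp2K bm_anchor.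
Qed.

End AssocUnit.

(** * The morphism of stacks is a gerbe *)

Lemma topological_stack_BG (M : cgtop) (G : tgroupoid M) :
  topological_stack (BG G).
Proof.
by split; [exact: is_stack_BG|exists M, G; exact: equivalent_refl].
Qed.

Section Gerbe.
Variables (M : cgtop) (G H : tgroupoid M) (F : tgroupoid_mor G H).
Hypothesis F0 : forall x, mor0 F x = x.

(** A local section [s] of [Q] maps the trivial [G]-bundle with the anchor of [s]
    equivariantly to [Q], by [(v, a) |-> (s v) . (F a)]. *)
Lemma epimorphism_BG_map : epimorphism (BG_map F).
Proof.
apply: epimorphism_of_local; [exact: fibered_BG|exact: fibered_BG|].
move=> U Q n; have [A [s [oA An sE]]] := local_sections_at (proj_sections Q) n.
exists A; split=> //.
pose m : cmap (cg_sub A) M := cm_comp (anchor (raction Q)) s.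
exists (triv_bundle G m).
have e0 (z : total (triv_bundle G m)) :
    anchor (raction Q) (s (fp1 z)) = tgt H (mor1 F (fp2 z)).
  by rewrite mor_tgt F0; exact: (fpP z).
have cf : continuous (fun z => act (raction Q) (fpmk (e0 z))) by cont.
have [||p a e e'|g [gb _]] :=
    @assoc_mor_ex _ _ _ _ F _ (triv_bundle G m) _ Q (incl A) (cm cf).
- by move=> z; rewrite [cm _ _]/= proj_act sE.
- by move=> z; rewrite [cm _ _]/= anchor_act mor_src.
- have e1 : src G (fp2 (p : triv_space G m)) = tgt G a by exact: e.
  have e2 : src H (mor1 F (fp2 (p : triv_space G m))) = tgt H (mor1 F a).
    by rewrite mor_src mor_tgt e1.
  have e3 : anchor (raction Q) (s (fp1 (p : triv_space G m))) = tgt H (gmul e2).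
    by rewrite gtgt e0.
  transitivity (act (raction Q) (fpmk e3)).
    apply: act_eq => //; rewrite -(mor_mul e1 e2); congr (mor1 F _).
    exact: gmul_eq.
  by rewrite -(act_mul (ab := e2) e' e3).
by exists g.
Qed.

Lemma mor0_inj x y : mor0 F x = mor0 F y -> x = y.
Proof. by rewrite !F0. Qed.

Hypothesis F1 : local_sections (mor1 F).

(** An object of the 2-fiber product consists of bundles [P], [P'] and an
    isomorphism [al] of the induced bundles. For local sections [t1] of [P] and
    [t2] of [P'] there is a map [de] to the arrows of [H] with
    [al (unit t1) = (unit t2) . de]. If [ga] is a local lift of [de] to [G], the
    sections [s = t1] and [s' = t2 . ga] have the same anchor and
    [al (unit s) = unit s']; they define morphisms to [P] and [P'] from one
    trivial bundle, and these are compatible with [al]. *)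
Lemma epimorphism_diagonal_BG_map : epimorphism (diagonal (BG_map F)).
Proof.
have fG := @fibered_BG _ G; have fH := @fibered_BG _ H.
apply: epimorphism_of_local => //; first exact: two_fiber_fibered.
move=> U [P P' al alb] n; rewrite /= in P P' al alb *.
have [A1 [s1 [oA1 A1n s1E]]] := local_sections_at (proj_sections P) n.
have [A2 [s2 [oA2 A2n s2E]]] := local_sections_at (proj_sections P') n.
pose B := A1 `&` A2; have oB : open B by exact: openI.
have Bn : B n by [].
pose t1 : cmap (cg_sub B) (total P) := cm_comp s1 (incl_map (@subIsetl _ _ _)).
pose t2 : cmap (cg_sub B) (total P') := cm_comp s2 (incl_map (@subIsetr _ _ _)).
have t1E v : proj P (t1 v) = incl B v by rewrite [t1 _]/= s1E.
have t2E v : proj P' (t2 v) = incl B v by rewrite [t2 _]/= s2E.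
have [d dE] := bundle_divE (assoc_bundle F P').
have e0 v : proj (assoc_bundle F P') (assoc_unit F P' (t2 v)) =
    proj (assoc_bundle F P') (bm_total al (assoc_unit F P (t1 v))).
  by rewrite bm_proj alb !assoc_unit_proj t1E t2E.
pose de v := d (fpmk (e0 v)).
have cde : continuous de by rewrite /de; cont.
have [A3 [sg [oA3 A3n sgE]]] := local_sections_at F1 (de (sub_elt Bn)).
pose C : set U := incl B @` (de @^-1` A3).
have oC : open C.
  apply: open_incl_image => //; by move/continuousP: cde; apply.
have CB : C `<=` B by move=> _ [v _ <-]; exact: inclP.
pose i := incl_map CB.
have CA3 c : A3 (de (i c)).
  have [v Av vc] := inclP c; rewrite (_ : i c = v) //.
  by apply: incl_inj; rewrite vc.
pose ga c := sg (sub_elt (CA3 c)).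
have gaE c : mor1 F (ga c) = de (i c) by rewrite sgE.
have cga : continuous ga.
  rewrite /ga; apply: ccomp; apply: sub_elt_continuous.
  by apply: (ccomp (g := cm cde)); exact: cts_fun.
have de1 v : anchor (raction (assoc_bundle F P')) (assoc_unit F P' (t2 v)) =
    tgt H (de v) by have [] := dE _ _ (e0 v).
have de2 v : act (raction (assoc_bundle F P')) (fpmk (de1 v)) =
    bm_total al (assoc_unit F P (t1 v)).
  by have [e <-] := dE _ _ (e0 v); exact: act_eq.
have e1 c : anchor (raction P') (t2 (i c)) = tgt G (ga c).
  by apply: mor0_inj; rewrite -assoc_unit_anchor de1 -gaE mor_tgt.
pose s c : total P := t1 (i c).
pose s' c := act (raction P') (fpmk (e1 c)).
have cs : continuous s by rewrite /s; cont.
have cs' : continuous s' by rewrite /s'; cont.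
have us c : bm_total al (assoc_unit F P (s c)) = assoc_unit F P' (s' c).
  have e2 : anchor (raction (assoc_bundle F P')) (assoc_unit F P' (t2 (i c))) =
      tgt H (mor1 F (ga c)) by rewrite de1 gaE.
  by rewrite (assoc_unit_act (e1 c) e2) -de2; apply: act_eq.
have ms c : anchor (raction P) (s c) = anchor (raction P') (s' c).
  apply: mor0_inj; rewrite -!assoc_unit_anchor -us.
  by rewrite bm_anchor.
pose m : cmap (cg_sub C) M := cm_comp (anchor (raction P)) (cm cs).
have m1 c : anchor (raction P) (cm cs c) = m c by [].
have m2 c : anchor (raction P') (cm cs' c) = m c by rewrite -[LHS]ms.
exists C; split=> //; first by exists (sub_elt Bn).
exists (triv_bundle G m).
have ps c : proj P (s c) = proj P' (s' c) by rewrite proj_act t2E; exact: t1E.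
have eb : bm_base (triv_mor m1) = bm_base (triv_mor m2) by exact: cm_ext.
pose T := triv_bundle G m.
have ec : bundle_comp al (assoc_mor F (triv_mor m1)) =
    bundle_comp (assoc_mor F (triv_mor m2)) (bundle_id _); last first.
  exists (@TfHom _ _ _ (BG_map F) (BG_map F) _ _ (diag_ob (BG_map F) T)
    (@TfOb _ _ _ (BG_map F) (BG_map F) U P P' al alb)
    (triv_mor m1) (triv_mor m2) eb ec).
  change (bm_base (triv_mor m1) = incl C).
  by apply: cm_ext => c; exact: t1E.
apply: assoc_mor_eq => [|z].
  rewrite [LHS]/= [RHS]/= alb; apply: cm_ext => c.
  exact: ps.
change (bm_total al (bm_total (assoc_mor F (triv_mor m1)) (assoc_unit F T z)) =
  bm_total (assoc_mor F (triv_mor m2)) (assoc_unit F T z)).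
rewrite !assoc_unit_nat.
have f1 := triv_mor_subproof m1 z; have f2 := triv_mor_subproof m2 z.
have g1 : anchor (raction (assoc_bundle F P)) (assoc_unit F P (s (fp1 z))) =
    tgt H (mor1 F (fp2 z)) by rewrite assoc_unit_anchor mor_tgt -f1.
have g2 : anchor (raction (assoc_bundle F P')) (assoc_unit F P' (s' (fp1 z))) =
    tgt H (mor1 F (fp2 z)) by rewrite assoc_unit_anchor mor_tgt -f2.
transitivity (act (raction (assoc_bundle F P')) (fpmk g2)).
  rewrite [X in assoc_unit F P X](_ : _ = act (raction P) (fpmk f1)); last exact: act_eq.
  have g3 : anchor (raction (assoc_bundle F P'))
     (bm_total al (assoc_unit F P (s (fp1 z)))) = tgt H (mor1 F (fp2 z)).
    by rewrite bm_anchor.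
  by rewrite (assoc_unit_act f1 g1) (bm_act g1 g3); apply: act_eq.
rewrite -(assoc_unit_act f2 g2); congr (assoc_unit F P' _); exact: act_eq.
Qed.

Lemma is_gerbe_BG_map : is_gerbe (BG_map F).
Proof.
split; [exact: topological_stack_BG|exact: topological_stack_BG| |].
  exact: epimorphism_BG_map.
exact: epimorphism_diagonal_BG_map.
Qed.

End Gerbe.

(** * Pullbacks of local fibrations *)

Record is_pullback (X Y X' Y' : cgtop) (f : cmap X Y) (f' : cmap X' Y')
    (a : cmap X' X) (b : cmap Y' Y) : Prop := IsPullback {
  pb_comm : forall x, f (a x) = b (f' x);
  pb_univ : forall (W : cgtop) (u : cmap W X) (v : cmap W Y'),
    (forall w, f (u w) = b (v w)) ->
    exists k : cmap W X', forall w, a (k w) = u w /\ f' (k w) = v w;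
  pb_inj : forall x x', a x = a x' -> f' x = f' x' -> x = x' }.

Section Fibration.
Variables (R : realType) (T : Type) (Z : T -> cgtop).

(** With [Z] ranging over all spaces these are the Hurewicz fibrations, with [Z]
    ranging over the cubes the Serre fibrations. *)
Definition has_liftings (X Y : cgtop) (f : cmap X Y) : Prop :=
  forall t, homotopy_lifting R (Z t) f.

Lemma has_liftings_pullback (X Y X' Y' : cgtop) (f : cmap X Y)
  (f' : cmap X' Y') (a : cmap X' X) (b : cmap Y' Y) :
  is_pullback f f' a b -> has_liftings f -> has_liftings f'.
Proof.
move=> [comm univ inj] Lf t h g gh.
have [|k [k0 kE]] := Lf t (cm_comp b h) (cm_comp a g).
  by move=> z /=; rewrite comm gh.
have [l lE] := univ _ k h kE; exists l; split=> w; last by have [] := lE w.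
apply: inj; first by have [-> _] := lE (w, interval0 R); exact: k0.
by have [_ ->] := lE (w, interval0 R); rewrite gh.
Qed.

(** Over the preimage of [V], the restriction of [f'] to the preimage of [U] is
    the pullback of the restriction of [f] from [U] to [V]. *)
Lemma locally_fibration_pullback (X Y X' Y' : cgtop) (f : cmap X Y)
  (f' : cmap X' Y') (a : cmap X' X) (b : cmap Y' Y) :
  is_pullback f f' a b -> locally_fibration has_liftings f ->
  locally_fibration has_liftings f'.
Proof.
move=> [comm univ inj] Lf x; have [U [V [g [[oU Ux] [oV Vx] gE Lg]]]] := Lf (a x).
pose U' : set X' := [set x | U (a x)]; pose V' : set Y' := [set y | V (b y)].
have UV (z : cg_sub U') : V' (f' (incl U' z)).
  rewrite /V' /= -comm -[a _]/(incl U (sub_elt (inclP z : U (a (incl U' z))))).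
  by rewrite -gE; exact: inclP.
have cg : continuous (fun z => sub_elt (UV z)) by cont.
have ca : continuous (fun z : cg_sub U' => sub_elt (inclP z : U (a (incl U' z)))).
  by cont.
have cb : continuous (fun z : cg_sub V' => sub_elt (inclP z : V (b (incl V' z)))).
  by cont.
exists U', V', (cm cg); split=> //.
- by split=> //; apply: open_preimage => //; exact: cts_fun.
- split; first by apply: open_preimage => //; exact: cts_fun.
  by rewrite /V' /= -comm.
apply: (has_liftings_pullback (a := cm ca) (b := cm cb) _ Lg); split.
- by move=> z; apply: incl_inj; rewrite gE; exact: comm.
- move=> W u v uv.
  have [|k kE] := univ W (cm_comp (incl U) u) (cm_comp (incl V') v).
    by move=> w; rewrite /= -gE uv.
  have kU w : U' (k w) by rewrite /U' /=; have [-> _] := kE w; exact: inclP.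
  have ck : continuous (fun w => sub_elt (kU w)) by cont.
  exists (cm ck) => w; have [k1 k2] := kE w.
  by split; apply: incl_inj; [exact: k1|exact: k2].
- move=> z z' /(congr1 (fun y => incl U y)) e1 /(congr1 (fun y => incl V' y)) e2.
  by apply: incl_inj; exact: inj e1 e2.
Qed.

End Fibration.

(** * The action groupoid *)

Section ActionGroupoid.
Variables (M : cgtop) (G : tgroupoid M) (Q : cgtop) (r : right_action G Q).

Lemma anchor_actE (z : fp (anchor r) (tgt G)) :
  anchor r (act r z) = src G (fp2 z).
Proof.
rewrite (_ : z = fpmk (fpP z)); first exact: anchor_act.
exact: fp_ext.
Qed.

Definition ag_arr : cgtop := fp (anchor r) (tgt G).

Lemma ag_one_subproof x : anchor r x = tgt G (gone G (anchor r x)).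
Proof. by rewrite tgt_one. Qed.

Lemma ag_one_continuous : continuous (fun x => fpmk (ag_one_subproof x) : ag_arr).
Proof. by cont. Qed.

Lemma ag_inv_subproof (z : ag_arr) : anchor r (act r z) = tgt G (ginv (fp2 z)).
Proof. by rewrite anchor_actE tgt_inv. Qed.

Lemma ag_inv_continuous : continuous (fun z => fpmk (ag_inv_subproof z) : ag_arr).
Proof. by cont. Qed.

Lemma ag_comp_subproof0 (z : fp (act r) (fp1 : cmap ag_arr Q)) :
  src G (fp2 (fp1 z)) = tgt G (fp2 (fp2 z)).
Proof. by rewrite -anchor_actE -(fpP (fp2 z)) (fpP z). Qed.

Lemma ag_comp_subproof (z : fp (act r) (fp1 : cmap ag_arr Q)) :
  anchor r (fp1 (fp1 z)) = tgt G (gmul (ag_comp_subproof0 z)).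
Proof. by rewrite gtgt; exact: fpP. Qed.

Lemma ag_comp_continuous :
  continuous (fun z => fpmk (ag_comp_subproof z) : ag_arr).
Proof. by cont. Qed.

Lemma ag_actE (z : ag_arr) x a (e : anchor r x = tgt G a) :
  fp1 z = x -> fp2 z = a -> act r z = act r (fpmk e).
Proof. by move=> ex ea; congr (act r _); exact: fp_ext. Qed.

(** The arrow [(x, a)] goes from [x . a] to [x], so that the composition is
    [(x, a) o (x . a, b) = (x, a o b)]. *)
Definition action_groupoid : tgroupoid Q.
Proof.
refine (@TGroupoid Q ag_arr (act r) fp1 (@cm _ ag_arr _ ag_one_continuous)
  (@cm _ ag_arr _ ag_inv_continuous) (@cm _ ag_arr _ ag_comp_continuous)
  _ _ _ _ _ _ _ _ _ _ _).
- by move=> x; exact: act_one.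
- by [].
- move=> z; have e1 : anchor r (fp1 z) = tgt G (fp2 z) by exact: fpP.
  have e2 : anchor r (act r (fpmk e1)) = tgt G (ginv (fp2 z)).
    by rewrite anchor_act tgt_inv.
  have e3 : src G (fp2 z) = tgt G (ginv (fp2 z)) by rewrite tgt_inv.
  have e4 : anchor r (fp1 z) = tgt G (gmul e3) by rewrite gtgt.
  transitivity (act r (fpmk e2)).
    by apply: ag_actE => //; rewrite fp1K; exact: ag_actE.
  rewrite (act_mul (ab := e3) e2 e4); apply: act_oneE.
  by rewrite (gmulV e3) // e1.
- by [].
- move=> a b e; have e0 : anchor r (fp1 a) = tgt G (fp2 a) by exact: fpP.
  have e1 : src G (fp2 a) = tgt G (fp2 b) by exact: (ag_comp_subproof0 (fpmk e)).
  have e2 : anchor r (act r (fpmk e0)) = tgt G (fp2 b) by rewrite anchor_act.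
  have e3 : anchor r (fp1 a) = tgt G (gmul e1) by rewrite gtgt.
  transitivity (act r (fpmk e3)); first by apply: ag_actE => //; exact: gmul_eq.
  rewrite -(act_mul (ab := e1) e2 e3); apply/esym/ag_actE => //.
  by rewrite -e; exact: ag_actE.
- by [].
- move=> a x e; apply: fp_ext => //; apply: gmul_one.
  rewrite [LHS]fp2K; congr (gone G _); rewrite -anchor_actE; congr (anchor r _).
  exact: esym e.
- move=> x a e.
  have ex : x = fp1 a by apply: etrans _ e; exact/esym/act_one.
  apply: fp_ext; first exact: ex.
  apply: one_gmul; rewrite [LHS]fp2K; congr (gone G _).
  by rewrite [in LHS]ex; exact: (fpP a).
- move=> a e; apply: fp_ext => //.
  have e1 : src G (fp2 a) = tgt G (ginv (fp2 a)) by rewrite tgt_inv.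
  transitivity (gmul e1); first exact: gmul_eq.
  by rewrite (gmulV e1) //= fp2K fpP.
- move=> a e; apply: fp_ext => //.
  have e1 : src G (ginv (fp2 a)) = tgt G (fp2 a) by rewrite src_inv.
  transitivity (gmul e1); first exact: gmul_eq.
  by rewrite (gVmul e1) //= fp2K anchor_actE.
- move=> a b c ab bc abc abc'; apply: fp_ext => //.
  have f1 : src G (fp2 a) = tgt G (fp2 b) by exact: (ag_comp_subproof0 (fpmk ab)).
  have f2 : src G (fp2 b) = tgt G (fp2 c) by exact: (ag_comp_subproof0 (fpmk bc)).
  have f3 : src G (fp2 a) = tgt G (gmul f2) by rewrite gtgt.
  have f4 : src G (gmul f1) = tgt G (fp2 c) by rewrite gsrc.
  transitivity (gmul f3); first by apply: gmul_eq => //; exact: gmul_eq.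
  by rewrite (gmulA f3 f4); apply: gmul_eq => //; exact: gmul_eq.
Defined.

(** An arrow of the action groupoid is determined by its source [y] and its
    component [a] in the groupoid, the target being [y . a^-1]. *)
Lemma src_action_groupoid_pullback :
  is_pullback (src G) (src action_groupoid)
    (fp2 : cmap (arr action_groupoid) (arr G)) (anchor r).
Proof.
split.
- by move=> z; exact/esym/anchor_actE.
- move=> W u v e.
  have e1 w : anchor r (v w) = tgt G (ginv (u w)) by rewrite tgt_inv.
  have e2 w : anchor r (act r (fpmk (e1 w))) = tgt G (u w).
    by rewrite anchor_act src_inv.
  have ck : continuous (fun w => fpmk (e2 w) : ag_arr) by cont.
  exists (@cm _ ag_arr _ ck) => w; split=> //.
  have e3 : src G (ginv (u w)) = tgt G (u w) by rewrite src_inv.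
  have e4 : anchor r (v w) = tgt G (gmul e3) by rewrite gtgt tgt_inv.
  rewrite [LHS](act_mul (ab := e3) _ e4); apply: act_oneE.
  by rewrite (gVmul e3) // e.
- move=> z z' e1 e2; apply: fp_ext => //.
  have back (t : ag_arr) : exists e : anchor r (act r t) = tgt G (ginv (fp2 t)),
      act r (fpmk e) = fp1 t.
    have e : anchor r (act r t) = tgt G (ginv (fp2 t)) by exact: ag_inv_subproof.
    exists e; have e0 : anchor r (fp1 t) = tgt G (fp2 t) by exact: fpP.
    have f1 : anchor r (act r (fpmk e0)) = tgt G (ginv (fp2 t)).
      by rewrite anchor_act tgt_inv.
    have f2 : src G (fp2 t) = tgt G (ginv (fp2 t)) by rewrite tgt_inv.
    have f3 : anchor r (fp1 t) = tgt G (gmul f2) by rewrite gtgt.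
    transitivity (act r (fpmk f1)); first by apply: act_eq => //; exact: ag_actE.
    by rewrite (act_mul (ab := f2) f1 f3); apply: act_oneE; rewrite (gmulV f2) // e0.
  have [f fE] := back z; have [f' f'E] := back z'.
  by rewrite -fE -f'E; apply: act_eq => //; rewrite e1.
Qed.

(** * Bundles over the action groupoid *)

Notation K := action_groupoid.

(** A [G]-bundle with an equivariant map [f] to [Q] is a bundle for the action
    groupoid, with anchor [f] and [p . (x, a) = p . a]. *)
Section ToAction.
Variables (N : cgtop) (P : principal_bundle G N) (f : cmap (total P) Q).
Hypotheses (fa : forall p, anchor r (f p) = anchor (raction P) p)
  (fact : forall p a (e : anchor (raction P) p = tgt G a)
    (e' : anchor r (f p) = tgt G a),
    f (act (raction P) (fpmk e)) = act r (fpmk e')).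

Lemma agb_subproof (z : fp f (tgt K)) :
  anchor (raction P) (fp1 z) = tgt G (fp2 (fp2 z : ag_arr)).
Proof. by rewrite -fa (fpP z); exact: fpP. Qed.

Lemma agb_continuous :
  continuous (fun z : fp f (tgt K) => act (raction P) (fpmk (agb_subproof z))).
Proof. by cont. Qed.

Lemma agb_actE (z : fp f (tgt K)) p a (e : anchor (raction P) p = tgt G a) :
  fp1 z = p -> fp2 (fp2 z : ag_arr) = a ->
  cm agb_continuous z = act (raction P) (fpmk e).
Proof. by move=> ep ea; exact: act_eq. Qed.

Definition agb_raction : right_action K (total P).
Proof.
refine (@RightAction Q K (total P) f (cm agb_continuous) _ _ _).
- move=> p a e; have e1 : anchor r (f p) = tgt G (fp2 (a : ag_arr)).
    by rewrite e; exact: fpP.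
  by rewrite [LHS](fact _ e1); apply/esym/ag_actE.
- by move=> p e; apply: act_oneE; rewrite -fa.
- move=> p a b e ab e' e''.
  have f1 : anchor (raction P) p = tgt G (fp2 (a : ag_arr)).
    by rewrite -fa e; exact: fpP.
  have f2 : src G (fp2 (a : ag_arr)) = tgt G (fp2 (b : ag_arr)).
    exact: (ag_comp_subproof0 (fpmk ab)).
  have f3 : anchor (raction P) (act (raction P) (fpmk f1)) = tgt G (fp2 (b : ag_arr)).
    by rewrite anchor_act.
  have f4 : anchor (raction P) p = tgt G (gmul f2) by rewrite gtgt.
  transitivity (act (raction P) (fpmk f3)).
    by apply: agb_actE => //; exact: agb_actE.
  rewrite (act_mul (ab := f2) f3 f4); apply/esym/agb_actE => //; exact: gmul_eq.
Defined.

Definition ag_bundle : principal_bundle K N.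
Proof.
apply: (@bundle_of_div _ K N (total P) agb_raction (proj P)).
- by move=> p a e; exact: proj_act.
- exact: proj_sections.
- move=> p a b e e' /bundle_free h; apply: fp_ext => //.
  by rewrite -[fp1 a]/(tgt K a) -e -[fp1 b]/(tgt K b) -e'.
have [d dE] := bundle_div P.
have e z : anchor (raction P) (fp1 z) = tgt G (d z) by have [] := dE z.
have e' z : anchor r (f (fp1 z)) = tgt G (d z) by rewrite fa.
have cd : continuous (fun z => fpmk (e' z) : ag_arr) by cont.
exists (@cm _ ag_arr _ cd) => z; exists erefl.
by have [e1 <-] := dE z; exact: agb_actE.
Defined.

Lemma ag_bundle_actE (p : total P) (a : ag_arr)
  (e : anchor (raction ag_bundle) p = tgt K a)
  (e1 : anchor (raction P) p = tgt G (fp2 a)) :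
  act (raction ag_bundle) (fpmk e) = act (raction P) (fpmk e1).
Proof. exact: (agb_actE (z := fpmk e)). Qed.

End ToAction.

(** Conversely [p . a = p . (f p, a)], where [f] is the anchor of a bundle for
    the action groupoid. *)
Section FromAction.
Variables (N : cgtop) (B : principal_bundle K N).

Lemma fag_subproof0 (z : fp (cm_comp (anchor r) (anchor (raction B))) (tgt G)) :
  anchor r (anchor (raction B) (fp1 z)) = tgt G (fp2 z).
Proof. exact: (fpP z). Qed.

Lemma fag_subproof z :
  anchor (raction B) (fp1 z) = tgt K (fpmk (fag_subproof0 z) : ag_arr).
Proof. by []. Qed.

Lemma fag_continuous : continuous (fun z => act (raction B) (fpmk (fag_subproof z))).
Proof. by cont. Qed.

Lemma fag_funE z p (k : ag_arr) (e : anchor (raction B) p = tgt K k) :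
  fp1 z = p -> fp2 z = fp2 k ->
  cm fag_continuous z = act (raction B) (fpmk e).
Proof.
move=> ep ek; apply: act_eq => //; apply: fp_ext => //.
by rewrite [LHS]fp1K ep e.
Qed.

Definition fag_raction : right_action G (total B).
Proof.
refine (@RightAction M G (total B) (cm_comp (anchor r) (anchor (raction B)))
  (cm fag_continuous) _ _ _).
- by move=> p a e; rewrite [LHS]/= anchor_act; exact: anchor_actE.
- move=> p e; apply: act_oneE; exact: fp_ext.
- move=> p a b e ab e' e''.
  have f1 : anchor r (anchor (raction B) p) = tgt G a by exact: e.
  have f2 : anchor (raction B) p = tgt K (fpmk f1 : ag_arr) by [].
  have f3 : anchor r (act r (fpmk f1)) = tgt G b by rewrite anchor_act.
  have f4 : src K (fpmk f1 : ag_arr) = tgt K (fpmk f3 : ag_arr) by [].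
  have f5 : anchor (raction B) (act (raction B) (fpmk f2)) = tgt K (fpmk f3 : ag_arr).
    exact: anchor_act.
  have f6 : anchor (raction B) p = tgt K (gmul f4) by rewrite gtgt.
  transitivity (act (raction B) (fpmk f5)).
    by apply: fag_funE => //; exact: fag_funE.
  rewrite (act_mul (ab := f4) f5 f6); apply/esym/fag_funE => //.
  exact: gmul_eq.
Defined.

Lemma fag_actE p a (e : anchor fag_raction p = tgt G a) (k : ag_arr)
  (e' : anchor (raction B) p = tgt K k) : fp2 k = a ->
  act fag_raction (fpmk e) = act (raction B) (fpmk e').
Proof. by move=> ea; exact: fag_funE. Qed.

Definition fag_bundle : principal_bundle G N.
Proof.
apply: (@bundle_of_div _ G N (total B) fag_raction (proj B)).
- by move=> p a e; exact: proj_act.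
- exact: proj_sections.
- by move=> p a b e e' /bundle_free/(congr1 (fun z : ag_arr => fp2 z)).
have [d dE] := bundle_div B.
have cd : continuous (fun z => fp2 (d z : ag_arr)) by cont.
exists (cm cd) => z; have [e1 e2] := dE z.
have e : anchor fag_raction (fp1 z) = tgt G (fp2 (d z : ag_arr)).
  by rewrite [LHS]/= e1; exact: fpP.
by exists e; rewrite -e2; exact: fag_actE.
Defined.

End FromAction.

End ActionGroupoid.

(** * The 2-fiber products over a represented stack *)

Section Fiber.
Variables (M : cgtop) (G H : tgroupoid M) (F : tgroupoid_mor G H).
Hypothesis F0 : forall x, mor0 F x = x.

(** The action of [G] through [F] on a space with an action of [H]; the anchor is
    the same because [F] is the identity on objects. *)
Section Restriction.
Variables (Q : cgtop) (rH : right_action H Q).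

Lemma restr_subproof (z : fp (anchor rH) (tgt G)) :
  anchor rH (fp1 z) = tgt H (mor1 F (fp2 z)).
Proof. by rewrite mor_tgt F0; exact: fpP. Qed.

Lemma restr_continuous :
  continuous (fun z => act rH (fpmk (restr_subproof z))).
Proof. by cont. Qed.

Lemma restr_funE z q a (e : anchor rH q = tgt H (mor1 F a)) :
  fp1 z = q -> fp2 z = a -> cm restr_continuous z = act rH (fpmk e).
Proof. by move=> eq ea; apply: act_eq => //; rewrite ea. Qed.

Definition restr_raction : right_action G Q.
Proof.
refine (@RightAction M G Q (anchor rH) (cm restr_continuous) _ _ _).
- by move=> p a e; rewrite [LHS]anchor_act mor_src F0.
- by move=> p e; apply: act_oneE; rewrite fp2K mor_one F0.
- move=> p a b e ab e' e''.
  have f1 : anchor rH p = tgt H (mor1 F a) by rewrite mor_tgt F0.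
  have f2 : src H (mor1 F a) = tgt H (mor1 F b) by rewrite mor_src mor_tgt ab.
  have f3 : anchor rH (act rH (fpmk f1)) = tgt H (mor1 F b) by rewrite anchor_act.
  have f4 : anchor rH p = tgt H (gmul f2) by rewrite gtgt.
  transitivity (act rH (fpmk f3)).
    by apply: restr_funE => //; exact: restr_funE.
  rewrite (act_mul (ab := f2) f3 f4); apply: act_eq => //.
  by rewrite fp2K (mor_mul ab f2).
Defined.

End Restriction.

Variables (U : cgtop) (q : fmor (repstack U) (BG H)).

Let Q : principal_bundle H U := q U (cm_id U).
Let r := restr_raction (raction Q).
Let K := action_groupoid r.
Let D := two_fiber (BG_map F) q.

(** The isomorphism of an object of the 2-fiber product, followed by the
    canonical arrow from the pullback of [Q] to [Q]. *)
Let theta N (x : ob D N) : bundle_mor (assoc_bundle F (tf_fst x)) Q :=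
  bundle_comp (can_arr q (tf_snd x) : bundle_mor _ _) (tf_arr x).

Definition fiber_map N (x : ob D N) : cmap (total (tf_fst x)) (total Q) :=
  cm_comp (bm_total (theta x)) (assoc_unit F (tf_fst x)).

Lemma theta_base N (x : ob D N) n : bm_base (theta x) n = tf_snd x n.
Proof.
have := tf_base x; rewrite /theta /= => ->.
have := can_arr_base q (tf_snd x); rewrite /= => ->.
by [].
Qed.

Lemma fiber_map_proj N (x : ob D N) p :
  proj Q (fiber_map x p) = tf_snd x (proj (tf_fst x) p).
Proof. by rewrite [LHS](bm_proj (theta x)) theta_base assoc_unit_proj. Qed.

Lemma fiber_map_anchor N (x : ob D N) p :
  anchor r (fiber_map x p) = anchor (raction (tf_fst x)) p.
Proof. by rewrite [LHS](bm_anchor (theta x)) assoc_unit_anchor F0. Qed.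

Lemma fiber_map_act N (x : ob D N) p a
  (e : anchor (raction (tf_fst x)) p = tgt G a)
  (e' : anchor r (fiber_map x p) = tgt G a) :
  fiber_map x (act (raction (tf_fst x)) (fpmk e)) = act r (fpmk e').
Proof.
have e1 : anchor (raction (assoc_bundle F (tf_fst x)))
    (assoc_unit F (tf_fst x) p) = tgt H (mor1 F a).
  by rewrite assoc_unit_anchor mor_tgt e.
have e2 : anchor (raction Q) (fiber_map x p) = tgt H (mor1 F a).
  by rewrite mor_tgt F0.
transitivity (act (raction Q) (fpmk e2)); last exact/esym/restr_funE.
rewrite [LHS]/= (assoc_unit_act e e1).
exact: (bm_act (b := theta x) e1 e2).
Qed.

Definition fiber_bundle N (x : ob D N) : principal_bundle K N :=
  ag_bundle (@fiber_map_anchor N x) (@fiber_map_act N x).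

Lemma fiber_bundle_actE N (x : ob D N) (p : total (tf_fst x)) (a : ag_arr r)
  (e : anchor (raction (fiber_bundle x)) p = tgt K a)
  (e1 : anchor (raction (tf_fst x)) p = tgt G (fp2 a)) :
  act (raction (fiber_bundle x)) (fpmk e) = act (raction (tf_fst x)) (fpmk e1).
Proof. exact: ag_bundle_actE. Qed.

Lemma fiber_map_nat N N' (x : ob D N) (y : ob D N') (h : hom x y) p :
  fiber_map y (bm_total (tfh_fst h) p) = fiber_map x p.
Proof.
rewrite [LHS]/= -assoc_unit_nat.
have := congr1 (fun k : bundle_mor _ _ => bm_total k (assoc_unit F (tf_fst x) p))
  (tfh_comm h).
have := congr1 (fun k : bundle_mor _ _ => bm_total k
  (bm_total (tf_arr x) (assoc_unit F (tf_fst x) p))) (can_arr_nat q (tfh_snd h)).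
rewrite /= => e1 e2.
by rewrite [X in bm_total (can_arr q _) X]e2 -[RHS]e1.
Qed.

Lemma fiber_hom_act N N' (x : ob D N) (y : ob D N') (h : hom x y)
  (k : bundle_mor (tf_fst x) (tf_fst y) := tfh_fst h)
  (p : total (tf_fst x)) (a : arr K)
  (e : anchor (raction (fiber_bundle x)) p = tgt K a)
  (e' : anchor (raction (fiber_bundle y)) (bm_total k p) = tgt K a) :
  bm_total k (act (raction (fiber_bundle x)) (fpmk e)) =
  act (raction (fiber_bundle y)) (fpmk e').
Proof.
have e1 : anchor (raction (tf_fst x)) p = tgt G (fp2 (a : ag_arr r)).
  exact: (agb_subproof (@fiber_map_anchor N x) (fpmk e)).
have e2 : anchor (raction (tf_fst y)) (bm_total k p) =
    tgt G (fp2 (a : ag_arr r)) by rewrite bm_anchor.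
transitivity (act (raction (tf_fst y)) (fpmk e2)).
  rewrite -(bm_act e1 e2); congr (bm_total k _); exact: ag_bundle_actE.
exact/esym/ag_bundle_actE.
Qed.

Definition fiber_hom N N' (x : ob D N) (y : ob D N') (h : hom x y) :
  bundle_mor (fiber_bundle x) (fiber_bundle y) :=
  @BundleMor _ K N N' (fiber_bundle x) (fiber_bundle y)
    (@bm_base _ G N N' (tf_fst x) (tf_fst y) (tfh_fst h))
    (@bm_total _ G N N' (tf_fst x) (tf_fst y) (tfh_fst h))
    (@bm_proj _ G N N' (tf_fst x) (tf_fst y) (tfh_fst h))
    (fiber_map_nat h) (@fiber_hom_act N N' x y h).

Lemma fiber_hom_id N (x : ob D N) :
  fiber_hom (idm x) = bundle_id (fiber_bundle x).
Proof. exact: bundle_mor_ext. Qed.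

Lemma fiber_hom_comp N N' N'' (x : ob D N) (y : ob D N') (z : ob D N'')
  (h : hom y z) (k : hom x y) :
  fiber_hom (compm h k) = bundle_comp (fiber_hom h) (fiber_hom k).
Proof. by apply: bundle_mor_ext; apply: cm_ext. Qed.

Definition fiber_functor : fmor D (BG K) :=
  @FMor D (BG K) fiber_bundle fiber_hom fiber_hom_id fiber_hom_comp
    (fun _ _ _ _ _ => erefl).

(** An equivariant map over [Q] determines the underlying map to [U], because [P]
    maps onto its base, and its compatibility with the isomorphisms may be
    checked after the cartesian arrow to [Q], on the unit. *)
Lemma fiber_functor_ff N N' (x : ob D N) (y : ob D N')
  (h : hom (fiber_functor N x) (fiber_functor N' y)) :
  exists! k : hom x y, fhom fiber_functor k = h.
Proof.
pose P := tf_fst x; pose P' := tf_fst y.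
pose t : cmap (total P) (total P') := bm_total h.
have tf p : fiber_map y (t p) = fiber_map x p by exact: (bm_anchor h p).
have tp p : proj P' (t p) = bm_base h (proj P p) by exact: (bm_proj h p).
have ta p : anchor (raction P') (t p) = anchor (raction P) p.
  by rewrite -!fiber_map_anchor tf.
have tact p a (e : anchor (raction P) p = tgt G a)
    (e' : anchor (raction P') (t p) = tgt G a) :
    t (act (raction P) (fpmk e)) = act (raction P') (fpmk e').
  have e0 : anchor r (fiber_map x p) = tgt G a by rewrite fiber_map_anchor.
  have e1 : anchor (raction (fiber_bundle x)) p = tgt K (fpmk e0 : ag_arr r) by [].
  have e2 : anchor (raction (fiber_bundle y)) (t p) = tgt K (fpmk e0 : ag_arr r).
    exact: tf.
  transitivity (act (raction (fiber_bundle y)) (fpmk e2)); last exact: ag_bundle_actE.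
  rewrite -(bm_act (b := h) e1 e2); congr (t _).
  exact/esym/ag_bundle_actE.
pose k1 : bundle_mor P P' := BundleMor tp ta tact.
have e2 n : tf_snd y (bm_base h n) = tf_snd x n.
  have [p <-] := local_sections_surj (proj_sections P) n.
  by rewrite -tp -!fiber_map_proj tf.
pose k2 : @hom (repstack U) N N' (tf_snd x) (tf_snd y) :=
  @ReprHom U N N' (tf_snd x) (tf_snd y) (bm_base h) e2.
have kb : @base (BG G) N N' P P' k1 = base k2 by [].
have kc : compm (tf_arr y) (@fhom _ _ (BG_map F) N N' P P' k1) =
    compm (fhom q k2) (tf_arr x).
  apply: (fib_uniq (@fibered_BG _ H) (k := can_arr q (tf_snd y))).
    by rewrite !base_comp !fhom_base !tf_base kb cm_comp1m cm_compm1.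
  rewrite !compmA can_arr_nat; apply: (@assoc_mor_eq _ _ _ _ F _ P).
    apply: cm_ext => n.
    change (bm_base (theta y) (bm_base h n) = bm_base (theta x) n).
    by rewrite !theta_base e2.
  move=> p.
  change (bm_total (theta y) (bm_total (assoc_mor F k1) (assoc_unit F P p)) =
    fiber_map x p).
  by rewrite assoc_unit_nat; exact: tf.
exists (@TfHom _ _ _ (BG_map F) q _ _ x y k1 k2 kb kc); split.
  exact: bundle_mor_ext.
move=> l lh.
have lb : bm_base (tfh_fst l) = bm_base h by rewrite -lh.
have lt : bm_total (tfh_fst l) = t by rewrite /t -lh.
apply: tf_hom_ext.
  exact: (@bundle_mor_ext _ G N N' P P' k1 (tfh_fst l) (esym lb) (esym lt)).
apply: repr_hom_ext; rewrite [LHS]/= -lb.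
exact: (tfh_base l).
Qed.

(** The anchor of [B] is an equivariant map to [Q]. It descends to a map [u] of
    the bases and extends to the induced bundle; the result lifts along the
    cartesian arrow from the pullback of [Q] along [u]. *)
Lemma fiber_functor_es N (B : ob (BG K) N) :
  exists (x : ob D N) (h : hom (fiber_functor N x) B),
    base h = cm_id N /\ is_iso h.
Proof.
pose P : principal_bundle G N := fag_bundle B.
pose f : cmap (total P) (total Q) := anchor (raction B).
have fa p : anchor r (f p) = anchor (raction P) p by [].
have fact p a (e : anchor (raction P) p = tgt G a)
    (e' : anchor (raction Q) (f p) = tgt H (mor1 F a)) :
    f (act (raction P) (fpmk e)) = act (raction Q) (fpmk e').
  have e1 : anchor (raction B) p = tgt K (fpmk (e : anchor r (f p) = _) : ag_arr r).
    by [].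
  rewrite [act _ (fpmk e)](fag_actE e e1) // /f anchor_act.
  exact: restr_funE.
have /choice[u uE] : forall n, exists m, forall p, proj P p = n -> proj Q (f p) = m.
  move=> n; have [p0 p0E] := local_sections_surj (proj_sections P) n.
  exists (proj Q (f p0)) => p pE; have [d dE] := bundle_divE P.
  have [e <-] := dE p0 p (etrans p0E (esym pE)).
  have e1 : anchor (raction Q) (f p0) = tgt H (mor1 F (d (fpmk (etrans p0E (esym pE))))).
    by rewrite mor_tgt F0.
  by rewrite (fact _ _ e e1) proj_act.
have up p : proj Q (f p) = u (proj P p) by exact: uE.
have cu : continuous u.
  apply: (local_sections_continuous (proj_sections P)).
  rewrite (_ : _ \o _ = fun p => proj Q (f p)); first by cont.
  by apply: funext => p; rewrite /= -up.
have fa' p : anchor (raction Q) (f p) = mor0 F (anchor (raction P) p).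
  by rewrite F0.
have [th [thb thE]] := @assoc_mor_ex _ _ _ _ F N P U Q (cm cu) f up fa' fact.
have [|al [alb alE]] := fib_liftE (@fibered_BG _ H)
   (h := th : @hom (BG H) _ _ (BG_map F N P) Q)
   (k := can_arr q (cm cu : ob (repstack U) N)) (f := cm_id N).
  by rewrite can_arr_base cm_compm1 -[base _]/(bm_base th) thb.
pose x : ob D N := @TfOb _ _ _ (BG_map F) q N P (cm cu) al alb.
have fx p : fiber_map x p = f p.
  by rewrite -thE -alE.
exists x.
have h1 p a (e : anchor (raction (fiber_bundle x)) p = tgt K a)
    (e' : anchor (raction B) (cm_id (total P) p) = tgt K a) :
    cm_id (total P) (act (raction (fiber_bundle x)) (fpmk e)) =
    act (raction B) (fpmk e').
  have e1 : anchor (raction (tf_fst x)) p = tgt G (fp2 (a : ag_arr r)).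
    exact: (agb_subproof (@fiber_map_anchor N x) (fpmk e)).
  apply: (etrans (fiber_bundle_actE e e1)).
  exact: (fag_actE e1 e').
pose h : bundle_mor (fiber_bundle x) B := @BundleMor _ K N N (fiber_bundle x) B
  (cm_id N) (cm_id (total P)) (fun p => erefl) (fun p => esym (fx p)) h1.
exists h; split=> //; exact: (fib_iso (@fibered_BG _ K)).
Qed.

Lemma fibration_stack_fiber (Fib : forall X Y : cgtop, cmap X Y -> Prop) :
  locally_fibration Fib (src K) -> fibration_stack Fib D.
Proof.
move=> LK; split.
  apply: (stack_of_ff_es fiber_functor_ff fiber_functor_es); exact: is_stack_BG.
exists (total Q), K; split=> //.
exact: (equivalent_of_ff_es fiber_functor_ff fiber_functor_es).
Qed.

End Fiber.

Lemma fibration_gerbe_BG_map (R : realType) (T : Type) (Z : T -> cgtop)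
  (M : cgtop) (G H : tgroupoid M) (F : tgroupoid_mor G H) :
  is_extension F -> locally_fibration (has_liftings R Z) (src G) ->
  fibration_gerbe (has_liftings R Z) (BG_map F).
Proof.
move=> [F0 F1] LG.
have F0E x : mor0 F x = x by rewrite F0.
split; first exact: is_gerbe_BG_map.
split; [exact: topological_stack_BG|exact: topological_stack_BG|] => U q.
apply: (@fibration_stack_fiber _ _ _ _ F0E).
exact: locally_fibration_pullback (src_action_groupoid_pullback _) LG.
Qed.

Theorem proposition5p1 (R : realType) (M : cgtop) (G H : tgroupoid M)
    (F : tgroupoid_mor G H) (hF : is_extension F) :
  (locally_fibration (@hurewicz_fibration R) (src G) ->
     hurewicz_gerbe R (BG_map F)) /\
  (locally_fibration (@serre_fibration R) (src G) ->
     serre_gerbe R (BG_map F)).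
Proof.
split=> LG.
  exact: (fibration_gerbe_BG_map (R := R) (Z := fun X : cgtop => X) hF LG).
exact: (fibration_gerbe_BG_map (R := R) (Z := cube R) hF LG).
Qed.
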